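(* Let $(P,\pi)$ be a regular Poisson manifold whose symplectic foliation $\mathcal F$ is transversally oriented. If $\mathcal F$ is a Riemannian foliation, then the modular class of $P$ vanishes: $mod(P)=0$ in $H^1_\pi(P)$.
   Context: A Poisson manifold $(P,\pi)$ is a smooth manifold with a Poisson bivector $\pi$; the bundle map $\pi:T^*P\to TP$ is defined by $\beta(\pi(\alpha))=\pi(\alpha,\beta)$. It is regular if this bundle map has constant rank; its symplectic foliation $\mathcal F$ is then the regular foliation with tangent bundle $T\mathcal F=\pi(T^*P)$. $\mathcal F$, of codimension $q$, is transversally oriented if there is a nowhere vanishing $q$-form $\nu$ on $P$ with $i_X\nu=0$ for all $X$ tangent to $\mathcal F$ (this makes $P$ orientable, since the leaves are symplectic). A foliation is Riemannian if there exists a bundle-like Riemannian metric $g$ on the manifold, i.e. one with $(L_Xg)(Y,Z)=0$ for every vector field $X$ tangent to $\mathcal F$ and all vector fields $Y,Z$ orthogonal to $\mathcal F$. Modular class: $H^1_\pi(P)$ denotes the first Poisson cohomology space, i.e. vector fields $\xi$ with $L_\xi\pi=0$ modulo Hamiltonian vector fields $\pi(df)$, $f\in C^\infty(P)$. For a volume form $\mu$ on $P$, the map $f\mapsto \mathrm{div}_\mu\,\pi(df)$, where $L_X\mu=(\mathrm{div}_\mu X)\mu$, is a derivation of $C^\infty(P)$, i.e. a vector field $\phi_\mu$ (the modular vector field). It satisfies $L_{\phi_\mu}\pi=0$ and its class in $H^1_\pi(P)$ does not depend on $\mu$; this class is the modular class $mod(P)$. *)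

(* Defs.v *)
From HB Require Import structures.
From mathcomp Require Import all_boot all_order all_algebra.
From mathcomp Require Import boolp classical_sets functions cardinality.
From mathcomp Require Import ring.
From mathcomp Require Import reals topology normedtype derive.

Set Implicit Arguments.
Unset Strict Implicit.
Unset Printing Implicit Defensive.

Import Order.TTheory GRing.Theory Num.Theory.
Import numFieldNormedType.Exports.

Local Open Scope classical_set_scope.
Local Open Scope ring_scope.

Section SmoothFunctionsOnRn.
Context {R : realType} {n : nat}.
Implicit Types (U : set 'rV[R]_n) (f g : 'rV[R]_n -> R).

(* All iterated partial derivatives of order at most [k] exist and are
   continuous at the points of [U]; meaningful only for open [U]. *)
Fixpoint Ck (k : nat) U f : Prop :=
  (forall x, U x -> {for x, continuous f}) /\
  if k is k'.+1 then
    forall i : 'I_n, (forall x, U x -> derivable f x (delta_mx 0 i)) /\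
                     Ck k' U ('D_(delta_mx 0 i) f)
  else True.

Definition smooth_on U f := forall k, Ck k U f.

Lemma CkW k U f : Ck k.+1 U f -> Ck k U f.
Proof.
elim: k f => [|k IH] f; first by case.
by move=> [fc fd]; split=> // i; have [? /IH] := fd i.
Qed.

Lemma near_eq_open U f g x :
  open U -> (forall y, U y -> f y = g y) -> U x -> {near x, f =1 g}.
Proof.
move=> oU fg Ux; have xU : nbhs x U by apply: open_nbhs_nbhs; split.
by move: xU; apply: filterS => y; exact: fg.
Qed.

Lemma eq_Ck k U f g :
  open U -> (forall y, U y -> f y = g y) -> Ck k U f -> Ck k U g.
Proof.
move=> oU; elim: k f g => [|k IH] f g fg [fc fd].
  split=> // x Ux; have fgx := near_eq_open oU fg Ux.
  rewrite /prop_for /continuous_at -(fg x)//.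
  exact: cvg_trans (near_eq_cvg fgx) (fc x Ux).
split=> [x Ux|i].
  have fgx := near_eq_open oU fg Ux.
  rewrite /prop_for /continuous_at -(fg x)//.
  exact: cvg_trans (near_eq_cvg fgx) (fc x Ux).
have [fi Di] := fd i; split=> [x Ux|].
  exact: near_eq_derivable (near_eq_open oU fg Ux) (fi x Ux).
apply: IH Di => x Ux; apply: near_eq_derive.
exact: near_eq_open oU fg Ux.
Qed.

Lemma Ck_cst k U (c : R) : open U -> Ck k U (cst c).
Proof.
move=> oU; elim: k c => [|k IH] c.
  by split=> // x _; exact: cst_continuous.
split=> [x _|i]; first exact: cst_continuous.
split=> [x _|]; first exact: derivable_cst.
by apply: eq_Ck (IH 0) => // y _; rewrite derive_cst.
Qed.

Lemma CkD k U f g : open U -> Ck k U f -> Ck k U g -> Ck k U (f \+ g).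
Proof.
move=> oU; elim: k f g => [|k IH] f g [fc fd] [gc gd].
  by split=> // x Ux; apply: continuousD; [exact: fc|exact: gc].
split=> [x Ux|i]; first by apply: continuousD; [exact: fc|exact: gc].
have [fi Dfi] := fd i; have [gi Dgi] := gd i; split=> [x Ux|].
  by apply: derivableD; [exact: fi|exact: gi].
apply: eq_Ck (IH _ _ Dfi Dgi) => // x Ux.
by rewrite (deriveD (fi x Ux) (gi x Ux)).
Qed.

Lemma CkM k U f g : open U -> Ck k U f -> Ck k U g -> Ck k U (f \* g).
Proof.
move=> oU; elim: k f g => [|k IH] f g fk gk.
  case: fk gk => [fc fd] [gc gd].
  by split=> // x Ux; apply: continuousM; [exact: fc|exact: gc].
have := fk; have := gk; move=> [gc gd] [fc fd].
split=> [x Ux|i]; first by apply: continuousM; [exact: fc|exact: gc].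
have [fi Dfi] := fd i; have [gi Dgi] := gd i; split=> [x Ux|].
  by apply: derivableM; [exact: fi|exact: gi].
apply: eq_Ck (CkD oU (IH _ _ (CkW fk) Dgi) (IH _ _ (CkW gk) Dfi)) => // x Ux.
by rewrite (deriveM (fi x Ux) (gi x Ux)).
Qed.

End SmoothFunctionsOnRn.

(* [fwd] and [bwd] are meaningful on [dom] and on [img] only. *)
Record chart (R : realType) (M : topologicalType) (n : nat) := Chart {
  dom : set M;
  fwd : M -> 'rV[R]_n;
  bwd : 'rV[R]_n -> M;
  img := fwd @` dom;
  open_dom : open dom;
  open_img : open img;
  fwdK : forall x, dom x -> bwd (fwd x) = x;
  fwd_continuous : forall x, dom x -> {for x, continuous fwd};
  bwd_continuous : forall y, img y -> {for y, continuous bwd} }.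

Definition compatible (R : realType) (M : topologicalType) (n : nat)
    (c1 c2 : chart R M n) :=
  forall i, smooth_on (fwd c1 @` (dom c1 `&` dom c2))
                      (fun y => fwd c2 (bwd c1 y) 0 i).

Arguments open_dom {R M n} c.
Arguments open_img {R M n} c.

(* Pure dimension [n], no boundary; the atlas need not be maximal. *)
Record manifold (R : realType) (n : nat) := Manifold {
  carrier :> topologicalType;
  atlas : set (chart R carrier n);
  hausdorff_carrier : hausdorff_space carrier;
  second_countable_carrier : @second_countable carrier;
  atlas_cover : forall x, exists2 c, atlas c & dom c x;
  atlas_compatible : forall c1 c2, atlas c1 -> atlas c2 -> compatible c1 c2 }.

Section SmoothFunctions.
Context {R : realType} {n : nat} (M : manifold R n).

Definition smooth : {pred M -> R^o} :=
  fun f => `[< forall c, atlas c -> smooth_on (img c) (f \o bwd c) >].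

Lemma smooth_submod_closed : submod_closed smooth.
Proof.
split=> [|a f g /asboolP fs /asboolP gs]; apply/asboolP => c ac k.
  exact: (Ck_cst k (0 : R) (open_img c)).
have oc := open_img c.
exact: CkD oc (CkM oc (Ck_cst k a oc) (fs c ac k)) (gs c ac k).
Qed.

Lemma smooth_subring_closed : subring_closed smooth.
Proof.
split=> [|f g fs gs|f g /asboolP fs /asboolP gs].
- by apply/asboolP => c ac k; exact: (Ck_cst k (1 : R) (open_img c)).
- rewrite addrC -scaleN1r; exact: smooth_submod_closed.2.
- apply/asboolP => c ac k; exact: CkM (open_img c) (fs c ac k) (gs c ac k).
Qed.

HB.instance Definition _ :=
  GRing.isSubringClosed.Build (M -> R^o) smooth smooth_subring_closed.
HB.instance Definition _ :=
  GRing.isSubmodClosed.Build R (M -> R^o) smooth smooth_submod_closed.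

Record Cinf := MkCinf { Cinf_fun :> M -> R^o; _ : Cinf_fun \in smooth }.

HB.instance Definition _ := [isSub for Cinf_fun].
HB.instance Definition _ := [Choice of Cinf by <:].
HB.instance Definition _ := 
  GRing.SubChoice_isSubComPzRing.Build (M -> R^o) smooth Cinf
    smooth_subring_closed.
HB.instance Definition _ := [SubZmodule_isSubLmodule of Cinf by <:].

Lemma Cinf_scaleE (a : R) (f : Cinf) : a *: f = (a *: (1 : Cinf)) * f.
Proof.
apply: val_inj; apply/funext => x; change (a * f x = (a * 1) * f x).
by rewrite mulr1.
Qed.

End SmoothFunctions.
Arguments smooth {R n} M _ : assert.

Section Dual.
Context {A : comPzRingType} (V : lmodType A).

Definition linear_pred : {pred V -> A^o} := fun u => `[< linear u >].

Lemma linear_pred_closed : submod_closed linear_pred.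
Proof.
split=> [|a u v /asboolP lu /asboolP lv]; apply/asboolP => b x y.
  by rewrite [LHS]/(0 : A^o) scaler0 addr0.
rewrite ![(a *: u + v) _]/(a *: u _ + v _) lu lv !scalerDr !scalerA mulrC.
by rewrite addrACA.
Qed.

HB.instance Definition _ :=
  GRing.isSubmodClosed.Build A (V -> A^o) linear_pred linear_pred_closed.

Record dual := Dual { dual_fun :> V -> A^o; _ : dual_fun \in linear_pred }.

HB.instance Definition _ := [isSub for dual_fun].
HB.instance Definition _ := [Choice of dual by <:].
HB.instance Definition _ := [SubChoice_isSubLmodule of dual by <:].

Lemma dual_linear (u : dual) : linear u.
Proof. by case: u => u /= /asboolP. Qed.

End Dual.
Arguments linear_pred {A} V _ : assert.

Section VectorFields.
Context {R : realType} {n : nat} (M : manifold R n).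
Local Notation A := (Cinf M).

(* Vector fields are the derivations of the real algebra of smooth functions;
   the value of [X] at [p] is the derivation [fun f => X f p] at [p].
   Tensor fields are the corresponding multilinear maps over [Cinf M]. *)
Definition derivation : {pred A -> A^o} := fun X =>
  `[< (forall (a : R) (f g : A), X (a *: f + g) = a *: (X f : A) + X g) /\
      (forall f g : A, X (f * g) = X f * g + f * X g) >].

Lemma derivation_closed : submod_closed derivation.
Proof.
split=> [|a X Y /asboolP[lX dX] /asboolP[lY dY]]; apply/asboolP; split.
- by move=> a f g; rewrite ![0 _]/(0 : A) scaler0 addr0.
- by move=> f g; rewrite ![0 _]/(0 : A) mul0r mulr0 addr0.
- move=> b f g; rewrite ![(a *: X + Y) _]/(a * X _ + Y _) lX lY.
  rewrite scalerDr mulrDr addrACA; congr (_ + _ + _).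
  by rewrite Cinf_scaleE [RHS]Cinf_scaleE mulrCA.
- move=> f g; rewrite ![(a *: X + Y) _]/(a * X _ + Y _) dX dY.
  by rewrite !mulrDr mulrDl addrACA !mulrA (mulrC f a).
Qed.

HB.instance Definition _ :=
  GRing.isSubmodClosed.Build A (A -> A^o) derivation derivation_closed.

Record vfield := Vfield { vfield_fun :> A -> A^o; _ : vfield_fun \in derivation }.

HB.instance Definition _ := [isSub for vfield_fun].
HB.instance Definition _ := [Choice of vfield by <:].
HB.instance Definition _ := [SubChoice_isSubLmodule of vfield by <:].

Lemma vfieldP (X : vfield) :
  (forall (a : R) (f g : A), X (a *: f + g) = a *: (X f : A) + X g) /\
  (forall f g : A, X (f * g) = X f * g + f * X g).
Proof. by case: X => X /= /asboolP. Qed.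

End VectorFields.
Arguments derivation {R n} M _ : assert.

Section TensorCalculus.
Context {R : realType} {n : nat} {M : manifold R n}.
Local Notation A := (Cinf M).
Local Notation vfield := (vfield M).
(* Every covector at [p] is the value at [p] of some 1-form. *)
Local Notation oneform := (dual vfield).

Lemma differential_subproof (f : A) :
  ((fun X : vfield => X f) : vfield -> A^o) \in linear_pred vfield.
Proof. by apply/asboolP. Qed.

Definition differential (f : A) : oneform := Dual (differential_subproof f).

Lemma differentialD (a : R) (f g : A) :
  differential (a *: f + g) = (a *: (1 : A)) *: differential f + differential g.
Proof.
apply: val_inj; apply/funext => X; rewrite /= (vfieldP X).1 Cinf_scaleE.
by [].
Qed.

Lemma differentialM (f g : A) :
  differential (f * g) = g *: differential f + f *: differential g.
Proof.
apply: val_inj; apply/funext => X; rewrite /= (vfieldP X).2 mulrC.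
by [].
Qed.

Lemma lie_bracket_subproof (X Y : vfield) :
  ((fun f => X (Y f) - Y (X f)) : A -> A^o) \in derivation M.
Proof.
have [lX dX] := vfieldP X; have [lY dY] := vfieldP Y.
have aD (Z : vfield) (f g : A) : Z (f + g) = Z f + Z g.
  by have := (vfieldP Z).1 1 f g; rewrite !scale1r.
apply/asboolP; split=> [a f g|f g].
  by rewrite lX lY lX lY scalerBr opprD addrACA.
rewrite dX dY !aD !dX !dY.
ring.
Qed.

Definition lie_bracket (X Y : vfield) : vfield :=
  Vfield (lie_bracket_subproof X Y).

Lemma lie_bracket_linr (X Y Z : vfield) (a : A) :
  lie_bracket X (a *: Y + Z) =
  X a *: Y + (a *: lie_bracket X Y + lie_bracket X Z).
Proof.
apply: val_inj; apply/funext => f.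
have aD (g h : A) : X (g + h) = X g + X h.
  by have := (vfieldP X).1 1 g h; rewrite !scale1r.
change (X (a * Y f + Z f) - (a * Y (X f) + Z (X f)) =
  X a * Y f + (a * (X (Y f) - Y (X f)) + (X (Z f) - Z (X f)))).
by rewrite aD (vfieldP X).2; ring.
Qed.

Lemma lie_oneform_subproof (X : vfield) (al : oneform) :
  ((fun Y => X (al Y) - al (lie_bracket X Y)) : vfield -> A^o)
    \in linear_pred vfield.
Proof.
apply/asboolP => a Y Z; rewrite lie_bracket_linr !dual_linear.
have aD (g h : A) : X (g + h) = X g + X h.
  by have := (vfieldP X).1 1 g h; rewrite !scale1r.
change (X (a * al Y + al Z) - (X a * al Y + (a * al (lie_bracket X Y)
     + al (lie_bracket X Z))) =
  a * (X (al Y) - al (lie_bracket X Y)) + (X (al Z) - al (lie_bracket X Z))).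
by rewrite aD (vfieldP X).2; ring.
Qed.

Definition lie_oneform (X : vfield) (al : oneform) : oneform :=
  Dual (lie_oneform_subproof X al).

Definition update {q} (Y : 'I_q -> vfield) (i : 'I_q) (X : vfield) :=
  fun j => if j == i then X else Y j.

Record form (q : nat) := Form {
  form_fun :> ('I_q -> vfield) -> A^o;
  form_linear : forall Y i, linear (fun X => form_fun (update Y i X));
  form_alternating : forall Y i j, i != j -> Y i = Y j -> form_fun Y = 0 }.

Definition nowhere_vanishing q (w : form q) :=
  forall p : M, exists Y, w Y p != 0.

Definition lie_form q (X : vfield) (w : form q) : ('I_q -> vfield) -> A :=
  fun Y => X (w Y) - \sum_(i < q) w (update Y i (lie_bracket X (Y i))).

(* Smooth sections of the second exterior power of the tangent bundle. *)
Record bivector := Bivector {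
  bivector_fun :> oneform -> oneform -> A^o;
  bivector_linearl : forall be, linear (bivector_fun ^~ be);
  bivector_linearr : forall al, linear (bivector_fun al);
  bivector_alternating : forall al, bivector_fun al al = 0 }.

Definition lie_bivector (X : vfield) (pi : bivector) (al be : oneform) : A :=
  X (pi al be) - pi (lie_oneform X al) be - pi al (lie_oneform X be).

Lemma sharp_subproof (pi : bivector) (al : oneform) :
  ((fun f => pi al (differential f)) : A -> A^o) \in derivation M.
Proof.
apply/asboolP; split=> [a f g|f g].
  rewrite differentialD bivector_linearr; congr (_ + _).
  by rewrite [RHS]Cinf_scaleE.
rewrite differentialM bivector_linearr.
rewrite (scalable_linear (bivector_linearr pi al)).
by congr (_ + _); exact: mulrC.
Qed.

(* The bundle map: the vector field [sharp pi al] is determined by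
   [be (sharp pi al) = pi al be] for the exact 1-forms [be = differential f]. *)
Definition sharp (pi : bivector) (al : oneform) : vfield :=
  Vfield (sharp_subproof pi al).

Definition hamiltonian_vf (pi : bivector) (f : A) : vfield :=
  sharp pi (differential f).

(* Jacobi identity for [{f, g} = pi(df, dg)], i.e. [[pi, pi] = 0]. *)
Definition is_poisson (pi : bivector) :=
  let br f g : A := pi (differential f) (differential g) in
  forall f g h, br f (br g h) + br g (br h f) + br h (br f g) = 0.

End TensorCalculus.
Arguments form {R n} M q.
Arguments bivector {R n} M.

Section PoissonCohomology.
Context {R : realType} {n : nat} {M : manifold R n} (pi : bivector M).
Local Notation A := (Cinf M).

Definition poisson_vf_pred : {pred vfield M} :=
  fun X => `[< forall al be, lie_bivector X pi al be = 0 >].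

Lemma lie_bivectorB (X Y : vfield M) al be :
  lie_bivector (X - Y) pi al be =
  lie_bivector X pi al be - lie_bivector Y pi al be.
Proof.
have lieB ga : lie_oneform (X - Y) ga = lie_oneform X ga - lie_oneform Y ga.
  apply: val_inj; apply/funext => Z.
  have brB : lie_bracket (X - Y) Z = lie_bracket X Z - lie_bracket Y Z.
    apply: val_inj; apply/funext => f.
    have ZB (g h : A) : Z (g - h) = Z g - Z h.
      have := (vfieldP Z).1 (-1) h g.
      by rewrite !scaleN1r addrC => ->; rewrite addrC.
    change (X (Z f) - Y (Z f) - Z (X f - Y f) =
      X (Z f) - Z (X f) - (Y (Z f) - Z (Y f))).
    by rewrite ZB; ring.
  have gaB := zmod_morphism_linear (dual_linear ga).
  change (X (ga Z) - Y (ga Z) - ga (lie_bracket (X - Y) Z) =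
    X (ga Z) - ga (lie_bracket X Z) - (Y (ga Z) - ga (lie_bracket Y Z))).
  by rewrite brB gaB; ring.
have piBl := zmod_morphism_linear (bivector_linearl pi be).
have piBr := zmod_morphism_linear (bivector_linearr pi al).
rewrite /lie_bivector !lieB piBr piBl.
change (X (pi al be) - Y (pi al be) -
    (pi (lie_oneform X al) be - pi (lie_oneform Y al) be) -
    (pi al (lie_oneform X be) - pi al (lie_oneform Y be)) =
  X (pi al be) - pi (lie_oneform X al) be - pi al (lie_oneform X be) -
  (Y (pi al be) - pi (lie_oneform Y al) be - pi al (lie_oneform Y be))).
by ring.
Qed.

Lemma poisson_vf_closed : zmod_closed poisson_vf_pred.
Proof.
have B X Y : X \in poisson_vf_pred -> Y \in poisson_vf_pred ->
    X - Y \in poisson_vf_pred.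
  move=> /asboolP PX /asboolP PY; apply/asboolP => al be.
  by rewrite lie_bivectorB PX PY subrr.
split=> //; apply/asboolP => al be.
by rewrite -[X in lie_bivector X](subrr 0) lie_bivectorB subrr.
Qed.

HB.instance Definition _ :=
  GRing.isZmodClosed.Build (vfield M) poisson_vf_pred poisson_vf_closed.

Record poisson_vf := PoissonVf {
  poisson_vf_val :> vfield M; _ : poisson_vf_val \in poisson_vf_pred }.

HB.instance Definition _ := [isSub for poisson_vf_val].
HB.instance Definition _ := [Choice of poisson_vf by <:].
HB.instance Definition _ := [SubChoice_isSubZmodule of poisson_vf by <:].

Definition hamiltonian_pred : {pred poisson_vf} :=
  fun X => `[< exists f : A, X = hamiltonian_vf pi f :> vfield M >].

Lemma hamiltonian_vfB (f g : A) :
  hamiltonian_vf pi (f - g) = hamiltonian_vf pi f - hamiltonian_vf pi g.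
Proof.
have dB : differential (f - g) = differential f - differential g.
  apply: val_inj; apply/funext => X.
  have := (vfieldP X).1 (-1) g f; rewrite !scaleN1r addrC => XB.
  by rewrite /= XB addrC.
apply: val_inj; apply/funext => h.
change (pi (differential (f - g)) (differential h) =
  pi (differential f) (differential h) - pi (differential g) (differential h)).
by rewrite dB (zmod_morphism_linear (bivector_linearl pi _)).
Qed.

Lemma hamiltonian_closed : zmod_closed hamiltonian_pred.
Proof.
have B X Y : X \in hamiltonian_pred -> Y \in hamiltonian_pred ->
    X - Y \in hamiltonian_pred.
  move=> /asboolP[f Xf] /asboolP[g Yg]; apply/asboolP; exists (f - g).
  by rewrite hamiltonian_vfB -Xf -Yg.
split=> //; apply/asboolP; exists 0.
by rewrite -[X in hamiltonian_vf pi X](subrr 0) hamiltonian_vfB subrr.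
Qed.

HB.instance Definition _ :=
  GRing.isZmodClosed.Build poisson_vf hamiltonian_pred hamiltonian_closed.

Definition H1 := Quotient.quot hamiltonian_pred.

HB.instance Definition _ := GRing.Zmodule.on H1.

Definition H1_class (X : poisson_vf) : H1 :=
  (\pi_(Quotient.quot hamiltonian_pred) X)%qT.

Definition is_volume_form (mu : form M n) := nowhere_vanishing mu.

Lemma H1_class_eq0 (X : poisson_vf) :
  H1_class X = 0 <-> exists f, X = hamiltonian_vf pi f :> vfield M.
Proof.
have -> : (0 : H1) = (\pi_(Quotient.quot hamiltonian_pred) 0)%qT.
  by rewrite -[LHS]/(Quotient.zero hamiltonian_pred) /Quotient.zero -lock.
by split=> [/eqP|h]; [|apply/eqP]; rewrite -Quotient.idealrBE subr0;
  [move/asboolP|apply/asboolP].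
Qed.

(* [h = div_mu X] *)
Definition is_divergence (mu : form M n) (X : vfield M) (h : A) :=
  forall Y, lie_form X mu Y = h * mu Y.

(* [phi = phi_mu] *)
Definition is_modular_vf (mu : form M n) (phi : vfield M) :=
  forall f : A, is_divergence mu (hamiltonian_vf pi f) (phi f).

(* [c = mod(M)] *)
Definition is_modular_class (c : H1) :=
  exists (mu : form M n) (phi : poisson_vf),
    [/\ is_volume_form mu, is_modular_vf mu phi & c = H1_class phi].

End PoissonCohomology.
Arguments poisson_vf_pred {R n M} pi _ : assert.
Arguments hamiltonian_pred {R n M} pi _ : assert.

Section SymplecticFoliation.
Context {R : realType} {n : nat} {M : manifold R n}.
Implicit Types (pi : bivector M) (X Y Z : vfield M).

(* The bundle map of [pi] has rank [r] at [p]: the values at [p] of the vector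
   fields [sharp pi (al i)], [i < r], form a basis of its image. *)
Definition rank_at pi (p : M) (r : nat) :=
  exists al : 'I_r -> dual (vfield M),
    (forall c : 'I_r -> R,
       (forall f, \sum_i c i * sharp pi (al i) f p = 0) -> forall i, c i = 0) /\
    (forall be, exists c : 'I_r -> R,
       forall f, sharp pi be f p = \sum_i c i * sharp pi (al i) f p).

Definition constant_rank pi (r : nat) := forall p, rank_at pi p r.

(* At each [p], the value of [X] lies in the image of the bundle map at [p]. *)
Definition tangent pi X :=
  forall p, exists al, forall f, X f p = sharp pi al f p.

(* The interior product is taken in an arbitrary slot. *)
Definition transversally_oriented pi (q : nat) :=
  exists2 nu : form M q, nowhere_vanishing nu &
    forall (Y : 'I_q -> vfield M) i, tangent pi (Y i) -> nu Y = 0.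

Record metric := Metric {
  metric_fun :> vfield M -> vfield M -> (Cinf M)^o;
  metric_linear : forall X, linear (metric_fun X);
  metric_sym : forall X Y, metric_fun X Y = metric_fun Y X;
  metric_pos : forall X (f : Cinf M) (p : M), X f p != 0 ->
    0 < (metric_fun X X : Cinf M) p :> R }.

Definition lie_metric X (g : metric) Y Z : Cinf M :=
  X (g Y Z) - g (lie_bracket X Y) Z - g Y (lie_bracket X Z).

Definition orthogonal pi (g : metric) Y := forall X, tangent pi X -> g X Y = 0.

Definition bundle_like pi (g : metric) :=
  forall X Y Z, tangent pi X -> orthogonal pi g Y -> orthogonal pi g Z ->
    lie_metric X g Y Z = 0.

Definition riemannian_foliation pi := exists g, bundle_like pi g.

End SymplecticFoliation.

(* Main.v *)
(* Let g be a bundle-like metric and mu a volume form.  Evaluate mu on tuples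
   (X_{f_1}, ..., X_{f_r}, N_1, ..., N_q) made of Hamiltonian fields and of
   fields orthogonal to the foliation.  On a change of such a frame both
   mu(X_f, N)^2 and det {f_i, f_j} * det g(N_i, N_j) are multiplied by the square
   of the determinant of the change, so that they differ by a nowhere vanishing
   function lambda that does not depend on the frame.  The brackets {f_i, f_j}
   evolve along X_h by the Jacobi identity, and the g(N_i, N_j) because g is
   bundle-like; differentiating the relation along X_h then gives
   2 lambda div_mu X_h = X_h lambda, i.e. the modular field of mu is Hamiltonian
   with Hamiltonian function - (ln lambda^2) / 4.

   A volume form is obtained from the q-form nu by antisymmetrizing eta^k * nu,
   where 2k = r and eta is pi with its indices lowered by g.

   Besides the smoothness of quotients, the only facts about charts that are
   needed are that the vector fields are locally generated by n of them, with
   coefficients X(x_1), ..., X(x_n), and that X (ln u) = X u / u.  Both follow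
   from Hadamard's lemma, bump functions and the chain rule. *)

From HB Require Import structures.
From mathcomp Require Import all_boot all_order all_algebra all_fingroup.
From mathcomp Require Import boolp classical_sets functions.
From mathcomp Require Import ring lra.
From mathcomp Require Import reals constructive_ereal topology normedtype.
From mathcomp Require Import derive realfun sequences exp.
From mathcomp Require Import measure lebesgue_measure lebesgue_integral ftc.
Require Import Defs.

Set Implicit Arguments.
Unset Strict Implicit.
Unset Printing Implicit Defensive.

Import Order.TTheory GRing.Theory Num.Theory.
Import numFieldNormedType.Exports.

Local Open Scope classical_set_scope.
Local Open Scope ring_scope.

(** * Functions of class C^k *)

Section Cktheory.
Context {R : realType} {n : nat}.
Implicit Types (U V : set 'rV[R]_n) (f g : 'rV[R]_n -> R).

(** The relation defining lambda has to be differentiated, but a frame is only known to be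
    independent at one point. The relation is therefore proved as an identity of functions on all of
    [M], for arbitrary [f] and for [N] orthogonal everywhere: where the tuple degenerates, both
    sides vanish. Thus no field has to be restricted to an open set. The derivative along X_h is
    then computed at the chosen point from two matrices: [K], the components of the [X_h, X_{f_i}]
    along the X_{f_j}, and the normal block of [C], the components of the [X_h, N_i] along the N_j.
    The product of the two determinants has logarithmic derivative 2 (tr K + tr C), while L_{X_h} mu
    differs from the derivative of the function mu (X_f, N) by (tr K + tr C) mu (X_f, N). The traces
    cancel and only X_h lambda remains. The tangential components of [X_h, N_i] contribute to
    neither side, which is why nothing needs to be known about them. *)

Lemma Ck_continuous k U f x : Ck k U f -> U x -> {for x, continuous f}.
Proof. by case: k => [|k] [fc _]; exact: fc. Qed.

Lemma CkWle j k U f : (j <= k)%N -> Ck k U f -> Ck j U f.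
Proof.
move=> /subnK <-; elim: (k - j)%N => // d IH; rewrite addSn => /CkW; exact: IH.
Qed.

Lemma Ck_sub k U V f : V `<=` U -> Ck k U f -> Ck k V f.
Proof.
move=> VU; elim: k f => [|k IH] f [fc fd]; split=> [x /VU|].
- exact: fc.
- by [].
- exact: fc.
- by move=> i; have [fi Di] := fd i; split=> [x /VU|]; [exact: fi|exact: IH].
Qed.

Lemma Ck_local k U f :
  (forall x, U x -> exists2 V, V x & Ck k V f) -> Ck k U f.
Proof.
elim: k f => [|k IH] f H.
  by split=> // x /H[V Vx [fc _]]; exact: fc.
split=> [x /H[V Vx [fc _]]|]; first exact: fc.
move=> i; split=> [x /H[V Vx [_ fd]]|]; first by have [fi _] := fd i; exact: fi.
by apply: IH => x /H[V Vx [_ fd]]; exists V => //; have [] := fd i.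
Qed.

Lemma CkN k U f : open U -> Ck k U f -> Ck k U (fun x => - f x).
Proof.
move=> oU fk; apply: eq_Ck (CkM oU (Ck_cst k (-1) oU) fk) => // y _ /=.
by rewrite mulN1r.
Qed.

Lemma CkB k U f g : open U -> Ck k U f -> Ck k U g -> Ck k U (fun x => f x - g x).
Proof. by move=> oU fk gk; exact: CkD oU fk (CkN oU gk). Qed.

Lemma Ck_sum k U (I : Type) (s : seq I) (F : I -> 'rV[R]_n -> R) : open U ->
  (forall i, Ck k U (F i)) -> Ck k U (fun x => \sum_(i <- s) F i x).
Proof.
move=> oU H; elim: s => [|i s IH].
  by apply: eq_Ck (Ck_cst k 0 oU) => // y _ /=; rewrite big_nil.
by apply: eq_Ck (CkD oU (H i) IH) => // y _ /=; rewrite big_cons.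
Qed.

Lemma is_derive_coord (x v : 'rV[R]_n) i :
  is_derive x v (fun y : 'rV[R]_n => y 0 i) (v 0 i).
Proof.
have E : (fun h : R => h^-1 *: (((fun y : 'rV[R]_n => y 0 i) \o shift x) (h *: v)
     - x 0 i)) @ 0^' --> v 0 i.
  apply: cvg_near_cst; near=> h.
  have h0 : h != 0 by near: h; exact: nbhs_dnbhs_neq.
  by rewrite /= !mxE addrK /GRing.scale /= mulKf.
split; last exact: cvg_lim E.
by apply/cvg_ex; exists (v 0 i).
Unshelve. all: by end_near. Qed.

Lemma Ck_coord k U i : open U -> Ck k U (fun y => y 0 i).
Proof.
move=> oU; case: k => [|k]; split=> //=.
- by move=> x _; exact: coord_continuous.
- by move=> x _; exact: coord_continuous.
move=> j; split=> [x _|]; first by have [] := is_derive_coord x (delta_mx 0 j) i.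
apply: eq_Ck (Ck_cst k ((j == i)%:R) oU) => // y _ /=.
have [_ ->] := is_derive_coord y (delta_mx 0 j) i.
by rewrite mxE eqxx eq_sym.
Qed.

(** Reduces directional derivatives to one real variable, where the chain rule [is_derive1_comp] is
    available. *)
Lemma is_derive_line f (x v : 'rV[R]_n) d :
  is_derive x v f d <-> is_derive (0 : R) 1 (fun h : R => f (h *: v + x)) d.
Proof.
have E : (fun h : R => h^-1 *: ((f \o shift x) (h *: v) - f x)) =
   (fun h : R => h^-1 *: (((fun h : R => f (h *: v + x)) \o shift 0) (h *: 1)
     - f (0 *: v + x))).
  by apply/funext => h; rewrite /= addr0 scale0r add0r [h *: 1]mulr1.
by split=> -[]; rewrite /derivable /derive => c d'; split; move: c d';
  rewrite /derivable /derive E.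
Qed.

(* The class [S] stands for the successive derivatives of [phi], which need not
   be named. *)
Lemma Ck_comp1 (S : (R -> R) -> Prop) (W : set R) k U f (phi : R -> R) :
  open U ->
  (forall phi, S phi -> exists2 phi', S phi' &
     forall t, W t -> is_derive t 1 phi (phi' t)) ->
  S phi -> (forall x, U x -> W (f x)) -> Ck k U f -> Ck k U (phi \o f).
Proof.
move=> oU HS; elim: k phi f => [|k IH] phi f Sphi fW fk.
all: have fc x (Ux : U x) : {for x, continuous f} := Ck_continuous fk Ux.
all: have pc x (Ux : U x) : {for f x, continuous phi}.
1,3: have [phi' _ /(_ _ (fW _ Ux)) pd] := HS _ Sphi;
     by apply: differentiable_continuous; apply/derivable1_diffP; exact: ex_derive.
all: have pfc x : U x -> {for x, continuous (phi \o f)}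
  by move=> Ux; apply: continuous_comp; [exact: fc|exact: pc].
  by split.
split=> // i.
have [phi' Sphi' pd] := HS _ Sphi.
have [_ /(_ i)[fi Di]] := fk.
have D x : U x -> is_derive x (delta_mx 0 i) (phi \o f)
    (phi' (f x) * 'D_(delta_mx 0 i) f x).
  move=> Ux; have pdx := pd _ (fW _ Ux).
  apply/is_derive_line; apply: is_derive1_comp.
    by rewrite scale0r add0r; exact: pdx.
  by apply/is_derive_line; split=> //; exact: fi.
split=> [x Ux|]; first by have [] := D _ Ux.
apply: eq_Ck (CkM oU (IH _ _ Sphi' fW (CkW fk)) Di) => // x Ux /=.
by have [_ ->] := D _ Ux.
Unshelve. all: by end_near. Qed.

End Cktheory.

(** * First-order factorization of a C^1 function *)

Section Caratheodory.
Context {R : realType} {n : nat}.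

Lemma rV_nbhsP (A : set 'rV[R]_n) (x : 'rV[R]_n) : nbhs x A <->
  exists2 d : R, 0 < d & forall y : 'rV[R]_n, (forall k, `|x 0 k - y 0 k| < d) -> A y.
Proof.
split=> [/nbhs_ballP[d /= d0 H]|[d d0 H]].
  by exists d => // y xy; apply: H; split=> // i j; rewrite (ord1 i); exact: xy.
by apply/nbhs_ballP; exists d => //= y [_ xy]; apply: H => k; exact: xy.
Qed.

Lemma rV_openP (A : set 'rV[R]_n) (x : 'rV[R]_n) : open A -> A x ->
  exists2 d : R, 0 < d & forall y : 'rV[R]_n, (forall k, `|x 0 k - y 0 k| < d) -> A y.
Proof. by move=> oA Ax; apply/rV_nbhsP; apply: open_nbhs_nbhs; split. Qed.

Lemma rV_cvgP (f : 'rV[R]_n -> R) (x : 'rV[R]_n) l : f y @[y --> x] --> l <->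
  forall e, 0 < e -> exists2 d : R, 0 < d &
    forall y : 'rV[R]_n, (forall k, `|x 0 k - y 0 k| < d) -> `|l - f y| <= e.
Proof.
have P := @cvgrPdist_le _ _ _ _ (nbhs_filter x) f l.
split=> [/P H e /H /rV_nbhsP //|H].
by apply/P => e /H /rV_nbhsP.
Qed.
Implicit Types (U V : set 'rV[R]_n) (f g : 'rV[R]_n -> R).

Lemma is_derive_affine f (p v : 'rV[R]_n) (d t D : R) :
  is_derive ((t * d) *: v + p) v f D ->
  is_derive t 1 (fun s : R => f ((s * d) *: v + p)) (D * d).
Proof.
move=> /is_derive_line H.
pose g := fun s : R => (s - t) * d.
have -> : (fun s : R => f ((s * d) *: v + p)) =
   (fun h : R => f (h *: v + ((t * d) *: v + p))) \o g.
  by apply/funext => s /=; rewrite addrA -scalerDl -mulrDl subrK.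
have H' : is_derive (g t) 1
  (fun h : R => f (h *: v + ((t * d) *: v + p))) D by rewrite /g subrr mul0r.
have g' : is_derive t 1 g (d : R).
  have -> : g = (fun s : R => d *: (s - t)).
    by apply/funext => s; rewrite /g /GRing.scale /= mulrC.
  apply: is_derive_eq; by rewrite /GRing.scale /= subr0 mulr1.
exact: is_derive1_comp.
Qed.

(* Telescoping along the coordinates: [G i] is a difference quotient in the
   [i]-th coordinate, continuous at [x] by the mean value theorem. *)
Lemma C1_caratheodory U f x : open U -> U x -> Ck 1 U f ->
  exists G : 'I_n -> 'rV[R]_n -> R,
  [/\ forall i, {for x, continuous (G i)},
      forall i, G i x = 'D_(delta_mx 0 i) f x &
      forall y, f y - f x = \sum_i (y 0 i - x 0 i) * G i y].
Proof.
move=> oU Ux [fc fd].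
pose p (j : nat) (y : 'rV[R]_n) : 'rV[R]_n :=
  \row_k (if (k < j)%N then y 0 k else x 0 k).
have pS (j : 'I_n) y : p j.+1 y = (y 0 j - x 0 j) *: delta_mx 0 j + p j y.
  apply/rowP => k; rewrite !mxE eqxx /= ltnS leq_eqVlt.
  have [->|kj] := eqVneq k j; first by rewrite eqxx ltnn /= mulr1 subrK.
  by rewrite -val_eqE /= in kj; rewrite (negbTE kj) /= mulr0 add0r.
pose G (j : 'I_n) (y : 'rV[R]_n) : R := if y 0 j == x 0 j then 'D_(delta_mx 0 j) f x
  else (f (p j.+1 y) - f (p j y)) / (y 0 j - x 0 j).
exists G; split=> [j|j|y].
- have [fj [Dc _]] := fd j.
  have Gx : G j x = 'D_(delta_mx 0 j) f x by rewrite /G eqxx.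
  suff : G j y @[y --> x] --> G j x by [].
  rewrite Gx; apply/rV_cvgP => e e0.
  have /rV_cvgP/(_ e e0)[d1 d10 Hd1] :
    'D_(delta_mx 0 j) f y @[y --> x] --> 'D_(delta_mx 0 j) f x by exact: Dc.
  have [d2 d20 Hd2] := rV_openP oU Ux.
  pose d := Num.min d1 d2; have d0 : 0 < d by rewrite lt_min d10.
  have Hd (y : 'rV[R]_n) : (forall k, `|x 0 k - y 0 k| < d) ->
      U y /\ `|'D_(delta_mx 0 j) f x - 'D_(delta_mx 0 j) f y| <= e.
    by move=> xy; split; [apply: Hd2|apply: Hd1] => k; have := xy k;
      rewrite lt_min => /andP[].
  exists d => // y xy.
  rewrite /G; case: ifP => [_|/negbT yx]; first by rewrite subrr normr0 ltW.
  have yx0 : y 0 j - x 0 j != 0 by rewrite subr_eq0.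
  pose z (t : R) : 'rV[R]_n := (t * (y 0 j - x 0 j)) *: delta_mx 0 j + p j y.
  have zb (t : R) : 0 <= t <= 1 -> forall k, `|x 0 k - z t 0 k| < d.
    move=> /andP[t0 t1] k; rewrite !mxE eqxx /=.
    have := xy k => xyk.
    have [->|kj] := eqVneq k j; last first.
      by rewrite mulr0 add0r; case: ifP => _; rewrite // subrr normr0.
    rewrite ltnn mulr1 opprD addrCA subrr addr0 normrN normrM ger0_norm//.
    apply: le_lt_trans (xy j); rewrite distrC.
    by rewrite ler_piMl.
  have zd (t : R) : 0 <= t <= 1 -> is_derive t 1 (f \o z)
      ('D_(delta_mx 0 j) f (z t) * (y 0 j - x 0 j)).
    move=> /zb /Hd[Uz _]; apply: is_derive_affine; split=> //; exact: fj.
  have [||c] := @MVT_segment _ (f \o z)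
    (fun t => 'D_(delta_mx 0 j) f (z t) * (y 0 j - x 0 j)) 0 1 ler01.
  - by move=> t /[!in_itv] /= /andP[t0 t1]; apply: zd; rewrite !ltW.
  - apply: derivable_within_continuous => t; rewrite in_itv /= => t01.
    by have := zd t t01; case.
  rewrite in_itv /= => c01.
  rewrite /= /z mul1r mul0r scale0r add0r -pS subr0 mulr1 => ->.
  by rewrite mulfK//; have [_] := Hd _ (zb _ c01).
- by rewrite /G eqxx.
have -> : f y - f x = \sum_(j < n) (f (p j.+1 y) - f (p j y)).
  rewrite -(big_mkord xpredT (fun j => f (p j.+1 y) - f (p j y))).
  rewrite telescope_sumr//; congr (f _ - f _); apply/rowP => k; rewrite mxE //.
  by rewrite ltn_ord.
apply: eq_bigr => j _; rewrite /G.
case: eqVneq => [yx|yx]; last by rewrite mulrC divfK// subr_eq0.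
by rewrite pS yx subrr scale0r add0r mul0r subrr.
Qed.

End Caratheodory.

(** * Chain rule and composition in several variables *)

Section Ckcomp.
Context {R : realType}.

Lemma rV_continuous (V : topologicalType) m (T : V -> 'rV[R]_m) y :
  (forall j, {for y, continuous (fun v => T v 0 j)}) -> {for y, continuous T}.
Proof.
move=> Tc; apply/cvg_ballP => e e0.
near=> z; split=> // i j; rewrite (ord1 i); move: j; near: z.
apply: filter_forall => j; have := Tc j.
by rewrite /prop_for /continuous_at => /cvg_ballP /(_ e e0).
Unshelve. all: by end_near. Qed.

(** The factorization of [f] turns the difference quotient of [f \o T] into a sum of values
    [G j (T _)] times difference quotients of the coordinates of [T]; continuity of [T] and
    directional derivatives of its coordinates then give the limit. *)
Lemma is_derive_chain (V : normedModType R) m (U : set 'rV[R]_m)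
    (f : 'rV[R]_m -> R) (T : V -> 'rV[R]_m) (y v : V) :
  open U -> Ck 1 U f -> U (T y) -> {for y, continuous T} ->
  (forall j, derivable (fun z => T z 0 j) y v) ->
  is_derive y v (f \o T)
    (\sum_j 'D_(delta_mx 0 j) f (T y) * 'D_v (fun z => T z 0 j) y).
Proof.
move=> oU f1 UTy Tc Td.
have [G [Gc Gx GE]] := C1_caratheodory oU UTy f1.
have H : (fun h : R => h^-1 *: (((f \o T) \o shift y) (h *: v) - (f \o T) y))
   @ 0^' --> \sum_j 'D_(delta_mx 0 j) f (T y) * 'D_v (fun z => T z 0 j) y.
  have -> : (fun h : R => h^-1 *: (((f \o T) \o shift y) (h *: v) - (f \o T) y)) =
     (fun h => \sum_(j < m) G j (T (h *: v + y)) *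
         (h^-1 *: (((fun z => T z 0 j) \o shift y) (h *: v) - T y 0 j))).
    apply/funext => h /=; rewrite GE scaler_sumr; apply: eq_bigr => j _.
    by rewrite mulrC -scalerAr.
  apply: cvg_big => [|j _]; first by apply: add_continuous.
  apply: cvgM; last exact: Td.
  rewrite -Gx; apply: (@cvg_comp _ _ _ (fun h : R => T (h *: v + y)) (G j)); last exact: Gc.
  apply: (@cvg_comp _ _ _ (fun h : R => h *: v + y) T); last exact: Tc.
  have : (fun h : R => h *: v + y) @ 0^' --> (0 : R) *: v + y.
    apply: cvg_within_filter; apply: cvgD; last exact: cvg_cst.
    exact: scalel_continuous.
  by rewrite scale0r add0r.
by split; [apply/cvg_ex; eexists; exact: H | exact: cvg_lim H].
Qed.

Lemma Ck_comp n m k (U : set 'rV[R]_n) (V : set 'rV[R]_m)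
    (T : 'rV[R]_n -> 'rV[R]_m) f :
  open U -> open V -> (forall y, U y -> V (T y)) ->
  (forall j, Ck k U (fun z => T z 0 j)) -> Ck k V f -> Ck k U (f \o T).
Proof.
move=> oU oV TV; elim: k f => [|k IH] f Tk fk.
all: have Tc y : U y -> {for y, continuous T} by
       move=> Uy; apply: rV_continuous => j; exact: Ck_continuous (Tk j) Uy.
all: have fTc y : U y -> {for y, continuous (f \o T)} by
       move=> Uy; apply: continuous_comp; [exact: Tc|
         exact: Ck_continuous fk (TV _ Uy)].
  by split.
split=> // i.
have D y : U y -> is_derive y (delta_mx 0 i) (f \o T)
    (\sum_j 'D_(delta_mx 0 j) f (T y) *
            'D_(delta_mx 0 i) (fun z => T z 0 j) y).
  move=> Uy; apply: (is_derive_chain oV _ (TV _ Uy)).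
  - exact: CkWle fk.
  - exact: Tc.
  - by move=> j; have [_ /(_ i)[+ _]] := Tk j; exact.
split=> [y Uy|]; first by have [] := D y Uy.
pose F j := ('D_(delta_mx 0 j) f \o T) \*
            ('D_(delta_mx 0 i) (fun z => T z 0 j)).
have FC : Ck k U (fun y => \sum_j F j y).
  apply: Ck_sum => // j; apply: CkM => //.
    apply: IH => [l|]; first exact: CkW.
    by have [_ /(_ j)[]] := fk.
  by have [_ /(_ i)[]] := Tk j.
apply: eq_Ck FC => // y Uy.
by have [_ ->] := D y Uy.
Qed.

End Ckcomp.

(** * Hadamard's lemma *)

Lemma Rintegral_sum (R : realType) (J : Type) (s : seq J) (F : J -> R -> R) :
  (forall j, {within `[0%R, 1%R]%classic, continuous (F j)}) ->
  (\int[@lebesgue_measure R]_(t in `[0%R, 1%R]) (\sum_(j <- s) F j t) =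
   \sum_(j <- s) \int[@lebesgue_measure R]_(t in `[0%R, 1%R]) F j t)%R.
Proof.
move=> Fc; elim: s => [|j s IH].
  rewrite big_nil; under eq_Rintegral do rewrite big_nil.
  by rewrite Rintegral_cst// mul0r.
rewrite big_cons -IH -RintegralD//.
- by apply: eq_Rintegral => t _; rewrite big_cons.
- by apply: continuous_compact_integrable; [exact: segment_compact|exact: Fc].
apply: continuous_compact_integrable; first exact: segment_compact.
move=> t; apply: cvg_big => [|i _]; first by apply: add_continuous.
exact: Fc.
Qed.

Section Hadamard.
Context {R : realType} {n : nat}.
Local Notation mu := (@lebesgue_measure R).
Local Notation I := (`[0%R, 1%R]%classic : set R).
Variables (B : set 'rV[R]_n) (a : 'rV[R]_n).
Hypothesis oB : open B.

Let z (t : R) (y : 'rV[R]_n) : 'rV[R]_n := t *: (y - a) + a.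

Hypothesis Bz : forall y t, B y -> 0 <= t <= 1 -> B (z t y).

(** Compactness of the unit interval in its near-covering form: continuity at each pair [(t, y)]
    yields a neighbourhood of [y] that serves all [t] at once. *)
Lemma segment_unif (W : 'rV[R]_n -> R) y e :
  (forall x, B x -> {for x, continuous W}) -> B y -> 0 < e ->
  exists2 d : R, 0 < d & forall y' : 'rV[R]_n,
    (forall k, `|y 0 k - y' 0 k| < d) ->
    forall t, 0 <= t <= 1 -> `|W (z t y) - W (z t y')| <= e.
Proof.
move=> Wc By e0.
have jc (t0 : R) : {for (t0, y), continuous (fun q : R * 'rV[R]_n => z q.1 q.2)}.
  apply: cvgD; last exact: cvg_cst.
  apply: cvgZ; first exact: cvg_fst.
  by apply: cvgB; [exact: cvg_snd|exact: cvg_cst].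
suff H : \forall y' \near nbhs y, I `<=` (fun t => `|W (z t y) - W (z t y')| <= e).
  have [d d0 Hd] := (rV_nbhsP _ _).1 H.
  by exists d => // y' yy' t t01; apply: (Hd y' yy' t); rewrite /= in_itv.
have cov := (compact_near_coveringP I).1 (@segment_compact R 0 1).
apply: (cov _ (nbhs y) (fun y' t => `|W (z t y) - W (z t y')| <= e)).
move=> t0; rewrite /= in_itv /= => t01.
have Wz : (fun q : R * 'rV[R]_n => W (z q.1 q.2)) q @[q --> (t0, y)] --> W (z t0 y).
  apply: (@cvg_comp _ _ _ (fun q : R * 'rV[R]_n => z q.1 q.2) W _ _ _ (jc t0)).
  exact: Wc (Bz By t01).
have e20 : 0 < e / 2 by rewrite divr_gt0.
have /cvgrPdist_le/(_ _ e20) H1 := Wz.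
have [[U1 U2] /= [tU1 yU2] H12] := H1.
exists (U1, U2) => // -[t y'] /= [U1t U2y'].
have A1 := H12 (t, y') (conj U1t U2y').
have A2 := H12 (t, y) (conj U1t (nbhs_singleton yU2)).
rewrite /= in A1 A2.
rewrite -(subrKA (W (z t0 y))) (splitr e); apply: le_trans (ler_normD _ _) _.
by rewrite lerD// distrC.
Qed.

(** The weight [t ^+ m] makes the family stable under derivation in [y]: each derivative of
    [W (z t y)] brings out one more factor [t]. *)
Definition segment_integral (m : nat) (W : 'rV[R]_n -> R) (y : 'rV[R]_n) : R :=
  (\int[mu]_(t in I) (t ^+ m * W (z t y)))%R.

Lemma segment_within W y m : (forall x, B x -> {for x, continuous W}) -> B y ->
  {within I, continuous (fun t => t ^+ m * W (z t y))}.
Proof.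
move=> Wc By; apply: continuous_in_subspaceT => t; rewrite inE /= in_itv /= => t01.
apply: cvgM.
  exact: exprn_continuous.
apply: (@cvg_comp _ _ _ (fun t : R => z t y) W); last exact: Wc (Bz By t01).
apply: cvgD; last exact: cvg_cst.
exact: scalel_continuous.
Qed.

Lemma segment_integrable W y m : (forall x, B x -> {for x, continuous W}) -> B y ->
  mu.-integrable I (EFin \o (fun t => t ^+ m * W (z t y))).
Proof.
move=> Wc By; apply: continuous_compact_integrable; first exact: segment_compact.
exact: segment_within.
Qed.

Lemma mu_I : fine (mu I) = 1.
Proof. by rewrite lebesgue_measure_itv /= lte_fin ltr01 /= subr0. Qed.

Lemma segment_integral_continuous W m y :
  (forall x, B x -> {for x, continuous W}) -> B y ->
  {for y, continuous (segment_integral m W)}.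
Proof.
move=> Wc By; suff : segment_integral m W v @[v --> y] --> segment_integral m W y by [].
apply/rV_cvgP => e e0.
have [d1 d10 H1] := segment_unif Wc By e0.
have [d2 d20 H2] := rV_openP oB By.
exists (Num.min d1 d2) => [|y' yy']; first by rewrite lt_min d10.
have {}H1 t : 0 <= t <= 1 -> `|W (z t y) - W (z t y')| <= e.
  by apply: H1 => k; have := yy' k; rewrite lt_min => /andP[].
have By' : B y' by apply: H2 => k; have := yy' k; rewrite lt_min => /andP[].
have i1 := segment_integrable m Wc By.
have i2 := segment_integrable m Wc By'.
have mI : measurable I by exact: measurable_itv.
pose F1 (t : R) := t ^+ m * W (z t y); pose F2 (t : R) := t ^+ m * W (z t y').
have i12 : mu.-integrable I (EFin \o (fun t => F1 t - F2 t)).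
  have -> : EFin \o (fun t => F1 t - F2 t) = ((EFin \o F1) \- (EFin \o F2))%E.
    by apply/funext => t /=; rewrite EFinB.
  exact: integrableB.
rewrite /segment_integral -RintegralB //.
apply: le_trans (le_normr_Rintegral _ i12) _ => //.
apply: le_trans (_ : \int[mu]_(t in I) (cst e t) <= e)%R; last first.
  by rewrite Rintegral_cst// mu_I mulr1.
apply: le_Rintegral => //.
- exact: (integrable_abse i12).
- apply: continuous_compact_integrable; first exact: segment_compact.
  by move=> x; exact: cvg_cst.
move=> t; rewrite /= in_itv /= => t01.
have /andP[t0 t1] := t01.
rewrite -mulrBr normrM -[leRHS]mul1r; apply: ler_pM => //.
  by rewrite ger0_norm ?exprn_ge0// exprn_ile1.
exact: H1.
Qed.

Lemma segment_integral_derive W m y i : Ck 1 B W -> B y ->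
  is_derive y (delta_mx 0 i) (segment_integral m W)
    (segment_integral m.+1 ('D_(delta_mx 0 i) W) y).
Proof.
move=> W1 By; have [Wc /(_ i)[Wd [DWc _]]] := W1.
pose e : 'rV[R]_n := delta_mx 0 i; pose DW := 'D_e W.
have [d1 d10 H1] := segment_unif DWc By ltr01.
have [d2 d20 H2] := rV_openP oB By.
pose d := Num.min d1 d2; have d0 : 0 < d by rewrite lt_min d10.
have se (s : R) : s \in `]-d, d[ -> forall k, `|y 0 k - (s *: e + y) 0 k| < d.
  rewrite in_itv /= => /andP[s1 s2] k; rewrite !mxE eqxx /=.
  rewrite opprD addrCA subrr addr0 normrN.
  case: eqP => _; rewrite ?mulr1 ?mulr0 ?normr0// ltr_norml s1 s2 //.
have Be (s : R) : s \in `]-d, d[ -> B (s *: e + y).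
  by move=> /se H; apply: H2 => k; have := H k; rewrite lt_min => /andP[].
pose f (s t : R) := t ^+ m * W (z t (s *: e + y)).
have zE s t : z t (s *: e + y) = (s * t) *: e + z t y.
  by rewrite /z -addrA scalerDr scalerA mulrC addrA.
have fd (s t : R) : s \in `]-d, d[ -> 0 <= t <= 1 ->
    is_derive s 1 (f ^~ t) (t ^+ m.+1 * DW (z t (s *: e + y))).
  move=> sd t01; have Bs := Be s sd.
  have zd : is_derive s 1 (fun s : R => W ((s * t) *: e + z t y))
     (DW (z t (s *: e + y)) * t).
    apply: is_derive_affine; rewrite -zE; split=> //; apply: Wd; exact: Bz.
  have -> : f ^~ t = (t ^+ m) \*: (fun s : R => W ((s * t) *: e + z t y)).
    by apply/funext => s' /=; rewrite /f zE.
  apply: is_derive_eq; rewrite /GRing.scale /= exprSr -mulrA; congr (_ * _).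
  by rewrite mulrC.
(* The dominating function is the constant [M + 1]: [M] bounds the derivative along the segment
   ending at [y], and by [H1] moving the end point changes it by at most 1. *)
have [M HM] : exists M, forall t, 0 <= t <= 1 -> `|DW (z t y)| <= M.
  have [||c _ Hc] := @EVT_max R (fun t => `|DW (z t y)|) 0 1; first exact: ler01.
    apply: continuous_in_subspaceT => t; rewrite inE /= in_itv /= => t01.
    apply: (@cvg_comp _ _ _ (fun t : R => DW (z t y)) (fun x : R => `|x|)); last first.
      exact: norm_continuous.
    apply: (@cvg_comp _ _ _ (fun t : R => z t y) DW); last exact: DWc (Bz By t01).
    apply: cvgD; last exact: cvg_cst.
    exact: scalel_continuous.
  by exists (`|DW (z c y)|) => t t01; apply: Hc; rewrite in_itv.
have mI : measurable I by exact: measurable_itv.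
have d00 : `]-d, d[%classic (0 : R) by rewrite /= in_itv /= oppr_lt0 d0.
have M0 : 0 <= M + 1.
  rewrite addr_ge0//; apply: le_trans (HM 0 _) => //; by rewrite lexx ler01.
have intf (s : R) : `]-d, d[%classic s -> mu.-integrable I (EFin \o f s).
  by move=> /Be Bs; exact: segment_integrable.
have intG : mu.-integrable I (EFin \o (cst (M + 1) : R -> R)).
  apply: continuous_compact_integrable; first exact: segment_compact.
  by move=> x; exact: cvg_cst.
have fd' (s t : R) : `]-d, d[%classic s -> I t -> derivable (f ^~ t) s 1.
  by move=> sd; rewrite /= in_itv /= => t01; have [] := fd s t sd t01.
have Gub (s t : R) : `]-d, d[%classic s -> I t -> `|partial1of2 f s t| <= cst (M + 1) t.
  move=> sd; rewrite /= in_itv /= => t01; have [_] := fd s t sd t01.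
  rewrite partial1of2E => ->.
  have /andP[t0 t1] := t01.
  rewrite normrM -[leRHS]mul1r; apply: ler_pM => //.
    by rewrite ger0_norm ?exprn_ge0// exprn_ile1.
  rewrite -[X in `|X|](subrK (DW (z t y))) addrC; apply: le_trans (ler_normD _ _) _.
  rewrite lerD ?HM// distrC; apply: H1 => // k.
  by have := se s sd k; rewrite lt_min => /andP[].
have H := @cvg_differentiation_under_integral R _ _ mu f I mI 0 (-d) d d00 intf fd'
  (cst (M + 1)) (fun=> M0) intG Gub.
have {}H : (fun h : R => h^-1 *: ((segment_integral m W \o shift y) (h *: e) -
      segment_integral m W y)) @ 0^' --> segment_integral m.+1 DW y.
  rewrite (_ : segment_integral m.+1 DW y =
    \int[mu]_(t in I) partial1of2 f 0 t)%R; last first.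
    apply: eq_Rintegral => t; rewrite inE /= in_itv /= => t01.
    have [_] := fd 0 t d00 t01; rewrite partial1of2E => ->.
    by rewrite scale0r add0r.
  apply: cvg_trans H; apply: near_eq_cvg; near=> h => /=.
  by rewrite addr0 /segment_integral /f scale0r add0r.
by split; [apply/cvg_ex; eexists; exact: H | exact: cvg_lim H].
Unshelve. all: by end_near. Qed.

Lemma Ck_segment_integral k W m : Ck k.+1 B W -> Ck k B (segment_integral m W).
Proof.
elim: k W m => [|k IH] W m Wk.
  split=> // y By; apply: segment_integral_continuous => //.
  by move=> x Bx; exact: Ck_continuous Wk Bx.
split=> [y By|i].
  apply: segment_integral_continuous => //.
  by move=> x Bx; exact: Ck_continuous Wk Bx.
have W1 : Ck 1 B W by exact: CkWle Wk.
have D y (By : B y) := segment_integral_derive m i W1 By.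
split=> [y By|]; first by have [] := D y By.
have [_ /(_ i)[_ /IH H]] := Wk.
by apply: eq_Ck (H m.+1) => // y By; have [_ ->] := D y By.
Qed.

(** The fundamental theorem of calculus along the segment from [a] to [y], which stays in [B] by
    [Bz]; the integrals of the partial derivatives are the [g i]. *)
Lemma hadamard f : smooth_on B f -> B a -> exists g : 'I_n -> 'rV[R]_n -> R,
  [/\ forall i, smooth_on B (g i),
      forall i, g i a = 'D_(delta_mx 0 i) f a &
      forall y, B y -> f y - f a = \sum_i (y 0 i - a 0 i) * g i y].
Proof.
move=> fs Ba; exists (fun i => segment_integral 0 ('D_(delta_mx 0 i) f)).
have mI : measurable I by exact: measurable_itv.
have Dc i x : B x -> {for x, continuous ('D_(delta_mx 0 i) f)}.
  by move=> Bx; have [_ /(_ i)[_ [+ _]]] := fs 1%N; exact.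
split=> [i k|i|y By].
- by apply: Ck_segment_integral; have [_ /(_ i)[]] := fs k.+2.
- rewrite /segment_integral.
  under eq_Rintegral do rewrite expr0 mul1r /z subrr scaler0 add0r.
  by rewrite Rintegral_cst// mu_I mulr1.
have f1 := fs 1%N.
pose Df t := \sum_i 'D_(delta_mx 0 i) f (z t y) * (y 0 i - a 0 i).
have zc t : {for t, continuous (z ^~ y)}.
  apply: cvgD; last exact: cvg_cst.
  exact: scalel_continuous.
have zcd (t : R) j : is_derive t 1 (fun s => z s y 0 j) (y 0 j - a 0 j).
  have -> : (fun s => z s y 0 j) = (fun s : R => (y 0 j - a 0 j) *: s + a 0 j).
    by apply/funext => s; rewrite /z !mxE [_ *: _]mulrC.
  by apply: is_derive_eq; rewrite addr0 [_ *: _]mulr1.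
have fD (t : R) : 0 <= t <= 1 -> is_derive t 1 (fun s => f (z s y)) (Df t).
  move=> t01; rewrite (_ : Df t = \sum_j 'D_(delta_mx 0 j) f (z t y) *
      'D_1 (fun s => z s y 0 j) t); last first.
    by apply: eq_bigr => j _; have [_ ->] := zcd t j.
  apply: (is_derive_chain (T := z ^~ y) oB f1); [exact: Bz|exact: zc|].
  by move=> j; have [] := zcd t j.
have dc : {within I, continuous Df}.
  apply: continuous_in_subspaceT => t; rewrite inE /= in_itv /= => t01.
  apply: cvg_big => [|j _]; first by apply: add_continuous.
  apply: cvgM; last exact: cvg_cst.
  apply: (@cvg_comp _ _ _ (z ^~ y) ('D_(delta_mx 0 j) f) _ _ _ (zc t)).
  exact: Dc (Bz By t01).
have fc (t : R) : 0 <= t <= 1 -> {for t, continuous (fun s => f (z s y))}.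
  move=> t01; apply: (@cvg_comp _ _ _ (z ^~ y) f _ _ _ (zc t)).
  exact: Ck_continuous (fs 0%N) (Bz By t01).
have := @continuous_FTC2 R Df (fun s => f (z s y)) 0 1 ltr01 dc.
have lr : derivable_oo_LRcontinuous (fun s => f (z s y)) 0 1.
  split=> [t||].
  - by rewrite in_itv /= => /andP[/ltW t0 /ltW t1]; have [] := fD t; rewrite ?t0.
  - by apply: cvg_at_right_filter; apply: fc; rewrite lexx ler01.
  - by apply: cvg_at_left_filter; apply: fc; rewrite lexx ler01.
move=> /(_ lr) H.
have z1 : z 1 y = y by rewrite /z scale1r subrK.
have z0 : z 0 y = a by rewrite /z scale0r add0r.
rewrite z1 z0 in H.
have {}H := H _.
have -> : f y - f a = (\int[mu]_(t in I) Df t)%R.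
  rewrite /Rintegral H // => t; rewrite in_itv /= => /andP[/ltW t0 /ltW t1].
  have t01 : 0 <= t <= 1 by rewrite t0.
  by rewrite derive1E; have [_ ->] := fD t t01.
rewrite Rintegral_sum => [|j].
  apply: eq_bigr => j _; rewrite /segment_integral mulrC RintegralZr//.
    by under [in RHS]eq_Rintegral do rewrite expr0 mul1r.
  rewrite (_ : (fun t => 'D_(delta_mx 0 j) f (z t y)) =
      (fun t => t ^+ 0 * 'D_(delta_mx 0 j) f (z t y))); last first.
    by apply/funext => t; rewrite mul1r.
  exact: (segment_integrable 0 (Dc j)).
apply: continuous_in_subspaceT => t; rewrite inE /= in_itv /= => t01.
apply: cvgM; last exact: cvg_cst.
apply: (@cvg_comp _ _ _ (z ^~ y) ('D_(delta_mx 0 j) f) _ _ _ (zc t)).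
exact: Dc (Bz By t01).
Qed.

End Hadamard.

(** * Bump functions *)

Section Bump.
Context {R : realType}.

(** Each power is dominated by its own term of the exponential series. With [u = h^-1] the bound
    controls [flat] near 0. *)
Lemma poly_le_expR (P : {poly R}) : exists2 C, 0 <= C &
  forall u : R, 0 <= u -> `|P.[u]| <= C * expR u.
Proof.
have mono m (u : R) : 0 <= u -> u ^+ m <= m`!%:R * expR u.
  move=> u0; have f0 : (0 : R) < m`!%:R by rewrite ltr0n fact_gt0.
  case: m f0 => [|m] f0.
    by rewrite expr0 mul1r (le_trans _ (expR_ge1Dx _))// lerDl.
  rewrite -ler_pdivrMl// mulrC (le_trans _ (expR_ge1Dxn m u0))// lerDr //.
exists (\sum_(i < size P) `|P`_i| * i`!%:R) => [|u u0].
  by apply: sumr_ge0 => i _; rewrite mulr_ge0.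
rewrite horner_coef mulr_suml; apply: le_trans (ler_norm_sum _ _ _) _.
apply: ler_sum => i _; rewrite normrM -mulrA ler_wpM2l//.
by rewrite ger0_norm ?exprn_ge0// mono.
Qed.

(* The derivatives of exp (-1/t) are all of this form. *)
Definition flat (P : {poly R}) (t : R) : R :=
  if 0 < t then P.[t^-1] * expR (- t^-1) else 0.

(** The derivative of P(1/t) exp(-1/t) is (P - P')(1/t) t^-2 exp(-1/t), so derivation acts on the
    polynomial alone. *)
Lemma is_derive_flat (P : {poly R}) (t : R) :
  is_derive t 1 (flat P) (flat ((P - P^`()) * 'X^2) t).
Proof.
have [t0|t0|<-] := ltgtP 0 t.
- pose Q := ((P - P^`()) * 'X^2).
  have ti : is_derive t 1 (fun s : R => s^-1) (- t ^- 2).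
    have := @is_deriveV _ id t 1 1; rewrite gt_eqF// /GRing.scale /= mulr1.
    by apply.
  have tn : is_derive t 1 (fun s : R => - s^-1) (t ^- 2).
    by apply: is_derive_eq; rewrite opprK.
  have te : is_derive t 1 (expR \o (fun s : R => - s^-1)) (expR (- t^-1) * t ^- 2).
    by apply: is_derive1_comp.
  have tp : is_derive t 1 (horner P \o (fun s : R => s^-1)) (P^`().[t^-1] * - t ^- 2).
    have hp : is_derive (t^-1) 1 (horner P) P^`().[t^-1].
      by split; [exact: derivable_horner|rewrite -derive1E -derivE].
    exact: is_derive1_comp.
  have H : is_derive t 1 ((horner P \o (fun s : R => s^-1)) *
     (expR \o (fun s : R => - s^-1))) (flat Q t).
    apply: is_derive_eq; rewrite /flat t0 /Q !hornerE /GRing.scale /=.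
    by rewrite -exprVn; ring.
  apply: near_eq_is_derive H.
  have : \forall s \near t, 0 < s by exact: lt_nbhsr.
  by apply: filterS => s s0; rewrite /flat s0.
- have H : is_derive t 1 (cst 0 : R -> R) (flat ((P - P^`()) * 'X^2) t).
    by apply: is_derive_eq; rewrite /flat ltNge (ltW t0).
  apply: near_eq_is_derive H.
  have : \forall s \near t, s < 0 by exact: lt_nbhsl.
  by apply: filterS => s s0; rewrite /flat ltNge (ltW s0).
(* At 0: the factor ['X^2] in the bound gives |flat P h| <= C h^2, so the difference quotient tends
   to 0. *)
have [C C0 HC] := poly_le_expR (P * 'X^2).
have fb h : `|flat P h| <= C * `|h| ^+ 2.
  rewrite /flat; case: ifP => h0; last by rewrite normr0 mulr_ge0 ?exprn_ge0.
  have := HC h^-1; rewrite invr_ge0 (ltW h0) => /(_ isT).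
  have hi : 0 <= h^-1 ^+ 2 by rewrite exprn_ge0// invr_ge0 ltW.
  rewrite hornerM hornerXn normrM (ger0_norm hi) exprVn ler_pdivrMr ?exprn_gt0// => H.
  rewrite normrM expRN (gtr0_norm h0) (@ger0_norm _ (_^-1)) ?invr_ge0 ?expR_ge0//.
  by rewrite ler_pdivrMr ?expR_gt0// mulrAC.
have f0 : flat P 0 = 0 by rewrite /flat ltxx.
have H : (fun h : R => h^-1 *: ((flat P \o shift 0) (h *: 1) - flat P 0)) @ 0^'
    --> (0 : R).
  apply/cvgr0Pnorm_le => e e0; near=> h.
  have h0 : h != 0 by near: h; exact: nbhs_dnbhs_neq.
  rewrite /= f0 subr0 addr0 [h *: 1]mulr1 normrM normfV.
  rewrite ler_pdivrMl ?normr_gt0//; apply: le_trans (fb h) _.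
  rewrite expr2 mulrA mulrC ler_wpM2l//.
  rewrite (le_trans (_ : _ <= (C + 1) * `|h|))//.
    by rewrite ler_wpM2r// lerDl.
  rewrite -ler_pdivlMl ?ltr_wpDl//.
  near: h; apply: dnbhs0_le; rewrite mulr_gt0// invr_gt0 ltr_wpDl //.
split; first by apply/cvg_ex; eexists; exact: H.
by rewrite /flat ltxx; exact: cvg_lim H.
Unshelve. all: by end_near. Qed.

Context {n : nat}.
Implicit Types (U : set 'rV[R]_n) (f : 'rV[R]_n -> R).

Lemma Ck_flat k U f P : open U -> Ck k U f -> Ck k U (flat P \o f).
Proof.
move=> oU; apply: (Ck_comp1 (S := fun phi => exists P, phi = flat P) (W := setT)) => //.
- move=> _ [Q ->]; exists (flat ((Q - Q^`()) * 'X^2)); first by eexists.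
  by move=> t _; exact: is_derive_flat.
- by exists P.
Qed.

(** The functions c t^-m form a class closed under derivation, as [Ck_comp1] requires; it contains
    the inverse and the derivative of the logarithm. *)
Lemma is_derive_expV m (c t : R) : t != 0 ->
  is_derive t 1 (fun t => c * t ^- m) (- (c * m%:R) * t ^- m.+1).
Proof.
move=> t0.
have te : is_derive t 1 (fun s : R => s ^+ m) (m%:R * t ^+ m.-1).
  have := @exp_derive R m t 1; rewrite /GRing.scale /= mulr1 => E.
  by split; [exact: exprn_derivable|rewrite E].
have tv : is_derive t 1 (fun s : R => (s ^+ m)^-1) (- (t ^+ m) ^- 2 * (m%:R * t ^+ m.-1)).
  by apply: is_deriveV; rewrite expf_neq0.
have -> : (fun t => c * t ^- m) = (c \*: (fun s : R => (s ^+ m)^-1)) by [].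
apply: is_derive_eq; rewrite /GRing.scale /=.
case: m te tv => [|m] _ _; first by rewrite !(mulr0, mul0r, oppr0).
have u0 : t ^+ m != 0 by rewrite expf_neq0.
rewrite /= (exprS t m.+1) (exprS t m); move: (t ^+ m) u0 => u u0.
by field; rewrite t0 u0.
Qed.

Lemma Ck_inv k U f : open U -> (forall x, U x -> f x != 0) -> Ck k U f ->
  Ck k U (fun x => (f x)^-1).
Proof.
move=> oU f0 fk.
have := @Ck_comp1 R n (fun phi => exists c m, phi = fun t => c * t ^- m)
  [set t : R | t != 0] k U f (fun t => 1 * t ^- 1) oU.
move=> H; apply: eq_Ck (H _ _ f0 fk) => //.
- by move=> y _ /=; rewrite mul1r expr1.
- move=> _ [c [m ->]]; exists (fun t => - (c * m%:R) * t ^- m.+1).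
    by exists (- (c * m%:R)), m.+1.
  by move=> t t0; exact: is_derive_expV.
by exists 1, 1%N.
Qed.

Lemma Ck_ln k U f : open U -> (forall x, U x -> 0 < f x) -> Ck k U f ->
  Ck k U (fun x => ln (f x)).
Proof.
move=> oU f0 fk.
have := @Ck_comp1 R n (fun phi => phi = @ln R \/ exists c m, phi = fun t => c * t ^- m)
  [set t : R | 0 < t] k U f (@ln R) oU.
move=> H; apply: H f0 fk; last by left.
move=> _ [->|[c [m ->]]].
  exists (fun t => 1 * t ^- 1); first by right; exists 1, 1%N.
  by move=> t t0; rewrite mul1r; exact: is_derive1_ln.
exists (fun t => - (c * m%:R) * t ^- m.+1).
  by right; exists (- (c * m%:R)), m.+1.
by move=> t t0; apply: is_derive_expV; rewrite gt_eqF.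
Qed.

(** The quotient g1 / (g1 + g2), with g1 positive exactly where [s y < d ^+ 2] and g2 exactly where
    [s y > d ^+ 2 / 2]. The function [s] is the squared Euclidean distance, while [d] and [d'] bound
    single coordinates. *)
Lemma smooth_bump (c : 'rV[R]_n) (d : R) : 0 < d -> exists2 b : 'rV[R]_n -> R,
  smooth_on setT b &
  (forall y, b y != 0 -> forall k, `|c 0 k - y 0 k| <= d) /\
  (exists2 d' : R, 0 < d' & forall y : 'rV[R]_n,
     (forall k, `|c 0 k - y 0 k| < d') -> b y = 1).
Proof.
move=> d0; pose s (y : 'rV[R]_n) : R := \sum_k (y 0 k - c 0 k) ^+ 2.
have sC k : Ck k setT s.
  apply: Ck_sum; first exact: openT.
  move=> i; have oT := @openT 'rV[R]_n.
  have H := CkB oT (Ck_coord k i oT) (Ck_cst k (c 0 i) oT).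
  by apply: eq_Ck (CkM oT H H) => // y _ /=; rewrite expr2.
pose g1 (y : 'rV[R]_n) : R := flat 1 (d ^+ 2 - s y).
pose g2 (y : 'rV[R]_n) : R := flat 1 (s y - d ^+ 2 / 2).
have flat_ge0 t : 0 <= flat 1 t.
  by rewrite /flat; case: ifP => // _; rewrite mulr_ge0 ?expR_ge0// hornerE.
have flat_gt0 t : 0 < t -> 0 < flat 1 t.
  by rewrite /flat => ->; rewrite mulr_gt0 ?expR_gt0// hornerE.
have d20 : 0 < d ^+ 2 / 2 by rewrite divr_gt0// exprn_gt0.
have dd2 : d ^+ 2 / 2 + d ^+ 2 / 2 = d ^+ 2 by rewrite -splitr.
have g0 y : 0 < g1 y + g2 y.
  have [sy|sy] := ltP (s y) (d ^+ 2).
    by apply: ltr_pwDl; [apply: flat_gt0; rewrite subr_gt0|exact: flat_ge0].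
  by apply: ltr_wpDl; [exact: flat_ge0|apply: flat_gt0; lra].
have gC1 k : Ck k setT g1.
  apply: (Ck_flat (f := fun y => d ^+ 2 - s y) _ openT).
  by apply: CkB (Ck_cst _ _ _) _ => //; exact: openT.
have gC2 k : Ck k setT g2.
  apply: (Ck_flat (f := fun y => s y - d ^+ 2 / 2) _ openT).
  by apply: CkB _ (Ck_cst _ _ _) => //; exact: openT.
exists (fun y => g1 y * (g1 y + g2 y)^-1).
  move=> k; apply: CkM => //; first exact: openT.
  apply: Ck_inv; first exact: openT.
    by move=> y _; rewrite gt_eqF.
  by apply: CkD => //; exact: openT.
split=> [y|].
  rewrite mulf_eq0 negb_or => /andP[gy _] k.
  have sy : s y < d ^+ 2.
    by rewrite ltNge; apply: contra gy => sy; rewrite /g1 /flat subr_gt0 ltNge sy.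
  rewrite leNgt; apply/negP => dk.
  have : d ^+ 2 <= s y.
    rewrite /s (bigD1 k)//=; apply: ler_wpDr.
      by apply: sumr_ge0 => j _; exact: sqr_ge0.
    by rewrite -(real_normK (num_real (_ - _))) lerXn2r ?nnegrE// ?ltW// distrC.
  by rewrite leNgt sy.
(* The bound by 1 makes the square of a number in [0, d'] at most d'; [n.+1] keeps the denominator
   nonzero when [n = 0]. *)
pose d' := Num.min 1 (d ^+ 2 / 2 / n.+1%:R).
have d'0 : 0 < d' by rewrite lt_min ltr01 divr_gt0.
have d'1 : d' <= 1 by rewrite ge_min lexx.
exists d' => // y yd.
have sy : s y <= d ^+ 2 / 2.
  apply: (@le_trans _ _ (\sum_(k < n) d')).
    apply: ler_sum => k _; rewrite -(real_normK (num_real (_ - _))) distrC.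
    rewrite expr2; apply: (@le_trans _ _ (1 * d')); last by rewrite mul1r.
    by apply: ler_pM => //; [apply: le_trans d'1|]; exact: ltW.
  rewrite sumr_const card_ord -[leLHS]mulr_natr.
  apply: (@le_trans _ _ (d ^+ 2 / 2 / n.+1%:R * n%:R)).
    by rewrite ler_wpM2r// ge_min lexx orbT.
  rewrite -mulrA ler_piMr ?(ltW d20)// mulrC ler_pdivrMr ?ltr0n// mul1r ler_nat //.
have -> : g2 y = 0 by rewrite /g2 /flat subr_gt0 ltNge sy.
by rewrite addr0 divff// gt_eqF//; apply: flat_gt0; lra.
Qed.

End Bump.

(** * Smooth functions and vector fields in charts *)

Lemma open_preimage_within (S T : topologicalType) (U : set S) (P : set T) (f : S -> T) :
  open U -> open P -> (forall x, U x -> {for x, continuous f}) ->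
  open (U `&` f @^-1` P).
Proof.
move=> oU oP fc; rewrite openE => x [Ux Px].
have xU : nbhs x U by apply: open_nbhs_nbhs; split.
have xP : nbhs (f x) P by apply: open_nbhs_nbhs; split.
exact: filterI xU (fc x Ux P xP).
Qed.

Section ManifoldFunctions.
Context {R : realType} {n : nat} {M : manifold R n}.
Implicit Types (c : chart R M n).

Lemma img_fwd c x : dom c x -> img c (fwd c x).
Proof. by exists x. Qed.

Lemma dom_bwd c y : img c y -> dom c (bwd c y).
Proof. by case=> x dx <-; rewrite fwdK. Qed.

Lemma bwdK c y : img c y -> fwd c (bwd c y) = y.
Proof. by case=> x dx <-; rewrite fwdK. Qed.

Lemma overlapE c1 c2 :
  fwd c1 @` (dom c1 `&` dom c2) = img c1 `&` bwd c1 @^-1` dom c2.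
Proof.
apply/seteqP; split=> [_ [x [d1 d2] <-]|y [iy d2]].
  by split; [exact: img_fwd|rewrite /= fwdK].
by exists (bwd c1 y); [split=> //; exact: dom_bwd|exact: bwdK].
Qed.

Lemma open_overlap c1 c2 : open (fwd c1 @` (dom c1 `&` dom c2)).
Proof.
rewrite overlapE; apply: open_preimage_within.
- exact: open_img.
- exact: open_dom.
- exact: bwd_continuous.
Qed.

Definition ext c (h : 'rV[R]_n -> R) : M -> R^o :=
  fun x => if `[< dom c x >] then h (fwd c x) else 0.

Lemma ext_in c h x : dom c x -> ext c h x = h (fwd c x).
Proof. by move=> dx; rewrite /ext asboolT. Qed.

(** The Hausdorff property enters here: the image of the compact set [K] is closed in [M], so a
    point outside [dom c] has a neighbourhood on which the extension is 0. *)
Lemma ext_smooth c h (K : set 'rV[R]_n) : atlas c -> compact K -> K `<=` img c ->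
  smooth_on (img c) h -> (forall y, ~ K y -> h y = 0) -> ext c h \in smooth M.
Proof.
move=> ac cK Kc hs h0; apply/asboolP => c' ac' k.
have K'c : closed (bwd c @` K).
  apply: compact_closed; first exact: hausdorff_carrier.
  apply: continuous_compact => //; apply: continuous_in_subspaceT => y.
  by rewrite inE => /Kc; exact: bwd_continuous.
apply: Ck_local => y iy.
have dy' := dom_bwd iy.
have [dy|ndy] := pselect (dom c (bwd c' y)).
  exists (fwd c' @` (dom c' `&` dom c)); first by rewrite overlapE.
  have oV := @open_overlap c' c.
  have Tc : Ck k (fwd c' @` (dom c' `&` dom c))
     (h \o (fun y => fwd c (bwd c' y))).
    apply: (Ck_comp oV (open_img c)) (hs k).
      by move=> z; rewrite overlapE => -[_ dz]; exact: img_fwd.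
    by move=> j; exact: (atlas_compatible ac' ac).
  apply: eq_Ck Tc => // z; rewrite overlapE => -[_ dz] /=.
  by rewrite ext_in.
exists (img c' `&` bwd c' @^-1` (~` (bwd c @` K))).
  split=> //= -[z Kz zy]; apply: ndy; rewrite -zy; apply: dom_bwd; exact: Kc.
have oV : open (img c' `&` bwd c' @^-1` (~` (bwd c @` K))).
  apply: open_preimage_within; first exact: open_img.
    exact: closed_openC.
  exact: bwd_continuous.
apply: eq_Ck (Ck_cst k (0 : R) oV) => // z [iz nK] /=.
rewrite /ext; case: asboolP => // dz.
rewrite h0// => Kf; apply: nK; exists (fwd c (bwd c' z)) => //.
by rewrite fwdK.
Qed.

Lemma Cinf_smooth (f : Cinf M) c : atlas c -> smooth_on (img c) (f \o bwd c).
Proof. by case: f => f /= /asboolP; apply. Qed.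

(** For a function defined point by point, such as the density [lam] below, smoothness near [p]
    follows from one equation whose coefficient is nonzero at [p]. *)
Lemma smooth_quotient (u : M -> R^o) :
  (forall p, exists a b : Cinf M, a p != 0 /\ forall x, u x * a x = b x) ->
  u \in smooth M.
Proof.
move=> H; apply/asboolP => c ac k; apply: Ck_local => y iy.
have [a [b [a0 uab]]] := H (bwd c y).
have as' := Cinf_smooth a ac; have bs' := Cinf_smooth b ac.
exists (img c `&` (a \o bwd c) @^-1` [set t | t != 0]); first by split.
have oV : open (img c `&` (a \o bwd c) @^-1` [set t | t != 0]).
  apply: open_preimage_within; first exact: open_img.
    exact: open_neq.
  by move=> z iz; exact: Ck_continuous (as' 0%N) iz.
have sV : img c `&` (a \o bwd c) @^-1` [set t | t != 0] `<=` img c by move=> z [].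
have iC := Ck_inv oV (fun z zV => zV.2) (Ck_sub sV (as' k)).
apply: eq_Ck (CkM oV (Ck_sub sV (bs' k)) iC) => // z [iz /= az].
by rewrite -uab mulfK.
Qed.

Lemma smooth_ln (u : Cinf M) : (forall x, 0 < (u x : R)) ->
  (fun x => ln (u x) : R^o) \in smooth M.
Proof.
move=> u0; apply/asboolP => c ac k.
by apply: (Ck_ln (open_img c)) (Cinf_smooth u ac k) => x _ /=.
Qed.

Lemma Cinf_eq (f g : Cinf M) : (forall x, f x = g x) -> f = g.
Proof. by move=> fg; apply: val_inj; apply/funext. Qed.

End ManifoldFunctions.

(** * Boxes and cut-off functions *)

Section Boxes.
Context {R : realType} {n : nat}.
Implicit Types (a c x y : 'rV[R]_n) (d : R).

Definition box c d : set 'rV[R]_n := [set y | forall k, `|c 0 k - y 0 k| < d].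

Definition closed_box c d : set 'rV[R]_n :=
  [set y | forall k, `|c 0 k - y 0 k| <= d].

Lemma open_box c d : 0 < d -> open (box c d).
Proof.
move=> d0; rewrite (_ : box c d = ball c d); first exact: ball_open.
apply/seteqP; split=> y; first by move=> H; split=> // i j; rewrite (ord1 i); exact: H.
by move=> [_ H] k; exact: H.
Qed.

Lemma compact_closed_box c d : compact (closed_box c d).
Proof.
rewrite (_ : closed_box c d =
   [set y | forall k, `[c 0 k - d, c 0 k + d]%classic (y 0 k)]).
  apply: (@rV_compact R n (fun k => `[c 0 k - d, c 0 k + d]%classic)) => k.
  exact: segment_compact.
apply/seteqP; split=> y H k; have := H k; by rewrite /= in_itv /= ler_distlC.
Qed.

Lemma box_center c d : 0 < d -> box c d c.
Proof. by move=> d0 k; rewrite subrr normr0. Qed.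

Lemma box_segment c d a y (t : R) : box c d a -> box c d y -> 0 <= t <= 1 ->
  box c d (t *: (y - a) + a).
Proof.
move=> ca cy /andP[t0 t1] k; rewrite !mxE.
have -> : c 0 k - (t * (y 0 k - a 0 k) + a 0 k) =
   t * (c 0 k - y 0 k) + (1 - t) * (c 0 k - a 0 k) by ring.
have t1' : 0 <= 1 - t by rewrite subr_ge0.
apply: le_lt_trans (ler_normD _ _) _; rewrite !normrM (ger0_norm t0) (ger0_norm t1').
have := ca k; have := cy k; move: `|_ - _| => u; move: `|_ - _| => v ud vd.
have [->|tn] := eqVneq t 0; first by rewrite mul0r add0r subr0 mul1r.
have tp : 0 < t by rewrite lt_neqAle eq_sym tn.
have -> : d = t * d + (1 - t) * d by ring.
by rewrite ltr_leD// ?ltr_pM2l// ler_wpM2l// ltW.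
Qed.

Lemma box_bump (W : set 'rV[R]_n) c : open W -> W c ->
  exists (b : 'rV[R]_n -> R) (K : set 'rV[R]_n) (d : R),
  [/\ smooth_on setT b, compact K, K `<=` W & (forall y, ~ K y -> b y = 0)] /\
  [/\ 0 < d, box c d `<=` W & forall y, box c d y -> b y = 1].
Proof.
move=> oW Wc; have [e e0 He] := rV_openP oW Wc.
have e20 : 0 < e / 2 by rewrite divr_gt0.
have KW : closed_box c (e / 2) `<=` W.
  move=> y yK; apply: He => k; apply: le_lt_trans (yK k) _.
  by rewrite ltr_pdivrMr// ltr_pMr// ltr1n.
have [b bs [b0 [d d0 b1]]] := smooth_bump c e20.
have bK y : ~ closed_box c (e / 2) y -> b y = 0.
  by apply: contra_notP => /eqP /b0.
exists b, (closed_box c (e / 2)), d; split; first by split=> //; exact: compact_closed_box.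
split=> // y yd; apply: KW; apply: b0; rewrite b1 ?oner_neq0 //.
Qed.

End Boxes.

(** * Rules for derivations, and cut-off coordinate fields *)

Section LocalFrame.
Context {R : realType} {n : nat} {M : manifold R n}.
Local Notation A := (Cinf M).

Lemma vfieldD (X Y : vfield M) f : (X + Y) f = X f + Y f :> A. Proof. by []. Qed.

Lemma vfieldZ (a : A) (X : vfield M) f : (a *: X) f = a * X f. Proof. by []. Qed.

Lemma vfield_sum (J : Type) (s : seq J) (F : J -> vfield M) f :
  (\sum_(j <- s) F j) f = \sum_(j <- s) F j f :> A.
Proof.
elim: s => [|j s IH]; first by rewrite !big_nil.
by rewrite !big_cons -IH.
Qed.

Lemma Cinf_sum (J : Type) (s : seq J) (F : J -> A) x :
  (\sum_(j <- s) F j) x = \sum_(j <- s) F j x :> R.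
Proof.
elim: s => [|j s IH]; first by rewrite !big_nil.
by rewrite !big_cons -IH.
Qed.

Lemma vfield_eq (X Y : vfield M) : (forall f, X f = Y f) -> X = Y.
Proof. by move=> XY; apply: val_inj; apply/funext. Qed.

Lemma vfield_aD (X : vfield M) f g : X (f + g) = X f + X g.
Proof. by have := (vfieldP X).1 1 f g; rewrite !scale1r. Qed.

Lemma vfieldM (X : vfield M) f g : X (f * g) = X f * g + f * X g.
Proof. exact: (vfieldP X).2. Qed.

Lemma vfield0 (X : vfield M) : X 0 = 0.
Proof.
have := vfield_aD X 0 0; rewrite addr0 => /eqP.
by rewrite -subr_eq0 opprD addNKr oppr_eq0 => /eqP.
Qed.

Lemma vfield_scal (X : vfield M) (a : R) f : X (a *: f) = a *: (X f : A).
Proof. by have := (vfieldP X).1 a f 0; rewrite !addr0 vfield0 addr0. Qed.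

Lemma vfield1 (X : vfield M) : X 1 = 0.
Proof.
have := vfieldM X 1 1; rewrite !mulr1 mul1r => /eqP.
by rewrite -subr_eq0 opprD addrA subrr add0r oppr_eq0 => /eqP.
Qed.

Lemma vfieldN (X : vfield M) f : X (- f) = - X f.
Proof. by rewrite -scaleN1r vfield_scal scaleN1r. Qed.

Lemma vfieldB (X : vfield M) f g : X (f - g) = X f - X g.
Proof. by rewrite vfield_aD vfieldN. Qed.

Lemma vfield_cst (X : vfield M) (a : R) : X (a *: (1 : A) : A) = 0.
Proof. by rewrite vfield_scal vfield1 scaler0. Qed.

Lemma vfield_suma (X : vfield M) (J : Type) (s : seq J) (F : J -> A) :
  X (\sum_(j <- s) F j) = \sum_(j <- s) X (F j).
Proof.
elim: s => [|j s IH]; first by rewrite !big_nil vfield0.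
by rewrite !big_cons vfield_aD IH.
Qed.

Section Partial.
Variables (c : chart R M n) (b : 'rV[R]_n -> R) (K : set 'rV[R]_n).
Hypotheses (ac : atlas c) (bs : smooth_on setT b) (cK : compact K).
Hypotheses (Kc : K `<=` img c) (b0 : forall y, ~ K y -> b y = 0).

Lemma ext_bump_smooth (W : set 'rV[R]_n) h : open W -> K `<=` W ->
  smooth_on W h -> ext c (fun y => b y * h y) \in smooth M.
Proof.
move=> oW KW hs; apply: (ext_smooth ac cK Kc) => [k|y /b0 ->]; last by rewrite mul0r.
apply: Ck_local => y iy; have [Ky|nKy] := pselect (K y).
  exists W; first exact: KW.
  by apply: CkM => //; apply: Ck_sub (bs k).
have Kcl : closed K by apply: compact_closed => //; exact: norm_hausdorff.
exists (~` K) => //; have oK := closed_openC Kcl.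
by apply: eq_Ck (Ck_cst k 0 oK) => // z /b0 ->; rewrite mul0r.
Qed.

Definition bump_fun : A :=
  MkCinf (ext_bump_smooth (open_img c) Kc (fun k => Ck_cst k 1 (open_img c))).

Lemma partial_subproof k (f : A) :
  ext c (fun y => b y * 'D_(delta_mx 0 k) (f \o bwd c) y) \in smooth M.
Proof.
apply: (ext_bump_smooth (open_img c) Kc) => j.
by have [_ /(_ k)[]] := Cinf_smooth f ac j.+1.
Qed.

Lemma chart_derivable (f : A) (y : 'rV[R]_n) (v : 'I_n) :
  img c y -> derivable (f \o bwd c) y (delta_mx 0 v).
Proof. by move=> iy; have [_ /(_ v)[+ _]] := Cinf_smooth f ac 1%N; apply. Qed.

Lemma partial_derivation k :
  ((fun f => MkCinf (partial_subproof k f)) : A -> A^o) \in derivation M.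
Proof.
apply/asboolP; split=> [a f g|f g]; apply: Cinf_eq => x.
  have [dx|ndx] := pselect (dom c x); last first.
    change (ext c (fun y => b y * 'D_(delta_mx 0 k) ((a *: f + g) \o bwd c) y) x =
      a * ext c (fun y => b y * 'D_(delta_mx 0 k) (f \o bwd c) y) x +
      ext c (fun y => b y * 'D_(delta_mx 0 k) (g \o bwd c) y) x).
    by rewrite /ext asboolF// mulr0 addr0.
  change (ext c (fun y => b y * 'D_(delta_mx 0 k) (a *: (f \o bwd c) + (g \o bwd c)) y) x =
      a * ext c (fun y => b y * 'D_(delta_mx 0 k) (f \o bwd c) y) x +
      ext c (fun y => b y * 'D_(delta_mx 0 k) (g \o bwd c) y) x).
  have ix := img_fwd dx.
  have df := @chart_derivable f _ k ix; have dg := @chart_derivable g _ k ix.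
  rewrite !ext_in// (deriveD (derivableZ (k := a) df) dg) (deriveZ _ df).
  by rewrite mulrDr; congr (_ + _); rewrite mulrCA.
have [dx|ndx] := pselect (dom c x); last first.
  change (ext c (fun y => b y * 'D_(delta_mx 0 k) ((f * g) \o bwd c) y) x =
    ext c (fun y => b y * 'D_(delta_mx 0 k) (f \o bwd c) y) x * g x +
    f x * ext c (fun y => b y * 'D_(delta_mx 0 k) (g \o bwd c) y) x).
  by rewrite /ext asboolF// mulr0 mul0r addr0.
change (ext c (fun y => b y * 'D_(delta_mx 0 k) ((f \o bwd c) * (g \o bwd c)) y) x =
    ext c (fun y => b y * 'D_(delta_mx 0 k) (f \o bwd c) y) x * g x +
    f x * ext c (fun y => b y * 'D_(delta_mx 0 k) (g \o bwd c) y) x).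
have ix := img_fwd dx.
have df := @chart_derivable f _ k ix; have dg := @chart_derivable g _ k ix.
rewrite !ext_in// (deriveM df dg).
have -> : (f \o bwd c) (fwd c x) = f x by rewrite /= fwdK.
have -> : (g \o bwd c) (fwd c x) = g x by rewrite /= fwdK.
move: (f x : R) (g x : R) ('D_(delta_mx 0 k) (f \o bwd c) _ : R)
  ('D_(delta_mx 0 k) (g \o bwd c) _ : R) => u v u' v'.
rewrite [u *: v']/(u * v') [v *: u']/(v * u').
move: (b _) => w; change (w * (u * v' + v * u') = w * u' * v + u * (w * v')).
by ring.
Qed.

Definition partial k : vfield M := Vfield (partial_derivation k).

End Partial.

End LocalFrame.

(** * Local generation of vector fields, and the logarithm *)

Section Generators.
Context {R : realType} {n : nat} {M : manifold R n}.
Local Notation A := (Cinf M).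
Implicit Types (c : chart R M n).

Lemma ext0 c h (x : M) : (dom c x -> h (fwd c x) = 0) -> ext c h x = 0.
Proof. by rewrite /ext; case: asboolP => // dx; apply. Qed.

Lemma CinfB (f g : A) x : (f - g) x = f x - g x. Proof. by []. Qed.
Lemma CinfM (f g : A) x : (f * g) x = f x * g x :> R. Proof. by []. Qed.
Lemma CinfD (f g : A) x : (f + g) x = f x + g x :> R. Proof. by []. Qed.
Lemma Cinf_scal (a : R) (f : A) x : (a *: f) x = a * f x :> R. Proof. by []. Qed.
Lemma Cinf_cst (a : R) x : (a *: (1 : A) : A) x = a. Proof. exact: mulr1. Qed.

(* Apply [X] to Hadamard's expansion of [f] around [x], multiplied by a bump
   function so that it becomes an identity between global functions. *)
Lemma vfield_chart (X : vfield M) (f : A) c (x : M) (B : set 'rV[R]_n)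
    (xc : 'I_n -> A) :
  atlas c -> dom c x -> open B -> B `<=` img c -> B (fwd c x) ->
  (forall y t, B y -> 0 <= t <= 1 -> B (t *: (y - fwd c x) + fwd c x)) ->
  (forall k z, dom c z -> B (fwd c z) -> xc k z = (fwd c z) 0 k) ->
  X f x = \sum_k X (xc k) x * 'D_(delta_mx 0 k) (f \o bwd c) (fwd c x) :> R.
Proof.
move=> ac dx oB Bc; set a := fwd c x => Ba star xcE.
have fs : smooth_on B (f \o bwd c).
  by move=> k; exact: Ck_sub Bc (Cinf_smooth f ac k).
have [g [gs ga gE]] := hadamard oB star fs Ba.
have [b [K [d [[bs cK KB b0] [d0 _ b1]]]]] := box_bump oB Ba.
have Kc : K `<=` img c by move=> y /KB /Bc.
pose G k : A := MkCinf (ext_bump_smooth ac bs cK Kc b0 oB KB (gs k)).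
pose bf : A := bump_fun ac bs cK Kc b0.
have ba : b a = 1 by apply: b1; exact: box_center.
have bfE z : bf z = ext c (fun y => b y * 1) z by [].
have GE k z : G k z = ext c (fun y => b y * g k y) z by [].
have bfx : bf x = 1 :> R by rewrite bfE ext_in// -/a ba mulr1.
have Gx k : G k x = 'D_(delta_mx 0 k) (f \o bwd c) a :> R.
  by rewrite GE ext_in// -/a ba mul1r ga.
have E : bf * (f - f x *: (1 : A)) = \sum_k (xc k - a 0 k *: (1 : A)) * G k.
  apply: Cinf_eq => z; rewrite Cinf_sum CinfM CinfB Cinf_cst.
  under eq_bigr => k _ do rewrite CinfM CinfB Cinf_cst GE.
  rewrite bfE.
  have [dz|ndz] := pselect (dom c z); last first.
    rewrite ext0 // mul0r big1 // => k _.
    by rewrite ext0 ?mulr0.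
  rewrite ext_in//; under eq_bigr do rewrite ext_in//.
  have [Kz|/b0 ->] := pselect (K (fwd c z)); last first.
    by rewrite !mul0r big1// => k _; rewrite mul0r mulr0.
  have Bz := KB _ Kz.
  have -> : f z - f x = (f \o bwd c) (fwd c z) - (f \o bwd c) a.
    by rewrite /= /a !fwdK.
  rewrite gE// mulr1 mulr_sumr; apply: eq_bigr => k _.
  by rewrite xcE// mulrCA.
have XE := congr1 (fun h : A => X h x) E.
rewrite /= vfieldM vfield_suma CinfD !CinfM CinfB Cinf_cst subrr mulr0 add0r in XE.
rewrite bfx mul1r vfieldB vfield_cst subr0 in XE.
rewrite XE Cinf_sum; apply: eq_bigr => k _.
rewrite vfieldM CinfD !CinfM vfieldB vfield_cst subr0 CinfB Cinf_cst.
by rewrite xcE// subrr mul0r addr0 Gx.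
Qed.

Lemma local_frame (p : M) :
  exists (chi : A) (x : 'I_n -> A) (D : 'I_n -> vfield M) c,
  [/\ chi p = 1, forall X : vfield M, chi *: X = \sum_k X (x k) *: D k,
      atlas c /\ dom c p &
      forall f k, D k f p = 'D_(delta_mx 0 k) (f \o bwd c) (fwd c p)].
Proof.
have [c ac dp] := atlas_cover p.
(* Two nested cut-offs: [b1] is 1 on a box containing [K2], outside of which [b2] vanishes. Hence
   the [x k] are true coordinates wherever [chi] or some [D k] is nonzero. *)
have [b1 [K1 [d1 [[b1s cK1 K1U b10] [d10 B1U b11]]]]] :=
  box_bump (open_img c) (img_fwd dp).
have oB := @open_box _ _ (fwd c p) _ d10.
have [b2 [K2 [d2 [[b2s cK2 K2B b20] [d20 _ b21]]]]] :=
  @box_bump _ _ _ _ oB (@box_center _ _ (fwd c p) _ d10).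
have K2U : K2 `<=` img c by move=> y /K2B /B1U.
pose x k : A := MkCinf (ext_bump_smooth ac b1s cK1 K1U b10 (open_img c) K1U
  (fun j => Ck_coord j k (open_img c))).
pose chi : A := bump_fun ac b2s cK2 K2U b20.
pose D k := partial ac b2s cK2 K2U b20 k.
have chiE z : chi z = ext c (fun y => b2 y * 1) z by [].
have DE k f z : D k f z = ext c (fun y => b2 y * 'D_(delta_mx 0 k) (f \o bwd c) y) z by [].
have xE k z : x k z = ext c (fun y => b1 y * y 0 k) z by [].
have b2p : b2 (fwd c p) = 1 by apply: b21; exact: box_center.
exists chi, x, D, c; split=> //.
- by rewrite chiE ext_in// b2p mulr1.
- move=> X; apply: vfield_eq => f; apply: Cinf_eq => z.
  rewrite vfieldZ vfield_sum CinfM Cinf_sum.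
  under eq_bigr => k _ do rewrite vfieldZ CinfM DE.
  rewrite chiE; have [dz|ndz] := pselect (dom c z); last first.
    by rewrite ext0 // mul0r big1 // => k _; rewrite ext0 ?mulr0.
  rewrite ext_in//; under eq_bigr do rewrite ext_in//.
  have [Kz|/b20 ->] := pselect (K2 (fwd c z)); last first.
    by rewrite !mul0r big1// => k _; rewrite mul0r mulr0.
  have Bz := K2B _ Kz.
  rewrite (@vfield_chart X f c z (box (fwd c p) d1) x)//.
  + rewrite mulr1 mulr_sumr; apply: eq_bigr => k _; exact: mulrCA.
  + by move=> y t By t01; exact: box_segment.
  + by move=> k w dw Bw; rewrite xE ext_in// b11// mul1r.
by move=> f k; rewrite DE ext_in// b2p mul1r.
Qed.

(** A derivation is only given by the Leibniz rule; the local frame expresses it at [p] through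
    partial derivatives, to which the chain rule applies. *)
Lemma ln_vfield (u : A) : (forall x, 0 < (u x : R)) ->
  exists l : A, forall X : vfield M, u * X l = X u.
Proof.
move=> u0; exists (MkCinf (smooth_ln u0)) => X.
set l := MkCinf _.
apply: Cinf_eq => p; rewrite CinfM.
have [chi [x [D [c [chip HX [ac dp] HD]]]]] := local_frame p.
have XE f : X f p = \sum_k X (x k) p * 'D_(delta_mx 0 k) (f \o bwd c) (fwd c p) :> R.
  have -> : X f p = (chi *: X) f p by rewrite vfieldZ CinfM chip mul1r.
  rewrite HX vfield_sum Cinf_sum.
  by apply: eq_bigr => k _; rewrite vfieldZ CinfM HD.
rewrite !XE mulr_sumr; apply: eq_bigr => k _; rewrite mulrCA; congr (_ * _).
have ip := img_fwd dp.
have du := @chart_derivable _ _ _ _ ac u _ k ip.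
have up : u p = (u \o bwd c) (fwd c p) by rewrite /= fwdK.
have lnd : is_derive (fwd c p) (delta_mx 0 k) (l \o bwd c)
    ((u p)^-1 * 'D_(delta_mx 0 k) (u \o bwd c) (fwd c p)).
  apply/is_derive_line.
  have -> : (fun h : R => (l \o bwd c) (h *: delta_mx 0 k + fwd c p)) =
    @ln R \o (fun h : R => (u \o bwd c) (h *: delta_mx 0 k + fwd c p)) by [].
  apply: is_derive1_comp.
    rewrite scale0r add0r -up; apply: is_derive1_ln; exact: u0.
  by apply/is_derive_line; split.
have [_ ->] := lnd.
by rewrite mulrA mulfV ?mul1r// gt_eqF.
Qed.

End Generators.

(** * Pointwise algebra of forms *)

Section Evaluation.
Context {R : realType} {n : nat} {M : manifold R n}.
Local Notation A := (Cinf M).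

Lemma Cinf_prod (J : Type) (s : seq J) (F : J -> A) x :
  (\prod_(j <- s) F j) x = \prod_(j <- s) F j x :> R.
Proof.
elim: s => [|j s IH]; first by rewrite !big_nil.
by rewrite !big_cons -IH.
Qed.

Lemma Cinf_sign (b : bool) x : ((-1) ^+ b : A) x = (-1) ^+ b :> R.
Proof. by case: b; rewrite ?expr1 ?expr0. Qed.

Lemma Cinf_det m (B : 'M[A]_m) x :
  (\det B) x = \det (\matrix_(i, j) (B i j x : R)).
Proof.
rewrite /determinant Cinf_sum; apply: eq_bigr => s _.
rewrite CinfM Cinf_sign Cinf_prod; congr (_ * _).
by apply: eq_bigr => i _; rewrite mxE.
Qed.

(** Multiplication by [chi] does not change the value at [p], and [chi *: X] depends on [X] only
    through the functions [X (x k)]. This replaces evaluation on tangent vectors. *)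
Lemma tensorial (L : vfield M -> A^o) (X Y : vfield M) p : linear L ->
  (forall f, X f p = Y f p) -> L X p = L Y p.
Proof.
move=> lL XY; have [chi [x [D [c [chip HX _ _]]]]] := local_frame p.
have LE (Z : vfield M) : L Z p = \sum_k Z (x k) p * L (D k) p :> R.
  have -> : L Z p = L (chi *: Z) p.
    by rewrite (scalable_linear lL) [RHS]CinfM chip mul1r.
  rewrite HX; pose L' := HB.pack L (GRing.isLinear.Build _ _ _ _ L lL) : {linear vfield M -> A^o}.
  rewrite -[L]/(L' : _ -> _) raddf_sum Cinf_sum; apply: eq_bigr => k _.
  by rewrite [_ (_ *: _)](scalable_linear lL).
by rewrite !LE; apply: eq_bigr => k _; rewrite XY.
Qed.

End Evaluation.

Section Forms.
Context {R : realType} {n : nat} {M : manifold R n} {q : nat}.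
Local Notation A := (Cinf M).
Implicit Types (w : form M q) (Y : 'I_q -> vfield M) (X Z : vfield M).

Lemma update_id Y i : update Y i (Y i) = Y.
Proof. by apply/funext => j; rewrite /update; case: eqP => // ->. Qed.

Lemma update_eq Y i X : update Y i X i = X.
Proof. by rewrite /update eqxx. Qed.

Lemma update_neq Y i j X : j != i -> update Y i X j = Y j.
Proof. by rewrite /update => /negbTE ->. Qed.

Lemma update_update Y i X Z : update (update Y i X) i Z = update Y i Z.
Proof. by apply/funext => j; rewrite /update; case: eqP. Qed.

Lemma updateC Y i j X Z : i != j ->
  update (update Y i X) j Z = update (update Y j Z) i X.
Proof.
move=> ij; apply/funext => k; rewrite /update.
by case: eqP => // ->; rewrite eq_sym (negbTE ij).
Qed.

Lemma formD w Y i X Z : w (update Y i (X + Z)) = w (update Y i X) + w (update Y i Z).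
Proof. by have := form_linear w Y i 1 X Z; rewrite !scale1r. Qed.

Lemma formZ w Y i (a : A) X : w (update Y i (a *: X)) = a * w (update Y i X).
Proof. exact: (scalable_linear (form_linear w Y i)). Qed.

Lemma form_sum w Y i (J : Type) (s : seq J) (F : J -> vfield M) :
  w (update Y i (\sum_(j <- s) F j)) = \sum_(j <- s) w (update Y i (F j)).
Proof.
elim: s => [|j s IH]; last by rewrite !big_cons formD IH.
by rewrite !big_nil -(scale0r (0 : vfield M)) formZ mul0r.
Qed.

Lemma form_tensorial w Y Y' p : (forall i f, Y i f p = Y' i f p) -> w Y p = w Y' p.
Proof.
move=> YY'; pose Z (m : nat) : 'I_q -> vfield M := fun i => if (i < m)%N then Y' i else Y i.
have -> : Y = Z 0%N by [].
have -> : Y' = Z q by apply/funext => i; rewrite /Z ltn_ord.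
suff H m : (m <= q)%N -> w (Z 0%N) p = w (Z m) p by exact: H.
elim: m => // m IH mq; rewrite IH ?(ltnW mq)//.
pose i := Ordinal mq.
have ZS : Z m.+1 = update (Z m) i (Y' i).
  apply/funext => j; rewrite /Z /update ltnS leq_eqVlt -val_eqE /=.
  by case: eqVneq => //= ji; congr Y'; apply: val_inj.
have Zm : Z m = update (Z m) i (Y i).
  apply/funext => j; rewrite /Z /update -val_eqE /=.
  by case: eqVneq => //= ji; rewrite ji ltnn; congr Y; apply: val_inj.
rewrite ZS [in LHS]Zm; apply: (tensorial (form_linear w (Z m) i)); exact: YY'.
Qed.

Lemma form_swap w Y i j : i != j -> w (Y \o tperm i j) = - w Y.
Proof.
move=> ij; pose F X Z := w (update (update Y i X) j Z).
have F0 X : F X X = 0.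
  apply: (form_alternating w ij).
  by rewrite update_neq// !update_eq.
have FDl X X' Z : F (X + X') Z = F X Z + F X' Z.
  by rewrite /F !(updateC _ _ _ ij) formD.
have FDr X Z Z' : F X (Z + Z') = F X Z + F X Z' by rewrite /F formD.
have := F0 (Y i + Y j); rewrite FDl !FDr !F0 add0r addr0 => /eqP.
rewrite addr_eq0 => /eqP FF.
have -> : w Y = F (Y i) (Y j).
  by rewrite /F !update_id.
rewrite FF opprK; congr (w _); apply/funext => k; rewrite /update /=.
by case: tpermP => [->|->|/eqP ki /eqP kj]; rewrite ?eqxx ?(negbTE ij) ?(negbTE ki) ?(negbTE kj).
Qed.

Lemma form_perm w Y (s : {perm 'I_q}) : w (Y \o s) = (-1) ^+ s * w Y.
Proof.
have [ts -> dts] := prod_tpermP s.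
elim: ts Y dts => [|[i j] ts IH] Y /=.
  by rewrite big_nil odd_perm1 mul1r => _; congr (w _); apply/funext => k; rewrite /= perm1.
move=> /andP[ij dts]; rewrite big_cons odd_permM odd_tperm ij /=.
have -> : Y \o (tperm i j * \prod_(t <- ts) tperm t.1 t.2)%g =
   (Y \o (\prod_(t <- ts) tperm t.1 t.2)%g) \o tperm i j.
  by apply/funext => k /=; rewrite permM.
by rewrite form_swap// IH// signrN mulNr.
Qed.

(* Both sides are multilinear in the rows of [B], so it suffices to compare
   them when all rows are vectors of the standard basis. *)
Lemma form_det w Y (B : 'I_q -> 'I_q -> A) :
  w (fun i => \sum_j B i j *: Y j) = \det (\matrix_(i, j) B i j) * w Y.
Proof.
suff H m : forall B : 'I_q -> 'I_q -> A,
    (forall i : 'I_q, (m <= i)%N -> exists k, forall j, B i j = (j == k)%:R) ->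
    w (fun i => \sum_j B i j *: Y j) = \det (\matrix_(i, j) B i j) * w Y.
  by apply: (H q) => i; rewrite leqNgt ltn_ord.
elim: m => [|m IH] {}B HB.
  have [f Hf] := choice (fun i => HB i isT).
  have -> : (fun i => \sum_j B i j *: Y j) = Y \o f.
    apply/funext => i /=; rewrite (bigD1 (f i))//= Hf eqxx scale1r big1 ?addr0// => j jf.
    by rewrite Hf (negbTE jf) scale0r.
  have [fi|/injectivePn[i [j ij fij]]] := boolP (injectiveb f); last first.
    have f0 : w (Y \o f) = 0 by apply: (form_alternating w ij); rewrite /= fij.
    rewrite f0 (determinant_alternate ij) ?mul0r// => k.
    by rewrite !mxE !Hf fij.
  have -> : Y \o f = Y \o perm (injectiveP _ fi).
    by apply/funext => i; rewrite /= permE.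
  rewrite form_perm -det_perm; congr (\det _ * _).
  by apply/matrixP => i j; rewrite !mxE Hf permE eq_sym.
have [mq|qm] := ltnP m q; last first.
  by apply: IH => i mi; have := leq_ltn_trans mi (ltn_ord i); rewrite ltnNge qm.
pose i := Ordinal mq.
pose Bk k := fun i' j => if i' == i then (j == k)%:R else B i' j.
have -> : (fun i => \sum_j B i j *: Y j) =
  update (fun i => \sum_j B i j *: Y j) i (\sum_k B i k *: Y k).
  by rewrite update_id.
rewrite form_sum.
have -> : \det (\matrix_(i, j) B i j) = \sum_k B i k * \det (\matrix_(i, j) Bk k i j).
  rewrite (expand_det_row _ i).
  apply: eq_bigr => k _; rewrite mxE; congr (_ * _).
  rewrite (expand_det_row _ i) (bigD1 k)//= mxE /Bk !eqxx mul1r big1 ?addr0 => [|j jk].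
    rewrite /cofactor; congr (_ * \det _); apply/matrixP => a b; rewrite !mxE.
    by rewrite eq_sym (negbTE (neq_lift _ _)).
  by rewrite mxE eqxx (negbTE jk) mul0r.
rewrite mulr_suml; apply: eq_bigr => k _.
rewrite formZ -mulrA; congr (_ * _); rewrite -IH => [|i' mi'].
  congr (w _); apply/funext => i'; rewrite /update /Bk; case: eqP => // _.
  rewrite (bigD1 k)//= eqxx scale1r big1 ?addr0// => j jk.
  by rewrite (negbTE jk) scale0r.
rewrite /Bk; case: eqP => [_|/eqP ii]; first by exists k.
apply: HB; rewrite ltn_neqAle mi' andbT eq_sym; exact: ii.
Qed.

Lemma form_det_at w Y Y' (B : 'M[R]_q) p :
  (forall i f, Y' i f p = \sum_j B i j * Y j f p) ->
  w Y' p = \det B * w Y p.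
Proof.
move=> HY; pose B' i j : A := B i j *: (1 : A).
rewrite (@form_tensorial w Y' (fun i => \sum_j B' i j *: Y j)) => [|i f].
  rewrite form_det CinfM Cinf_det; congr (\det _ * _).
  by apply/matrixP => i j; rewrite !mxE Cinf_cst.
rewrite HY vfield_sum Cinf_sum; apply: eq_bigr => j _.
by rewrite vfieldZ CinfM Cinf_cst.
Qed.

End Forms.

(** * Linear algebra of vector fields at a point *)

Section PointwiseFrames.
Context {R : realType} {n : nat} {M : manifold R n}.
Local Notation A := (Cinf M).
Local Notation oneform := (dual (vfield M)).
Implicit Types (X Y Z : vfield M) (p : M).

(** A relation between tangent vectors at [p], tested on all functions; its coefficients are real
    numbers. *)
Definition comb_at p (I : finType) (Z : I -> vfield M) (c : I -> R) X :=
  forall h : A, X h p = \sum_i c i * Z i h p :> R.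

Lemma linear_comb_at (L : vfield M -> A^o) p (I : finType) (Z : I -> vfield M) c X :
  linear L -> comb_at p Z c X -> L X p = \sum_i c i * L (Z i) p :> R.
Proof.
move=> lL XZ; pose V : vfield M := \sum_i (c i *: (1 : A)) *: Z i.
rewrite (@tensorial _ _ _ L X V)// => [|h]; last first.
  rewrite XZ vfield_sum Cinf_sum; apply: eq_bigr => i _.
  by rewrite vfieldZ CinfM Cinf_cst.
pose L' := HB.pack L (GRing.isLinear.Build _ _ _ _ L lL) : {linear vfield M -> A^o}.
rewrite -[L]/(L' : _ -> _) raddf_sum Cinf_sum; apply: eq_bigr => i _.
by rewrite [_ (_ *: _)](scalable_linear lL) [LHS]CinfM Cinf_cst.
Qed.

Definition free_at p (I : finType) (Z : I -> vfield M) :=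
  forall c, (forall h : A, \sum_i c i * Z i h p = 0 :> R) -> forall i, c i = 0.

(** The [D k] span at [p], so freeness of the [Z i] makes the square matrix of their coordinates
    [Z i (x k) p] invertible. *)
Lemma free_at_basis p (Z : 'I_n -> vfield M) : free_at p Z ->
  forall X, exists c, comb_at p Z c X.
Proof.
move=> fZ; have [chi [x [D [c [chip HX _ _]]]]] := local_frame p.
have XE X h : X h p = \sum_k X (x k) p * D k h p :> R.
  have -> : X h p = (chi *: X) h p by rewrite vfieldZ CinfM chip mul1r.
  by rewrite HX vfield_sum Cinf_sum.
pose K : 'M[R]_n := \matrix_(i, k) Z i (x k) p.
have Ku : K \in unitmx.
  rewrite unitmxE unitfE; apply/negP => /det0P[v v0 vK].
  case/negP: v0; apply/eqP/rowP => i; rewrite mxE.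
  apply: (fZ (v 0)) => h.
  under eq_bigr => j _ do rewrite XE mulr_sumr.
  rewrite exchange_big big1 //= => k _.
  have := congr1 (fun u : 'rV_n => u 0 k) vK; rewrite !mxE => vk.
  under eq_bigr => j _ do rewrite mulrA.
  rewrite -mulr_suml (_ : \sum_i _ = 0) ?mul0r// -[RHS]vk.
  by apply: eq_bigr => j _; rewrite mxE.
move=> X; pose cX := (\row_k (X (x k) p : R)) *m invmx K.
exists (cX 0) => h; rewrite XE.
under [RHS]eq_bigr => i _ do rewrite XE mulr_sumr.
rewrite [RHS]exchange_big /=; apply: eq_bigr => k _.
under [RHS]eq_bigr => i _ do rewrite mulrA.
rewrite -mulr_suml; congr (_ * _).
have <- : (cX *m K) 0 k = X (x k) p by rewrite mulmxKV// mxE.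
by rewrite mxE; apply: eq_bigr => j _; rewrite [K _ _]mxE.
Qed.

Variable g : @metric R n M.

Lemma metric_linearl Y : linear (fun X => g X Y).
Proof. by move=> a X X'; rewrite !(metric_sym g _ Y) metric_linear. Qed.

(** A vector in the kernel of the Gram matrix gives a combination [V] with [g V V p = 0], which
    positivity forces to vanish at [p]. *)
Lemma gram_neq0 p m (Z : 'I_m -> vfield M) : free_at p Z ->
  \det (\matrix_(i, j) (g (Z i) (Z j) p : R)) != 0.
Proof.
move=> fZ; apply/negP => /det0P[v v0 vG]; case/negP: v0.
pose V : vfield M := \sum_i (v 0 i *: (1 : A)) *: Z i.
have VE : comb_at p Z (v 0) V.
  move=> h; rewrite vfield_sum Cinf_sum; apply: eq_bigr => i _.
  by rewrite vfieldZ CinfM Cinf_cst.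
have gVZ j : g V (Z j) p = 0 :> R.
  rewrite (linear_comb_at (metric_linearl (Z j)) VE).
  have := congr1 (fun u : 'rV_m => u 0 j) vG; rewrite [RHS]mxE => vGj.
  by rewrite -[RHS]vGj mxE; apply: eq_bigr => i _; rewrite mxE.
have gVV : g V V p = 0 :> R.
  rewrite (linear_comb_at (metric_linear g V) VE) big1// => i _.
  by rewrite gVZ mulr0.
apply/eqP/rowP => i; rewrite mxE; apply: (fZ (v 0)) => h.
rewrite -VE; apply/eqP/negPn/negP => Vh.
by have := metric_pos g Vh; rewrite gVV ltxx.
Qed.

End PointwiseFrames.

(** * Hamiltonian vector fields and adapted frames *)

Section Hamiltonian.
Context {R : realType} {n : nat} {M : manifold R n} (pi : bivector M).
Local Notation A := (Cinf M).
Local Notation oneform := (dual (vfield M)).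
Local Notation H := (hamiltonian_vf pi).
Implicit Types (f h : A) (al be : oneform) (X Y : vfield M).

Lemma bivectorDl al al' be : pi (al + al') be = pi al be + pi al' be.
Proof. by have := bivector_linearl pi be 1 al al'; rewrite !scale1r. Qed.

Lemma bivectorDr al be be' : pi al (be + be') = pi al be + pi al be'.
Proof. by have := bivector_linearr pi al 1 be be'; rewrite !scale1r. Qed.

Lemma bivectorC al be : pi al be = - pi be al.
Proof.
have := bivector_alternating pi (al + be).
rewrite bivectorDl !bivectorDr !bivector_alternating add0r addr0 => /eqP.
by rewrite addr_eq0 => /eqP.
Qed.

Lemma hamC f h : H f h = - H h f.
Proof. exact: bivectorC. Qed.

(** The dual reading of [local_frame]: apply [al] to the expansion of [chi *: X]. Identities linear
    in a 1-form can then be tested on differentials. *)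
Lemma oneform_local (p : M) : exists (chi : A) (x : 'I_n -> A) (D : 'I_n -> vfield M),
  chi p = 1 /\ forall al, chi *: al = \sum_k al (D k) *: differential (x k).
Proof.
have [chi [x [D [c [chip HX _ _]]]]] := local_frame p.
exists chi, x, D; split=> // al; apply: val_inj; apply/funext => X.
have sumE (J : Type) (s : seq J) (F : J -> oneform) :
    (\sum_(j <- s) F j) X = \sum_(j <- s) F j X.
  elim: s => [|j s IH]; first by rewrite !big_nil.
  by rewrite !big_cons -IH.
rewrite [RHS]sumE; have lal := dual_linear al.
transitivity (al (chi *: X)); first by rewrite (scalable_linear lal).
rewrite HX.
pose al' := HB.pack (al : _ -> _) (GRing.isLinear.Build _ _ _ _ _ lal) : {linear vfield M -> A^o}.
rewrite -[al : _ -> _]/(al' : _ -> _) raddf_sum; apply: eq_bigr => k _.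
transitivity (X (x k) * al (D k)); first exact: (scalable_linear lal).
exact: mulrC.
Qed.

Lemma oneform_linear_at (L : oneform -> A^o) p : linear L ->
  forall (chi : A) (x : 'I_n -> A) (D : 'I_n -> vfield M), chi p = 1 ->
  (forall al, chi *: al = \sum_k al (D k) *: differential (x k)) ->
  forall al, L al p = \sum_k al (D k) p * L (differential (x k)) p :> R.
Proof.
move=> lL chi x D chip HX al.
have -> : L al p = L (chi *: al) p.
  by rewrite (scalable_linear lL) [RHS]CinfM chip mul1r.
pose L' := HB.pack L (GRing.isLinear.Build _ _ _ _ L lL) : {linear oneform -> A^o}.
rewrite HX -[L]/(L' : _ -> _) raddf_sum Cinf_sum; apply: eq_bigr => k _.
by rewrite [_ (_ *: _)](scalable_linear lL).
Qed.

Lemma exact_span (L : oneform -> A^o) : linear L ->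
  (forall f, L (differential f) = 0) -> forall al, L al = 0.
Proof.
move=> lL L0 al; apply: Cinf_eq => p.
have [chi [x [D [chip HX]]]] := oneform_local p.
rewrite (oneform_linear_at lL chip HX) big1// => k _.
by rewrite L0 mulr0.
Qed.

Hypothesis poisson : is_poisson pi.

Lemma ham_bracket f h : lie_bracket (H f) (H h) = H (H f h).
Proof.
apply: vfield_eq => k.
have J : H f (H h k) + H h (H k f) + H k (H f h) = 0 by exact: poisson.
change (H f (H h k) - H h (H f k) = H (H f h) k).
rewrite [H (H f h) k]hamC [H f k]hamC vfieldN opprK.
by apply/eqP; rewrite -subr_eq0 opprK J.
Qed.

Lemma lie_differential X f : lie_oneform X (differential f) = differential (X f).
Proof.
apply: val_inj; apply/funext => Y.
change (X (Y f) - (X (Y f) - Y (X f)) = Y (X f)).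
by rewrite opprB addrCA subrr addr0.
Qed.

Lemma lie_oneformD X (a : A) al al' :
  lie_oneform X (a *: al + al') = X a *: al + (a *: lie_oneform X al + lie_oneform X al').
Proof.
apply: val_inj; apply/funext => Y.
change (X (a * al Y + al' Y) - (a * al (lie_bracket X Y) + al' (lie_bracket X Y)) =
  X a * al Y + (a * (X (al Y) - al (lie_bracket X Y)) + (X (al' Y) - al' (lie_bracket X Y)))).
by rewrite vfield_aD vfieldM; ring.
Qed.

Lemma lie_bivector_linear X be : linear (fun al => lie_bivector X pi al be : A^o).
Proof.
move=> a al al'; rewrite /lie_bivector lie_oneformD.
have lZ c al1 be1 : pi (c *: al1) be1 = c * pi al1 be1.
  by rewrite (scalable_linear (bivector_linearl pi be1)).
rewrite !bivectorDl !lZ vfield_aD vfieldM.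
change (X a * pi al be + a * X (pi al be) + X (pi al' be) -
  (X a * pi al be + (a * pi (lie_oneform X al) be + pi (lie_oneform X al') be)) -
  (a * pi al (lie_oneform X be) + pi al' (lie_oneform X be)) =
  a * (X (pi al be) - pi (lie_oneform X al) be - pi al (lie_oneform X be)) +
  (X (pi al' be) - pi (lie_oneform X al') be - pi al' (lie_oneform X be))).
by ring.
Qed.

Lemma lie_bivectorC X al be : lie_bivector X pi al be = - lie_bivector X pi be al.
Proof.
rewrite /lie_bivector (bivectorC al be) (bivectorC _ be) (bivectorC al) vfieldN.
by ring.
Qed.

(** The Lie derivative of [pi] is tensorial in both 1-forms, so it suffices to take them exact,
    where the claim is the Jacobi identity. *)
Lemma ham_poisson f : H f \in poisson_vf_pred pi.
Proof.
apply/asboolP => al be; move: al.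
apply: (exact_span (lie_bivector_linear _ be)) => h; rewrite lie_bivectorC.
apply/eqP; rewrite oppr_eq0; apply/eqP; move: be.
apply: (exact_span (lie_bivector_linear _ _)) => k.
rewrite /lie_bivector !lie_differential.
have J : H f (H k h) + H k (H h f) + H h (H f k) = 0 by exact: poisson.
change (H f (H k h) - H (H f k) h - H k (H f h) = 0).
by rewrite -[RHS]J (hamC (H f k) h) (hamC f h) vfieldN !opprK addrAC.
Qed.

End Hamiltonian.

(** * Hamiltonian frames of the foliation *)

Section TangentFrames.
Context {R : realType} {n : nat} {M : manifold R n} (pi : bivector M).
Local Notation A := (Cinf M).
Local Notation H := (hamiltonian_vf pi).
Implicit Types (X Y Z : vfield M) (p : M).

Lemma tangent_ham f : tangent pi (H f).
Proof. by move=> p; exists (differential f). Qed.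

Lemma tangent_lin (a : A) X Y : tangent pi X -> tangent pi Y -> tangent pi (a *: X + Y).
Proof.
move=> tX tY p; have [al Hal] := tX p; have [be Hbe] := tY p.
exists (a *: al + be) => f.
change (a p * X f p + Y f p = pi (a *: al + be) (differential f) p).
rewrite bivectorDl (scalable_linear (bivector_linearl pi _)) Hal Hbe.
by [].
Qed.

Lemma tangent0 : tangent pi 0.
Proof.
have := tangent_lin 0 (tangent_ham 0) (tangent_ham 0).
rewrite scale0r add0r => _ p; exists 0 => f.
change (0 = pi 0 (differential f) p :> R).
by rewrite -(scale0r (0 : dual (vfield M)))
  (scalable_linear (bivector_linearl pi _)) [RHS]mul0r.
Qed.

Lemma tangent_sum (I : Type) (s : seq I) (F : I -> vfield M) :
  (forall i, tangent pi (F i)) -> tangent pi (\sum_(i <- s) F i).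
Proof.
move=> tF; elim: s => [|i s IH]; first by rewrite big_nil; exact: tangent0.
by rewrite big_cons -[F i]scale1r; apply: tangent_lin.
Qed.

Lemma tangentZ (a : A) X : tangent pi X -> tangent pi (a *: X).
Proof. by move=> tX; rewrite -[a *: X]addr0; apply: tangent_lin => //; exact: tangent0. Qed.

Context {r : nat}.
Implicit Types (f : 'I_r -> A).

Definition ham_mx f p : 'M[R]_r := \matrix_(i, j) (H (f i) (f j) p : R).

Lemma ham_comb (I : finType) (f : I -> A) (c : I -> R) p :
  comb_at p (fun i => H (f i)) c (H (\sum_i c i *: f i)).
Proof.
move=> h; rewrite hamC vfield_suma -[LHS]/(- (\sum_i H h (c i *: f i)) p : R).
rewrite Cinf_sum -sumrN; apply: eq_bigr => i _.
by rewrite vfield_scal Cinf_scal (hamC _ (f i)) -mulrN.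
Qed.

Lemma ham_mx_change f f' p (B : 'I_r -> 'I_r -> R) :
  (forall i, comb_at p (fun i => H (f i)) (B i) (H (f' i))) ->
  ham_mx f' p = (\matrix_(i, j) B i j) *m ham_mx f p *m (\matrix_(i, j) B i j)^T.
Proof.
move=> HB; apply/matrixP => i j; rewrite !mxE HB.
under eq_bigr => k _.
  rewrite hamC [X in _ * X](_ : _ = - H (f' j) (f k) p :> R)// HB -sumrN mulr_sumr.
  over.
rewrite exchange_big /=; apply: eq_bigr => l _; rewrite !mxE mulr_suml.
apply: eq_bigr => k _; rewrite !mxE (hamC _ (f k)).
by rewrite [X in _ = _ * X * _](_ : _ = - H (f l) (f k) p :> R)//; ring.
Qed.

Definition spans f p := forall X, (exists al, forall h, X h p = sharp pi al h p) ->
  exists c, comb_at p (fun i => H (f i)) c X.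

Lemma ham_mx_free f p : \det (ham_mx f p) != 0 -> free_at p (fun i => H (f i)).
Proof.
move=> dW c Hc i; have Wu : ham_mx f p \in unitmx by rewrite unitmxE unitfE.
have c0 : (\row_i c i) *m ham_mx f p = 0.
  apply/rowP => j; rewrite !mxE -[RHS](Hc (f j)); apply: eq_bigr => k _.
  by rewrite !mxE.
have := congr1 (fun u : 'rV_r => (u *m invmx (ham_mx f p)) 0 i) c0.
by rewrite mulmxK// mul0mx !mxE.
Qed.

Hypothesis rk : constant_rank pi r.

Lemma ham_frame p : exists2 f, spans f p & \det (ham_mx f p) != 0.
Proof.
have [al [fal sal]] := rk p.
have [chi [x [D [chip HX]]]] := oneform_local p.
(* The coefficients are frozen at [p]: the differential of [f i] has the same value at [p] as
   [al i]. *)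
pose f i : A := \sum_k (al i (D k) p : R) *: x k.
have fE i h : H (f i) h p = sharp pi (al i) h p :> R.
  rewrite (@ham_comb _ x).
  rewrite -[RHS]/(pi (al i) (differential h) p : R).
  rewrite (oneform_linear_at (bivector_linearl pi (differential h)) chip HX).
  by [].
have sf : spans f p.
  move=> X [be Hbe]; have [c Hc] := sal be; exists c => h.
  by rewrite Hbe Hc; apply: eq_bigr => i _; rewrite fE.
(* A kernel vector of the bracket matrix yields [F] whose brackets with all [f j] vanish at [p]. As
   the [H (f j)] span, [H F] is 0 at [p], against the independence of the [al i]. *)
exists f => //; apply/negP => /det0P[v v0 vW]; case/negP: v0.
pose F : A := \sum_i v 0 i *: f i.
have HFf j : H F (f j) p = 0 :> R.
  rewrite (@ham_comb _ f); have := congr1 (fun u : 'rV_r => u 0 j) vW.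
  rewrite [RHS]mxE => vj; rewrite -[RHS]vj mxE; apply: eq_bigr => i _.
  by rewrite mxE.
apply/eqP/rowP => i; rewrite mxE; apply: (fal (v 0)) => h.
under eq_bigr do rewrite -fE.
rewrite -(@ham_comb _ f) -/F hamC.
have [c Hc] := sf (H h) (tangent_ham h p).
rewrite -[LHS]/(- H h F p : R) Hc big1 ?oppr0// => j _.
by rewrite hamC -[X in _ * X]/(- H F (f j) p : R) HFf oppr0 mulr0.
Qed.

(** Comparison with a spanning family [f0]: the bracket matrix of [f] is B W0 B^T, so its
    invertibility forces that of [B]. *)
Lemma ham_mx_spans f p : \det (ham_mx f p) != 0 -> spans f p.
Proof.
move=> dW; have [f0 sf0 dW0] := ham_frame p.
have [B HB] := choice (fun i => sf0 (H (f i)) (tangent_ham (f i) p)).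
have WE := ham_mx_change HB.
set Bm : 'M_r := \matrix_(i, j) B i j in WE.
have Bu : Bm \in unitmx.
  rewrite unitmxE unitfE; apply: contra dW => /eqP dB.
  by rewrite WE !det_mulmx dB !mul0r.
move=> X /sf0[c Hc]; exists (((\row_i c i) *m invmx Bm) 0) => h.
have -> : \sum_i ((\row_i c i) *m invmx Bm) 0 i * H (f i) h p =
  ((\row_i c i) *m invmx Bm *m Bm *m (\col_j (H (f0 j) h p : R))) 0 0.
  rewrite -mulmxA [RHS]mxE; apply: eq_bigr => i _; rewrite HB [in RHS](mxE _ _ i).
  congr (_ * _).
  by apply: eq_bigr => j _; rewrite !mxE.
rewrite mulmxKV// mxE Hc; apply: eq_bigr => i _; by rewrite !mxE.
Qed.

Variable g : @metric R n M.

(* Gram-Schmidt without division: the factor [w] makes [N] vanish wherever the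
   [E i] fail to span the foliation. *)
Lemma orthogonal_projection f p Y : \det (ham_mx f p) != 0 ->
  exists N T (s : A), [/\ orthogonal pi g N, N = s *: Y + T, tangent pi T & s p != 0].
Proof.
move=> dW; pose E i := H (f i).
pose G : 'M[A]_r := \matrix_(i, j) g (E i) (E j).
pose d := \det G; pose w : A := \det (\matrix_(i, j) (H (f i) (f j) : A)).
have wE x : w x = \det (ham_mx f x).
  rewrite Cinf_det; congr (\det _); apply/matrixP => i j; by rewrite !mxE.
have dp : d p != 0.
  rewrite Cinf_det; have := gram_neq0 g (ham_mx_free dW).
  by congr (\det _ != 0); apply/matrixP => i j; rewrite !mxE.
(* By Cramer's rule, where [d] is nonzero the [a j] are [d] times the coefficients of the projection
   of [Y] on the span of the [E j]. *)
pose a j : A := \sum_i g (E i) Y * \adj G i j.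
pose T := \sum_j (- (w * a j)) *: E j.
exists ((w * d) *: Y + T), T, (w * d); split=> //; last first.
- by rewrite CinfM mulf_neq0// wE.
- by apply: tangent_sum => j; apply: tangentZ; exact: tangent_ham.
pose Q X : A := d * g X Y - \sum_j a j * g X (E j).
have gDr X Z Z' : g X (Z + Z') = g X Z + g X Z'.
  by have := metric_linear g X 1 Z Z'; rewrite !scale1r.
have gZr X c Z : g X (c *: Z) = c * g X Z by exact: (scalable_linear (metric_linear g X)).
have QE i : Q (E i) = 0.
  apply/eqP; rewrite subr_eq0; apply/eqP.
  have -> : d * g (E i) Y = \sum_k g (E k) Y * (\adj G *m G) k i.
    rewrite mul_adj_mx (bigD1 i)//= mxE eqxx mulr1n big1 ?addr0 => [|k ki].
      exact: mulrC.
    by rewrite mxE (negbTE ki) mulr0n mulr0.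
  under eq_bigr do rewrite mxE mulr_sumr.
  rewrite exchange_big; apply: eq_bigr => j _; rewrite /a mulr_suml.
  by apply: eq_bigr => k _; rewrite [G _ _]mxE (metric_sym g (E i)) mulrA.
have lQ : linear (Q : vfield M -> A^o).
  move=> c X X'; rewrite /Q.
  have gl Z : g (c *: X + X') Z = c * g X Z + g X' Z by exact: (metric_linearl g Z).
  rewrite gl; under eq_bigr do rewrite gl mulrDr mulrCA.
  rewrite big_split /= -mulr_sumr.
  change (d * (c * g X Y + g X' Y) - (c * (\sum_j a j * g X (E j)) + \sum_j a j * g X' (E j)) =
    c * (d * g X Y - \sum_j a j * g X (E j)) + (d * g X' Y - \sum_j a j * g X' (E j))).
  by ring.
have gXN X : g X ((w * d) *: Y + T) = w * Q X.
  rewrite gDr gZr /Q mulrBr mulrA; congr (_ + _).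
  rewrite /T mulr_sumr; elim: (index_enum _) => [|j s IH].
    by rewrite !big_nil oppr0 -(scale0r Y) gZr mul0r.
  by rewrite !big_cons gDr gZr IH opprD mulNr mulrA.
move=> X tX; rewrite gXN; apply: Cinf_eq => x; rewrite CinfM.
have [wx|wx] := eqVneq (w x) 0; first by rewrite wx mul0r.
have dWx : \det (ham_mx f x) != 0 by rewrite -wE.
have [c Hc] := ham_mx_spans dWx (tX x).
rewrite (linear_comb_at lQ Hc) big1 ?mulr0// => i _.
by rewrite QE mulr0.
Qed.

End TangentFrames.

(** * Adapted frames and the density of a volume form *)

Section AdaptedFrames.
Context {R : realType} {r q : nat} {M : manifold R (r + q)} (pi : bivector M).
Local Notation A := (Cinf M).
Local Notation H := (hamiltonian_vf pi).
Implicit Types (X Y Z : vfield M) (p : M) (f : 'I_r -> A) (N : 'I_q -> vfield M).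
Hypothesis rk : constant_rank pi r.
Variable g : @metric R (r + q) M.

Definition frame f N (i : 'I_(r + q)) : vfield M :=
  match fintype.split i with inl a => H (f a) | inr b => N b end.

Lemma frame_l f N a : frame f N (lshift q a) = H (f a).
Proof. by rewrite /frame -[lshift q a]/(unsplit (inl a)) unsplitK. Qed.

Lemma frame_r f N b : frame f N (rshift r b) = N b.
Proof. by rewrite /frame -[rshift r b]/(unsplit (inr b)) unsplitK. Qed.

Lemma comb_frame p f N (c : 'I_(r + q) -> R) X : comb_at p (frame f N) c X ->
  forall h, X h p = \sum_a c (lshift q a) * H (f a) h p +
                    \sum_b c (rshift r b) * N b h p :> R.
Proof.
move=> Hc h; rewrite Hc big_split_ord /=; congr (_ + _); apply: eq_bigr => i _.
  by rewrite frame_l.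
by rewrite frame_r.
Qed.

(** Orthogonality is required on all of [M], since [bundle_like] speaks of fields orthogonal
    everywhere; the other two conditions concern [p] alone. *)
Definition adapted p f N := [/\ \det (ham_mx pi f p) != 0,
  forall b, orthogonal pi g (N b) & free_at p (frame f N)].

Definition gram_at m p (Z : 'I_m -> vfield M) : 'M[R]_m :=
  \matrix_(i, j) (g (Z i) (Z j) p : R).

Lemma adapted_gram p f N : adapted p f N -> \det (gram_at p N) != 0.
Proof.
move=> [_ _ fr]; apply: gram_neq0 => c Hc b.
have := fr (fun i => match fintype.split i with inl _ => 0 | inr b => c b end) _ (rshift r b).
rewrite -[rshift r b]/(unsplit (inr b)) unsplitK; apply=> h.
rewrite big_split_ord /= big1 ?add0r => [|a _].
  rewrite -[RHS](Hc h); apply: eq_bigr => b' _.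
  by rewrite frame_r -[rshift r b']/(unsplit (inr b')) unsplitK.
by rewrite -[lshift q a]/(unsplit (inl a)) unsplitK mul0r.
Qed.

Lemma adapted_comb p f N X : adapted p f N -> exists c, comb_at p (frame f N) c X.
Proof. by move=> [_ _ fr]; exact: free_at_basis. Qed.

(* The Gram matrix of the [H (f i)] at [p] is invertible, hence the tangential
   part of [X] vanishes. *)
Lemma adapted_orthogonal p f N X : adapted p f N ->
  (forall i, g (H (f i)) X p = 0 :> R) ->
  exists c, comb_at p N c X.
Proof.
move=> ad oX; have [c Hc] := adapted_comb X ad; have [dW oN _] := ad.
have Hc' := comb_frame Hc.
have fE := ham_mx_free dW; have dG := gram_neq0 g fE.
pose u := \row_a c (lshift q a).
have uG : u *m gram_at p (fun a => H (f a)) = 0.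
  apply/rowP => j; rewrite !mxE -[RHS](oX j) (linear_comb_at (metric_linear g _) Hc).
  rewrite big_split_ord /= [X in _ = _ + X]big1 ?addr0 => [|b _].
    by apply: eq_bigr => a _; rewrite !mxE frame_l (metric_sym g (H (f j))).
  by rewrite frame_r (oN b _ (tangent_ham _ _)) mulr0.
have u0 a : c (lshift q a) = 0.
  have Gu : gram_at p (fun a => H (f a)) \in unitmx by rewrite unitmxE unitfE.
  have := congr1 (fun v => (v *m invmx (gram_at p (fun a => H (f a)))) 0 a) uG.
  by rewrite mulmxK// mul0mx !mxE.
exists (fun b => c (rshift r b)) => h; rewrite Hc' big1 ?add0r// => a _.
by rewrite u0 mul0r.
Qed.

Lemma adapted_tangent p f N X : adapted p f N -> tangent pi X ->
  exists c, comb_at p (fun i => H (f i)) c X.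
Proof. by move=> [dW _ _] tX; exact: ham_mx_spans dW _ (tX p). Qed.

Variable nu : form M q.
Hypotheses (nu0 : nowhere_vanishing nu).
Hypothesis nuT : forall (Y : 'I_q -> vfield M) i, tangent pi (Y i) -> nu Y = 0.

Lemma nu_update (Y : 'I_q -> vfield M) (i : 'I_q) X T (s : A) :
  tangent pi T -> X = s *: Y i + T ->
  nu (update Y i X) = s * nu Y.
Proof.
move=> tT ->; rewrite formD formZ update_id (@nuT (update Y i T) i) ?addr0//.
by rewrite update_eq.
Qed.

(** The slots are made orthogonal one at a time. As [nu] kills tangent fields, each replacement
    multiplies it by a function nonzero at [p]. *)
Lemma transverse_frame p : exists N, (forall b, orthogonal pi g (N b)) /\ nu N p != 0.
Proof.
have [Y Yp] := nu0 p; have [f sf dW] := ham_frame rk p.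
suff Hm m : (m <= q)%N -> exists N, (forall b : 'I_q, (b < m)%N -> orthogonal pi g (N b)) /\
    nu N p != 0.
  have [N [oN Np]] := Hm q (leqnn q); exists N; split=> // b; exact: oN.
elim: m => [_|m IH mq]; first by exists Y.
have [N [oN Np]] := IH (ltnW mq); pose i := Ordinal mq.
have [Ni [T [s [oNi NE tT sp]]]] := orthogonal_projection rk g (N i) dW.
exists (update N i Ni); split=> [b|].
  rewrite ltnS leq_eqVlt => /orP[/eqP bm|bm].
    by rewrite (_ : b = i) ?update_eq//; apply: val_inj.
  by rewrite update_neq; [exact: oN|rewrite -val_eqE /= ltn_eqF].
by rewrite (nu_update tT NE) CinfM mulf_neq0.
Qed.

(** Insert a linear relation into slot [b] of [nu]: the tangential part and the repeated [N b'] drop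
    out, which isolates the coefficient of [N b]. The Hamiltonian part is then free by
    [ham_mx_free]. *)
Lemma transverse_free p f N : \det (ham_mx pi f p) != 0 -> nu N p != 0 ->
  free_at p (frame f N).
Proof.
move=> dW Np c Hc.
pose T := \sum_a (c (lshift q a) *: (1 : A)) *: H (f a).
have tT : tangent pi T by apply: tangent_sum => a; apply: tangentZ; exact: tangent_ham.
have cr b : c (rshift r b) = 0.
  pose V := T + \sum_b' (c (rshift r b') *: (1 : A)) *: N b'.
  have V0 : nu (update N b V) p = nu (update N b ((0 : A) *: V)) p.
    apply: form_tensorial => i h; rewrite /update; case: eqP => // _.
    rewrite vfieldZ mul0r /V /T vfieldD CinfD !vfield_sum !Cinf_sum.
    rewrite -[RHS](Hc h) big_split_ord /=; congr (_ + _); apply: eq_bigr => i' _.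
      rewrite frame_l -[c _ in RHS](Cinf_cst (M := M) _ p).
      by rewrite -CinfM.
    rewrite frame_r -[c _ in RHS](Cinf_cst (M := M) _ p).
    by rewrite -CinfM.
  move: V0; rewrite formZ mul0r formD (@nuT (update N b T) b) ?update_eq// add0r.
  rewrite form_sum Cinf_sum (bigD1 b)//= big1 ?addr0 => [|b' bb'].
    rewrite formZ update_id CinfM Cinf_cst => /eqP.
    by rewrite mulf_eq0 (negbTE Np) orbF => /eqP.
  rewrite formZ (form_alternating nu (i := b) (j := b')) ?mulr0 1?eq_sym//.
  by rewrite update_eq update_neq.
have cl a : c (lshift q a) = 0.
  apply: (ham_mx_free dW (c := fun a => c (lshift q a))) => h.
  rewrite -[RHS](Hc h) big_split_ord /= [X in _ = _ + X]big1 ?addr0 => [|b _].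
    by apply: eq_bigr => i _; rewrite frame_l.
  by rewrite cr mul0r.
by move=> i; rewrite -(fintype.splitK i); case: (fintype.split i) => j /=.
Qed.

Lemma adapted_frame p : exists f N, adapted p f N /\ nu N p != 0.
Proof.
have [N [oN Np]] := transverse_frame p; have [f _ dW] := ham_frame rk p.
exists f, N; split=> //; split=> //; exact: transverse_free.
Qed.

Section Volume.
Variable mu : form M (r + q).
Hypothesis mu0 : is_volume_form mu.

Lemma volume_adapted p f N : adapted p f N -> mu (frame f N) p != 0.
Proof.
move=> ad; have [Y Yp] := mu0 p.
have [B HB] := choice (fun i => adapted_comb (Y i) ad).
apply: contra Yp => /eqP m0.
rewrite (@form_det_at _ _ _ _ mu (frame f N) Y (\matrix_(i, j) B i j)) ?m0 ?mulr0// => i h.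
by rewrite HB; apply: eq_bigr => j _; rewrite mxE.
Qed.

Definition wdet f : A := \det (\matrix_(i, j) (H (f i) (f j) : A)).
Definition gdet N : A := \det (\matrix_(i, j) (g (N i) (N j) : A)).

Lemma wdetE f p : wdet f p = \det (ham_mx pi f p).
Proof. by rewrite Cinf_det; congr (\det _); apply/matrixP => i j; rewrite !mxE. Qed.

Lemma gdetE N p : gdet N p = \det (gram_at p N).
Proof. by rewrite Cinf_det; congr (\det _); apply/matrixP => i j; rewrite !mxE. Qed.

(** The change of frame is block diagonal because [N'] is orthogonal. The family [f'], [N'] may
    degenerate at [p]; then [b] or [c] is 0, and this case is what makes the relation of
    [volume_density] global. *)
Lemma adapted_change p f N f' N' : adapted p f N ->
  (forall b, orthogonal pi g (N' b)) -> exists b c : R,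
  [/\ mu (frame f' N') p = b * c * mu (frame f N) p,
      wdet f' p = b ^+ 2 * wdet f p & gdet N' p = c ^+ 2 * gdet N p].
Proof.
move=> ad oN'.
have [B HB] := choice (fun i => adapted_tangent ad (tangent_ham pi (f' i))).
have [C HC] := choice (fun j => adapted_orthogonal ad
   (fun i => congr1 (fun h : A => h p : R) (oN' j _ (tangent_ham pi (f i))))).
set Bm : 'M_r := \matrix_(i, j) B i j; set Cm : 'M_q := \matrix_(i, j) C i j.
exists (\det Bm), (\det Cm); split.
- rewrite -(det_ublock Bm 0 Cm); apply: form_det_at => i h.
  rewrite big_split_ord /=; case: (split_ordP i) => a ->.
    rewrite frame_l HB [X in _ + X]big1 ?addr0 => [|j _].
      by apply: eq_bigr => j _; rewrite frame_l block_mxEul mxE.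
    by rewrite block_mxEur mxE mul0r.
  rewrite frame_r HC [X in _ = X + _]big1 ?add0r => [|j _].
    by apply: eq_bigr => j _; rewrite frame_r block_mxEdr mxE.
  by rewrite block_mxEdl mxE mul0r.
- rewrite !wdetE (ham_mx_change HB) !det_mulmx det_tr -/Bm; ring.
rewrite !gdetE; have -> : gram_at p N' = Cm *m gram_at p N *m Cm^T.
  apply/matrixP => i j; rewrite !mxE (linear_comb_at (metric_linearl g _) (HC i)).
  under eq_bigr => k _ do rewrite (linear_comb_at (metric_linear g _) (HC j)) mulr_sumr.
  rewrite exchange_big /=; apply: eq_bigr => l _; rewrite !mxE mulr_suml.
  by apply: eq_bigr => k _; rewrite !mxE; ring.
rewrite !det_mulmx det_tr; ring.
Qed.

Lemma volume_density : exists lam : A, (forall p, lam p != 0) /\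
  forall f N, (forall b, orthogonal pi g (N b)) ->
    mu (frame f N) * mu (frame f N) = lam * (wdet f * gdet N).
Proof.
have [F HF] := choice adapted_frame; have [N HN] := choice HF.
pose D p : A := wdet (F p) * gdet (N p).
have Dp p : D p p != 0.
  have [ad _] := HN p; rewrite CinfM mulf_neq0//.
    by rewrite wdetE; case: ad.
  by rewrite gdetE; exact: adapted_gram ad.
pose m p : A := mu (frame (F p) (N p)).
pose lam p : R^o := m p p * m p p / D p p.
have lamE p f' N' : (forall b, orthogonal pi g (N' b)) ->
    (mu (frame f' N') * mu (frame f' N')) p = lam p * (wdet f' * gdet N') p.
  have [ad _] := HN p => oN'; have [b [c [Hm Hw Hg]]] := adapted_change f' ad oN'.
  rewrite !CinfM Hm Hw Hg /lam -/(m p).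
  have Dpp := Dp p; move: Dpp; rewrite CinfM.
  move: (m p p : R) (wdet (F p) p : R) (gdet (N p) p : R) => x y z.
  rewrite mulf_eq0 negb_or => /andP[y0 z0]; field; by rewrite y0 z0.
(* With the frame chosen at [p] kept fixed, [lamE] at [x] is an equation for [lam x] with smooth
   coefficients, although [lam x] is defined through the frame chosen at [x]. *)
have ls : lam \in smooth M.
  apply: smooth_quotient => p; exists (D p), (m p * m p); split=> // x.
  by rewrite -lamE//; have [[]] := HN p.
exists (MkCinf ls); split=> [p|f' N' oN'].
  have [ad _] := HN p; have mp := volume_adapted ad.
  by change (m p p * m p p / D p p != 0); rewrite !mulf_neq0 ?invr_eq0.
by apply: Cinf_eq => p; rewrite lamE.
Qed.

End Volume.

End AdaptedFrames.

(** * The modular vector field *)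

Section LieDerivativeForm.
Context {R : realType} {n : nat} {M : manifold R n} {q : nat}.
Local Notation A := (Cinf M).
Variables (X : vfield M) (w : form M q).
Implicit Types (Y : 'I_q -> vfield M) (Z : vfield M).

Lemma lie_form_update Y i Z : lie_form X w (update Y i Z) =
  X (w (update Y i Z)) - (w (update Y i (lie_bracket X Z)) +
    \sum_(j | j != i) w (update (update Y j (lie_bracket X (Y j))) i Z)).
Proof.
rewrite /lie_form (bigD1 i)//= update_eq update_update; congr (_ - (_ + _)).
apply: eq_bigr => j ji; rewrite update_neq// updateC//.
by rewrite eq_sym.
Qed.

Lemma lie_form_linear Y i : linear (fun Z => lie_form X w (update Y i Z) : A^o).
Proof.
move=> a Z Z'; rewrite !lie_form_update lie_bracket_linr !formD !formZ.
rewrite vfield_aD vfieldM.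
have -> : \sum_(j | j != i) w (update (update Y j (lie_bracket X (Y j))) i (a *: Z + Z')) =
  a * (\sum_(j | j != i) w (update (update Y j (lie_bracket X (Y j))) i Z)) +
  \sum_(j | j != i) w (update (update Y j (lie_bracket X (Y j))) i Z').
  rewrite mulr_sumr -big_split /=; apply: eq_bigr => j _.
  by rewrite formD formZ.
set S := \sum_(j | _) _; set S' := \sum_(j | _) _.
change (X a * w (update Y i Z) + a * X (w (update Y i Z)) + X (w (update Y i Z')) -
  (X a * w (update Y i Z) + (a * w (update Y i (lie_bracket X Z)) +
     w (update Y i (lie_bracket X Z'))) + (a * S + S')) =
  a * (X (w (update Y i Z)) - (w (update Y i (lie_bracket X Z)) + S)) +
  (X (w (update Y i Z')) - (w (update Y i (lie_bracket X Z')) + S'))).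
by ring.
Qed.

Lemma lie_form_alternating Y i j : i != j -> Y i = Y j -> lie_form X w Y = 0.
Proof.
move=> ij Yij; rewrite /lie_form (form_alternating w ij Yij) vfield0 add0r.
rewrite (bigD1 i)//= (bigD1 j) 1?eq_sym//= big1 ?addr0 => [|k /andP[ki kj]].
  rewrite -Yij; set Z := lie_bracket X (Y i).
  have -> : update Y i Z = update Y j Z \o tperm i j.
    apply/funext => k; rewrite /update /=.
    case: tpermP => [->|->|/eqP ki /eqP kj].
    - by rewrite !eqxx.
    - by rewrite eq_sym (negbTE ij) Yij.
    by rewrite (negbTE ki) (negbTE kj).
  by rewrite form_swap// addNr oppr0.
apply: (form_alternating w ij); rewrite !update_neq//; by rewrite eq_sym.
Qed.

(** Being a form, the Lie derivative transforms under a change of frame by the same determinant as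
    [w], so the divergence can be read off on one frame at each point. *)
Definition lie_form_form : form M q :=
  @Form R n M q (lie_form X w) lie_form_linear lie_form_alternating.

End LieDerivativeForm.

(** * Derivatives of determinants *)

Section DerivationDet.
Context {R : realType} {n : nat} {M : manifold R n}.
Local Notation A := (Cinf M).

Lemma vfield_prod (X : vfield M) (I : finType) (F : I -> A) :
  X (\prod_i F i) = \sum_i X (F i) * \prod_(j | j != i) F j.
Proof.
have H (s : seq I) : uniq s -> X (\prod_(i <- s) F i) =
    \sum_(i <- s) X (F i) * \prod_(j <- s | j != i) F j.
  elim: s => [|a s IH] /=; first by rewrite !big_nil vfield1.
  move=> /andP[aNs us]; rewrite !big_cons vfieldM IH// eqxx; congr (_ + _).
    congr (_ * _); rewrite big_seq [RHS]big_seq_cond; apply: eq_bigl => j.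
    by case js : (j \in s) => //=; apply/esym/eqP => ja; rewrite -ja js in aNs.
  rewrite mulr_sumr big_seq [RHS]big_seq; apply: eq_bigr => i is_.
  rewrite big_cons; case: eqP => [ai|_]; first by rewrite ai is_ in aNs.
  by rewrite /= mulrCA.
exact: H (index_enum_uniq I).
Qed.

(** Jacobi's formula: differentiate row by row and expand each determinant along the differentiated
    row. *)
Lemma vfield_det (X : vfield M) m (B : 'M[A]_m) :
  X (\det B) = \tr ((\matrix_(i, j) (X (B i j) : A)) *m \adj B).
Proof.
have -> : \tr ((\matrix_(i, j) (X (B i j) : A)) *m \adj B) =
    \sum_i \det (\matrix_(k, j) if k == i then (X (B k j) : A) else B k j).
  apply: eq_bigr => i _; rewrite mxE (expand_det_row _ i).
  apply: eq_bigr => j _; rewrite !mxE eqxx; congr (_ * _).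
  rewrite /cofactor; congr (_ * \det _); apply/matrixP => a b; rewrite !mxE.
  by rewrite eq_sym (negbTE (neq_lift _ _)).
rewrite /determinant vfield_suma exchange_big /=; apply: eq_bigr => s _.
have -> : X ((-1) ^+ s * \prod_i B i (s i)) = (-1) ^+ s * X (\prod_i B i (s i)).
  case: (s : bool); last by rewrite expr0 !mul1r.
  by rewrite expr1 !mulN1r vfieldN.
rewrite vfield_prod mulr_sumr; apply: eq_bigr => i _; congr (_ * _).
rewrite [RHS](bigD1 i)//= mxE eqxx; congr (_ * _).
by apply: eq_bigr => j /negbTE ji; rewrite mxE ji.
Qed.

(** The hypothesis reads X B = K B + B K^T at [p]. Multiplying by the adjugate and taking traces
    uses no inverse of [B]. *)
Lemma vfield_det_at (X : vfield M) m (B : 'M[A]_m) p (K : 'I_m -> 'I_m -> R) :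
  (forall i j, X (B i j) p = \sum_k K i k * B k j p + \sum_k K j k * B i k p :> R) ->
  X (\det B) p = 2 * (\sum_i K i i) * (\det B) p :> R.
Proof.
move=> HK; pose Bp : 'M[R]_m := \matrix_(i, j) (B i j p : R).
pose Km : 'M[R]_m := \matrix_(i, j) K i j.
have -> : X (\det B) p = \tr ((Km *m Bp + Bp *m Km^T) *m \adj Bp).
  rewrite vfield_det /mxtrace Cinf_sum; apply: eq_bigr => i _.
  rewrite !mxE Cinf_sum; apply: eq_bigr => j _.
  rewrite CinfM !mxE; congr (_ * _).
    rewrite HK; congr (_ + _); apply: eq_bigr => k _; rewrite !mxE//.
    exact: mulrC.
  rewrite /cofactor CinfM -(signr_odd _ (_ + _)) Cinf_sign signr_odd Cinf_det.
  by congr (_ * \det _); apply/matrixP => a b; rewrite !mxE.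
rewrite mulmxDl mxtraceD -mulmxA mul_mx_adj mul_mx_scalar.
rewrite -(mulmxA Bp) mxtrace_mulC -mulmxA mul_adj_mx mul_mx_scalar.
rewrite !mxtraceZ mxtrace_tr -Cinf_det.
have -> : \tr Km = \sum_i K i i by apply: eq_bigr => i _; rewrite mxE.
by ring.
Qed.

End DerivationDet.

(** * Divergence of Hamiltonian fields *)

Section ModularField.
Context {R : realType} {r q : nat} {M : manifold R (r + q)} (pi : bivector M).
Local Notation A := (Cinf M).
Local Notation H := (hamiltonian_vf pi).
Hypothesis rk : constant_rank pi r.
Hypothesis poisson : is_poisson pi.
Variable g : @metric R (r + q) M.
Hypothesis bl : bundle_like pi g.
Variable nu : form M q.
Hypotheses (nu0 : nowhere_vanishing nu).
Hypothesis nuT : forall (Y : 'I_q -> vfield M) i, tangent pi (Y i) -> nu Y = 0.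
Variable mu : form M (r + q).
Hypothesis mu0 : is_volume_form mu.

Lemma form_update_comb m (w : form M m) (Y : 'I_m -> vfield M) i p (c : 'I_m -> R) V :
  comb_at p Y c V -> w (update Y i V) p = c i * w Y p.
Proof.
move=> HV; rewrite (linear_comb_at (form_linear w Y i) HV) (bigD1 i)//= update_id.
rewrite big1 ?addr0// => j ji.
rewrite (form_alternating w (i := i) (j := j)) ?mulr0 1?eq_sym//.
by rewrite update_eq update_neq.
Qed.

Lemma lie_volume_adapted lam h p f N :
  (forall f N, (forall b, orthogonal pi g (N b)) ->
    mu (frame pi f N) * mu (frame pi f N) = lam * (wdet pi f * gdet g N)) ->
  adapted pi g p f N ->
  2 * lam p * lie_form (H h) mu (frame pi f N) p = H h lam p * mu (frame pi f N) p :> R.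
Proof.
move=> Hlam ad; have [dW oN fr] := ad.
set fm := frame pi f N; pose m := mu fm; pose X := H h.
have m0 : m p != 0 by exact: volume_adapted.
have [K HK] := choice (fun i => adapted_tangent rk ad (tangent_ham pi (H h (f i)))).
have [C HC] := choice (fun j => adapted_comb (lie_bracket X (N j)) ad).
pose tK := \sum_i K i i; pose tC := \sum_j C j (rshift r j).
have Xw : X (wdet pi f) p = 2 * tK * wdet pi f p :> R.
  apply: (vfield_det_at (K := K)) => i j; rewrite !mxE.
  have J : X (H (f i) (f j)) = H (X (f i)) (f j) + H (f i) (X (f j)).
    have := congr1 (fun V : vfield M => V (f j)) (ham_bracket poisson h (f i)).
    rewrite [LHS]/(X (H (f i) (f j)) - H (f i) (X (f j))) => /eqP.
    by rewrite subr_eq => /eqP.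
  rewrite J CinfD HK; congr (_ + _).
    by apply: eq_bigr => k _; rewrite !mxE.
  rewrite hamC -[LHS]/(- H (X (f j)) (f i) p : R) HK -sumrN.
  apply: eq_bigr => k _; rewrite !mxE (hamC _ (f i)).
  by rewrite -[X in _ = _ * X]/(- H (f k) (f i) p : R) mulrN.
have Xg : X (gdet g N) p = 2 * tC * gdet g N p :> R.
  apply: (vfield_det_at (K := fun i k => C i (rshift r k))) => i j; rewrite !mxE.
  have B : X (g (N i) (N j)) = g (lie_bracket X (N i)) (N j) + g (N i) (lie_bracket X (N j)).
    have := bl (tangent_ham pi h) (oN i) (oN j).
    rewrite /lie_metric => /eqP; rewrite -addrA -opprD subr_eq0 => /eqP.
    by [].
  (* The tangential components of the bracket pair to 0 with the orthogonal field [N l]. *)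
  have gN k l : g (lie_bracket X (N k)) (N l) p =
      \sum_k' C k (rshift r k') * g (N k') (N l) p :> R.
    rewrite (linear_comb_at (metric_linearl g (N l)) (HC k)) big_split_ord /=.
    rewrite [X in X + _ = _]big1 ?add0r => [|a _].
      by apply: eq_bigr => b _; rewrite frame_r.
    by rewrite frame_l (oN l _ (tangent_ham pi _)) mulr0.
  rewrite B CinfD (metric_sym g (N i)) !gN; congr (_ + _); apply: eq_bigr => k _; rewrite !mxE//.
  by rewrite (metric_sym g (N i)).
(* Putting a bracket into its slot keeps only its diagonal component, since every other component
   repeats a field of the frame. *)
have lieE : lie_form X mu fm p = X m p - (tK + tC) * m p :> R.
  rewrite /lie_form CinfB Cinf_sum; congr (_ - _).
  rewrite big_split_ord /= mulrDl !mulr_suml; congr (_ + _); apply: eq_bigr => i _.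
    rewrite [fm _]frame_l /X ham_bracket//.
    pose c (j : 'I_(r + q)) := match fintype.split j with inl a => K i a | inr _ => 0 end.
    have cl a : c (lshift q a) = K i a by rewrite /c -[lshift q a]/(unsplit (inl a)) unsplitK.
    have cr b : c (rshift r b) = 0 by rewrite /c -[rshift r b]/(unsplit (inr b)) unsplitK.
    rewrite (@form_update_comb _ mu fm _ p c) ?cl// => k.
    rewrite HK big_split_ord /= [X in _ = _ + X]big1 ?addr0 => [|b _]; last by rewrite cr mul0r.
    by apply: eq_bigr => a _; rewrite cl [fm _]frame_l.
  rewrite [fm _]frame_r; exact: form_update_comb.
have E := Hlam f N oN.
have mm : m p * m p = lam p * (wdet pi f p * gdet g N p) :> R.
  by have := congr1 (fun a : A => a p : R) E; rewrite !CinfM.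
have EX : X (m * m) p = X (lam * (wdet pi f * gdet g N)) p by rewrite /m /fm E.
rewrite !vfieldM !CinfD !CinfM CinfD !CinfM Xw Xg in EX.
rewrite -/X -/fm -/m lieE.
apply: (mulfI m0).
move: EX mm; move: (X m p : R) (m p : R) (wdet pi f p : R) (gdet g N p : R)
  (lam p : R) (X lam p : R) => Xm m1 w1 g1 l1 Xl EX mm.
have -> : m1 * (2 * l1 * (Xm - (tK + tC) * m1)) =
  l1 * (Xm * m1 + m1 * Xm) - 2 * l1 * (tK + tC) * (m1 * m1) by ring.
have -> : m1 * (Xl * m1) = Xl * (m1 * m1) by ring.
rewrite EX mm; ring.
Qed.

Lemma modular_hamiltonian : exists F : A, is_modular_vf pi mu (H F).
Proof.
have [lam [lam0 Hlam]] := volume_density rk g nu0 nuT mu0.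
(* The square gives a positive argument for the logarithm whatever the sign of [lam]. *)
have u0 x : 0 < ((lam * lam) x : R).
  by rewrite CinfM -expr2 exprn_even_gt0//= lam0.
have [l Hl] := ln_vfield u0.
(* The divergence is X_h lam / (2 lam), and X_h ln (lam^2) = 2 X_h lam / lam, whence the quarter;
   the sign comes from X_F h = - X_h F. *)
exists (- ((4^-1 : R) *: l)) => h Y; rewrite hamC vfieldN opprK vfield_scal.
apply: Cinf_eq => p; rewrite CinfM Cinf_scal.
have [f [N [ad _]]] := adapted_frame rk g nu0 nuT p.
have [B HB] := choice (fun i => adapted_comb (Y i) ad).
have HB' i k : Y i k p = \sum_j (\matrix_(i, j) B i j) i j * frame pi f N j k p :> R.
  by rewrite HB; apply: eq_bigr => j _; rewrite mxE.
rewrite (form_det_at mu HB') -[lie_form _ _]/(lie_form_form (H h) mu : _ -> _).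
rewrite (form_det_at (lie_form_form _ _) HB').
have lE := lie_volume_adapted h Hlam ad.
have := congr1 (fun a : A => a p : R) (Hl (H h)).
rewrite vfieldM CinfD !CinfM => HlE.
have l0 := lam0 p.
rewrite mulrCA; congr (_ * _).
apply: (mulfI (x := 2 * lam p)); first by rewrite mulf_neq0// pnatr_eq0.
rewrite [LHS]lE.
move: HlE l0; move: (lam p : R) (H h l p : R) (H h lam p : R) (mu _ p : R) => a b c d HlE a0.
have -> : c = a * b / 2.
  apply: (mulfI a0); rewrite [a * (a * b / 2)](_ : _ = a * a * b / 2); last by ring.
  by rewrite HlE; field.
by field.
Qed.

End ModularField.

(** * Existence of a volume form *)

Section Darboux.
Context {F : numFieldType} {m : nat}.
Variable W : 'M[F]_m.
Hypotheses (skew : W^T = - W) (Wu : W \in unitmx).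

(** The rows of [E] and [L] are the two halves of a partial symplectic basis for the form with
    matrix [W]. *)
Definition darboux_pair k (E L : 'M[F]_(k, m)) :=
  [/\ E *m W *m L^T = 1%:M, E *m W *m E^T = 0 & L *m W *m L^T = 0].

Lemma skew_pair a b (u : 'M[F]_(a, m)) (v : 'M[F]_(b, m)) :
  (u *m W *m v^T)^T = - (v *m W *m u^T).
Proof. by rewrite !trmx_mul trmxK skew mulNmx mulmxN mulmxA. Qed.

Lemma skew_diag (u : 'rV[F]_m) : u *m W *m u^T = 0.
Proof.
apply/matrixP => i j; rewrite !ord1 [RHS]mxE.
have := congr1 (fun A : 'M_1 => A 0 0) (skew_pair u u).
rewrite [LHS]mxE [RHS]mxE => /eqP.
by rewrite -subr_eq0 opprK -mulr2n mulrn_eq0 /= => /eqP.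
Qed.

Lemma darboux_pairC k (E L : 'M[F]_(k, m)) : darboux_pair E L -> L *m W *m E^T = - 1%:M.
Proof. by case=> EL _ _; rewrite -[LHS]opprK -skew_pair EL trmx1. Qed.

(** The Gram matrix of the rows of [E] and [L] is the standard symplectic matrix; its inverse gives
    a right inverse of [col_mx E L], so there are at most [m] rows. *)
Lemma darboux_size k (E L : 'M[F]_(k, m)) : darboux_pair E L -> (k + k <= m)%N.
Proof.
move=> d; have LE := darboux_pairC d; have [EL EE LL] := d.
apply: (@mulmx1_min _ _ _ (col_mx E L)
  (W *m (col_mx E L)^T *m block_mx 0 (- 1%:M) 1%:M 0)).
rewrite mulmxA mulmxA tr_col_mx mul_col_mx mul_col_row EL EE LL LE.
rewrite mulmx_block !mul0mx !mulmx0 !mul1mx !mulNmx !mulmxN !mul1mx opprK.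
by rewrite ?add0r ?addr0 ?oppr0 ?addr0 ?add0r -scalar_mx_block.
Qed.

(* Symplectic Gram-Schmidt. *)
Lemma darboux_extend k (E L : 'M[F]_(k, m)) : darboux_pair E L -> (k + k < m)%N ->
  exists E' L' : 'M[F]_(k + 1, m), darboux_pair E' L'.
Proof.
move=> d km; have LE := darboux_pairC d; have [EL EE LL] := d.
(* The orthogonal complement of the rows already found, nonzero by dimension. *)
pose K := kermx (W *m (col_mx E L)^T).
have K0 : K != 0.
  rewrite -mxrank_eq0 mxrank_ker subn_eq0 -ltnNge.
  exact: leq_ltn_trans (rank_leq_col _) km.
have [i vi] : exists i, row i K != 0.
  apply/existsP; apply: contraNT K0; rewrite negb_exists => /forallP H.
  by apply/eqP/row_matrixP => i; rewrite row0; apply/eqP; move: (H i); rewrite negbK.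
set v := row i K in vi.
have vB : v *m W *m (col_mx E L)^T = 0.
  by rewrite -mulmxA -row_mul mulmx_ker row0.
rewrite tr_col_mx mul_mx_row -[0]row_mx0 in vB; have [vE vL] := eq_row_mx vB.
have vW : v *m W != 0.
  by apply: contra vi => /eqP v0; rewrite -[v](mulmxK Wu) v0 mul0mx.
have [j vj] : exists j, (v *m W) 0 j != 0.
  apply/existsP; apply: contraNT vW; rewrite negb_exists => /forallP H.
  by apply/eqP/rowP => j; rewrite [RHS]mxE; apply/eqP; move: (H j); rewrite negbK.
pose u0 : 'rV[F]_m := delta_mx 0 j.
(* The correction makes [u] orthogonal to [E] and [L], and it keeps the pairing with [v], which is
   orthogonal to them already. *)
pose u := u0 - (u0 *m W *m L^T) *m E + (u0 *m W *m E^T) *m L.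
have uL : u *m W *m L^T = 0.
  rewrite /u !mulmxDl !mulNmx -!(mulmxA _ _ W) -!(mulmxA _ (_ *m W)) EL LL.
  by rewrite mulmx1 mulmx0 addr0 subrr.
have uE : u *m W *m E^T = 0.
  rewrite /u !mulmxDl !mulNmx -!(mulmxA _ _ W) -!(mulmxA _ (_ *m W)) EE LE.
  by rewrite mulmx0 mulmxN mulmx1 subr0 subrr.
pose c := (v *m W *m u^T) 0 0.
have c0 : c != 0.
  have -> : c = (v *m W) 0 j; last by [].
  have -> : c = (v *m W *m u0^T) 0 0.
    rewrite /c; have -> : u^T = u0^T - E^T *m (u0 *m W *m L^T)^T + L^T *m (u0 *m W *m E^T)^T.
      by rewrite /u raddfD /= raddfB /= !trmx_mul.
    rewrite !mulmxDr mulmxN !mulmxA.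
    by rewrite vE vL !mul0mx subr0 addr0.
  rewrite mxE (bigD1 j)//= [u0^T _ _]mxE [u0 _ _]mxE !eqxx mulr1.
  rewrite big1 ?addr0// => l lj.
  by rewrite [u0^T _ _]mxE [u0 _ _]mxE (negbTE lj) mulr0.
pose v' := c^-1 *: v.
have v'E : v' *m W *m E^T = 0 by rewrite /v' -!scalemxAl vE scaler0.
have v'L : v' *m W *m L^T = 0 by rewrite /v' -!scalemxAl vL scaler0.
have v'u : v' *m W *m u^T = 1%:M.
  rewrite /v' -!scalemxAl; apply/matrixP => a b; rewrite !ord1 [LHS]mxE [RHS]mxE eqxx.
  exact: mulVf.
have swap a b (x : 'M_(a, m)) (y : 'M_(b, m)) : x *m W *m y^T = 0 -> y *m W *m x^T = 0.
  by move=> xy; rewrite -[LHS]opprK -skew_pair xy trmx0 oppr0.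
exists (col_mx E v'), (col_mx L u); split; rewrite tr_col_mx mul_col_mx mul_col_row.
- by rewrite EL (swap _ _ _ _ uE) v'L v'u -scalar_mx_block.
- by rewrite EE (swap _ _ _ _ v'E) v'E skew_diag block_mx0.
by rewrite LL (swap _ _ _ _ uL) uL skew_diag block_mx0.
Qed.

(** Serves twice: it shows that the rank [r] is even, and it provides the basis on which the volume
    form is evaluated. *)
Lemma darboux : exists k (E L : 'M[F]_(k, m)), m = (k + k)%N /\ darboux_pair E L.
Proof.
suff H d : forall k (E L : 'M[F]_(k, m)), (m - (k + k) <= d)%N -> darboux_pair E L ->
    exists k (E L : 'M[F]_(k, m)), m = (k + k)%N /\ darboux_pair E L.
  apply: (H m 0%N 0 0); first exact: leq_subr.
  by split; apply/matrixP => - [].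
elim: d => [|d IH] k E L md dp.
  exists k, E, L; split=> //; apply/eqP; rewrite eqn_leq (darboux_size dp) andbT.
  by rewrite -subn_eq0 -leqn0.
have := darboux_size dp; rewrite leq_eqVlt => /orP[/eqP km|km].
  by exists k, E, L.
have [E' [L' dp']] := darboux_extend dp km.
apply: IH dp'; rewrite -ltnS; apply: leq_trans md; apply: ltn_sub2l => //.
by rewrite !addn1 addSn addnS ltnS leqnSn.
Qed.

End Darboux.

(** * Antisymmetrization of a multilinear map *)

Section Antisymmetrization.
Context {R : realType} {n : nat} {M : manifold R n} {m : nat}.
Local Notation A := (Cinf M).
Variable T : ('I_m -> vfield M) -> A.
Hypothesis T_linear : forall Y i, linear (fun X => T (update Y i X) : A^o).

Definition antisym (Y : 'I_m -> vfield M) : A := \sum_(s : 'S_m) (-1) ^+ s * T (Y \o s).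

Lemma antisym_linear Y i : linear (fun X => antisym (update Y i X) : A^o).
Proof.
move=> a X Z; rewrite /antisym.
have E (s : 'S_m) V : update Y i V \o s = update (Y \o s) ((s^-1)%g i) V.
  apply/funext => j; rewrite /update /=; congr (if _ then _ else _).
  by rewrite -[in RHS](inj_eq (@perm_inj _ s)) permKV.
change (\sum_(s : 'S_m) (-1) ^+ s * T (update Y i (a *: X + Z) \o s) =
  a * (\sum_(s : 'S_m) (-1) ^+ s * T (update Y i X \o s)) +
  \sum_(s : 'S_m) (-1) ^+ s * T (update Y i Z \o s)).
rewrite mulr_sumr -big_split /=; apply: eq_bigr => s _; rewrite !E.
have := T_linear (Y \o s) ((s^-1)%g i) a X Z.
rewrite [RHS]/(a * T (update (Y \o s) ((s^-1)%g i) X) +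
  T (update (Y \o s) ((s^-1)%g i) Z)) => ->.
by rewrite mulrDr mulrCA.
Qed.

Lemma antisym_alternating Y i j : i != j -> Y i = Y j -> antisym Y = 0.
Proof.
move=> ij Yij.
have E : antisym Y = - antisym Y.
  rewrite [LHS](reindex_inj (@mulIg _ (tperm i j))) /= -sumrN.
  apply: eq_bigr => s _; rewrite odd_permM odd_tperm ij /= addbT signrN mulNr.
  congr (- (_ * T _)); apply/funext => k /=; rewrite permM.
  by case: tpermP => // ->.
apply: Cinf_eq => p; have := congr1 (fun h : A => h p : R) E.
rewrite [RHS]/(- antisym Y p : R) => /eqP; rewrite -subr_eq0 opprK -mulr2n.
by rewrite mulrn_eq0 => /eqP.
Qed.

Definition antisym_form : form M m :=
  @Form R n M m antisym antisym_linear antisym_alternating.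

End Antisymmetrization.

(** * Signs in the antisymmetrized product *)

Section PairSigns.
Context {R : comPzRingType} {k q : nat}.
Local Notation I := 'I_(k + k + q).
Let l (j : 'I_k) : I := lshift q (lshift k j).
Let l' (j : 'I_k) : I := lshift q (rshift k j).

Variables (J : I -> I -> R) (nu : ('I_q -> I) -> R).
Hypotheses (Jl : forall i j, J (l i) (l' j) = (i == j)%:R)
  (Jskew : forall x y, J x y = - J y x)
  (Jll : forall i j, J (l i) (l j) = 0) (Jl'l' : forall i j, J (l' i) (l' j) = 0)
  (J0r : forall b x, J x (rshift (k + k) b) = 0).
Hypothesis nu_perm : forall (s : 'S_q),
  nu (fun b => rshift (k + k) (s b)) = (-1) ^+ s * nu (@rshift (k + k) q).

(** The term of index [s] in the antisymmetrization of eta^k * nu, evaluated on a symplectic basis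
    followed by a normal frame; [J] and [nu] abstract the values of the two factors. *)
Definition pair_term (s : 'S_(k + k + q)) : R :=
  (-1) ^+ s * ((\prod_j J (s (l j)) (s (l' j))) * nu (fun b => s (rshift (k + k) b))).

Lemma indexP (x : I) : [\/ exists j, x = l j, exists j, x = l' j |
  exists b, x = rshift (k + k) b].
Proof.
case: (split_ordP x) => y ->; last by apply: Or33; exists y.
by case: (split_ordP y) => z ->; [apply: Or31|apply: Or32]; exists z.
Qed.

(* A permutation that moves the pairs [l j], [l' j] as a block contributes
   [nu] with the sign of its action on the last block only, as its actions on
   the two halves of the first block are equal. *)
Lemma pair_term_straight (s : 'S_(k + k + q)) (a : 'I_k -> 'I_k) :
  (forall j, s (l j) = l (a j)) -> (forall j, s (l' j) = l' (a j)) ->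
  pair_term s = nu (@rshift (k + k) q).
Proof.
move=> sl sl'.
have l_inj : injective l by move=> i j /lshift_inj /lshift_inj.
have a_inj : injective a.
  by move=> i j ij; apply: l_inj; apply: (@perm_inj _ s); rewrite !sl ij.
have [a' _ a'K] := injF_bij a_inj.
have sr i : exists j : 'I_q, s (rshift (k + k) i) = rshift (k + k) j.
  have [[j sj]|[j sj]|//] := indexP (s (rshift (k + k) i)).
    move: sj; rewrite -(a'K j) -sl => /perm_inj /eqP.
    by rewrite eq_rlshift.
  move: sj; rewrite -(a'K j) -sl' => /perm_inj /eqP.
  by rewrite eq_rlshift.
have [b sb] := choice sr.
have b_inj : injective b.
  move=> i j ij; apply: (@rshift_inj (k + k) q); apply: (@perm_inj _ s).
  by rewrite !sb ij.
pose pa := perm a_inj; pose pb := perm b_inj.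
have ss : (-1) ^+ s = (-1) ^+ pb :> R.
  rewrite -!det_perm.
  have -> : perm_mx s = block_mx (block_mx (perm_mx pa) 0 0 (perm_mx pa)) 0 0
      (perm_mx pb) :> 'M[R]_(k + k + q).
    apply/matrixP => i j; case: (split_ordP i) => x ->; case: (split_ordP j) => y ->.
    - rewrite block_mxEul; case: (split_ordP x) => x' ->; case: (split_ordP y) => y' ->.
      + by rewrite block_mxEul !mxE sl permE !eq_lshift.
      + by rewrite block_mxEur !mxE sl eq_lshift eq_lrshift.
      + by rewrite block_mxEdl !mxE sl' eq_lshift eq_rlshift.
      + by rewrite block_mxEdr !mxE sl' permE eq_lshift eq_rshift.
    - rewrite block_mxEur; case: (split_ordP x) => x' ->.
        by rewrite !mxE sl eq_lrshift.
      by rewrite !mxE sl' eq_lrshift.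
    - by rewrite block_mxEdl !mxE sb eq_rlshift.
    by rewrite block_mxEdr !mxE sb permE eq_rshift.
  by rewrite !det_ublock !det_perm -signr_addb addbb mul1r.
rewrite /pair_term big1 => [|j _]; last by rewrite sl sl' Jl eqxx.
rewrite mul1r ss (_ : (fun b => _) = (fun i => rshift (k + k) (pb i))).
  by rewrite nu_perm mulrA -signr_addb addbb mul1r.
by apply/funext => i; rewrite sb permE.
Qed.

Lemma pair_cases x y : [\/ J x y = 0, exists i, x = l i /\ y = l' i |
  exists i, x = l' i /\ y = l i].
Proof.
have [[i ->]|[i ->]|[b ->]] := indexP x; last by apply: Or31; rewrite Jskew J0r oppr0.
  have [[j ->]|[j ->]|[b ->]] := indexP y; last by apply: Or31; rewrite J0r.
    by apply: Or31; rewrite Jll.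
  have [<-|ij] := eqVneq i j; first by apply: Or32; exists i.
  by apply: Or31; rewrite Jl (negbTE ij).
have [[j ->]|[j ->]|[b ->]] := indexP y; last by apply: Or31; rewrite J0r.
  have [<-|ij] := eqVneq i j; first by apply: Or33; exists i.
  by apply: Or31; rewrite Jskew Jl eq_sym (negbTE ij) oppr0.
by apply: Or31; rewrite Jl'l'.
Qed.

Lemma pair_term_swap (s : 'S_(k + k + q)) j :
  pair_term (tperm (l j) (l' j) * s)%g = pair_term s.
Proof.
have ll' : l j != l' j by rewrite /l /l' eq_lshift eq_lrshift.
rewrite /pair_term odd_permM odd_tperm ll' addTb signrN mulNr -mulrN -mulNr.
congr (_ * (_ * nu _)); last first.
  by apply/funext => b; rewrite permM tpermD// /l /l' eq_lrshift.
rewrite (bigD1 j)//= [RHS](bigD1 j)//= -mulNr; congr (_ * _).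
  by rewrite !permM tpermL tpermR -Jskew.
apply: eq_bigr => i ij; rewrite !permM !tpermD// /l /l'
  ?eq_lshift ?eq_rshift ?eq_lrshift ?eq_rlshift//.
all: by rewrite eq_sym.
Qed.

(* Exchanging the two elements of a pair changes both the sign of [s] and that
   of a factor [J], so one may assume that no pair is flipped. *)
Lemma pair_termE (s : 'S_(k + k + q)) :
  pair_term s = 0 \/ pair_term s = nu (@rshift (k + k) q).
Proof.
(* When no factor [J] vanishes, [c s] counts the flipped pairs; exchanging the elements of one of
   them decreases it. *)
pose c (s : 'S_(k + k + q)) := #|[pred j | (k <= s (l j))%N]|.
move: {2}(c s) (leqnn (c s)) => d; elim: d s => [|d IH] s sd.
all: have [/existsP[j /eqP Jj]|/existsPn H] := boolP [exists j, J (s (l j)) (s (l' j)) == 0];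
  first by left; rewrite /pair_term (bigD1 j)//= Jj !mul0r mulr0.
all: have [/existsP[j kj]|/existsPn Hk] := boolP [exists j, (k <= s (l j))%N].
- by move: sd; rewrite leqn0 /c => /eqP /card0_eq /(_ j); rewrite !inE kj.
- right.
  have Ha j : exists i, s (l j) = l i /\ s (l' j) = l' i.
    have [J0|//|[i [slj _]]] := pair_cases (s (l j)) (s (l' j)).
      by have := H j; rewrite J0 eqxx.
    by have := Hk j; rewrite slj /= leq_addr.
  by have [a Ha'] := choice Ha; apply: (@pair_term_straight _ a) => j; have [] := Ha' j.
- rewrite -(pair_term_swap s j); apply: IH; rewrite -ltnS; apply: leq_trans sd.
  rewrite /c (cardD1 j) [X in (_ < X)%N](cardD1 j) !inE kj add1n ltnS.
  have [J0|[i [slj _]]|[i [_ sl'j]]] := pair_cases (s (l j)) (s (l' j)).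
  + by have := H j; rewrite J0 eqxx.
  + by move: kj; rewrite slj /= leqNgt ltn_ord.
  rewrite permM tpermL sl'j /= (leqNgt k i) ltn_ord add0n.
  apply: subset_leq_card; apply/fintype.subsetP => i'; rewrite !inE => /andP[ij].
  by rewrite ij permM tpermD// /l /l' ?eq_lshift ?eq_lrshift ?eq_rlshift// eq_sym.
right.
have Ha j : exists i, s (l j) = l i /\ s (l' j) = l' i.
  have [J0|//|[i [slj _]]] := pair_cases (s (l j)) (s (l' j)).
    by have := H j; rewrite J0 eqxx.
  by have := Hk j; rewrite slj /= leq_addr.
by have [a Ha'] := choice Ha; apply: (@pair_term_straight _ a) => j; have [] := Ha' j.
Qed.

Lemma pair_term1 : pair_term 1%g = nu (@rshift (k + k) q).
Proof. by apply: (@pair_term_straight _ id) => j; rewrite perm1. Qed.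

End PairSigns.

(** * The 2-form on the leaves *)

Section LeafwiseForm.
Context {R : realType} {n : nat} {M : manifold R n} (pi : bivector M).
Local Notation A := (Cinf M).
Local Notation H := (hamiltonian_vf pi).
Variable g : @metric R n M.

Lemma flat_subproof (X : vfield M) : (g X : vfield M -> A^o) \in linear_pred (vfield M).
Proof. by apply/asboolP; exact: metric_linear. Qed.

Definition lower (X : vfield M) : dual (vfield M) := Dual (flat_subproof X).

Lemma lower_lin (a : A) X Y : lower (a *: X + Y) = a *: lower X + lower Y.
Proof.
apply: val_inj; apply/funext => Z; exact: (metric_linearl g Z).
Qed.

(* The 2-form obtained from [pi] by lowering its indices with [g]. *)
Definition eta (X Y : vfield M) : A := pi (lower X) (lower Y).

Lemma eta_linear Y : linear (fun X => eta X Y : A^o).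
Proof. by move=> a X X'; rewrite /eta lower_lin bivector_linearl. Qed.

Lemma etaC X Y : eta X Y = - eta Y X.
Proof. exact: bivectorC. Qed.

Lemma eta_linearr X : linear (fun Y => eta X Y : A^o).
Proof. by move=> a Y Y'; rewrite /eta lower_lin bivector_linearr. Qed.

(** [sharp] is defined through differentials; [exact_span] extends the defining relation to all
    1-forms. *)
Lemma sharp_dual (al be : dual (vfield M)) : be (sharp pi al) = pi al be.
Proof.
apply/eqP; rewrite -subr_eq0; apply/eqP; move: be.
apply: (exact_span (L := fun be => be (sharp pi al) - pi al be)) => [a be be'|f].
  rewrite (bivector_linearr pi al).
  change (a * be (sharp pi al) + be' (sharp pi al) - (a * pi al be + pi al be') =
    a * (be (sharp pi al) - pi al be) + (be' (sharp pi al) - pi al be')).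
  by ring.
by rewrite [differential f _]/(pi al (differential f)) subrr.
Qed.

Lemma etaE X Y : eta X Y = g Y (sharp pi (lower X)).
Proof. by rewrite /eta -sharp_dual. Qed.

Lemma tangent_sharp al : tangent pi (sharp pi al).
Proof. by move=> p; exists al. Qed.

Lemma eta_orthogonal X N : orthogonal pi g N -> eta X N = 0.
Proof. by move=> oN; rewrite etaE metric_sym oN//; exact: tangent_sharp. Qed.

Context {r : nat}.
Hypothesis rk : constant_rank pi r.
Variables (p : M) (f : 'I_r -> A).
Hypothesis dW : \det (ham_mx pi f p) != 0.

Definition eta_mx : 'M[R]_r := \matrix_(i, j) (eta (H (f i)) (H (f j)) p : R).

Lemma eta_mx_skew : eta_mx^T = - eta_mx.
Proof. by apply/matrixP => i j; rewrite !mxE etaC. Qed.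

(** For [V] in the kernel, the raised field [S] of [lower V] is both tangent and orthogonal to the
    leaf at [p], hence 0 there. Then [V] is orthogonal to every [H (f j)] at [p], and being tangent
    it vanishes too. *)
Lemma eta_mx_unit : eta_mx \in unitmx.
Proof.
rewrite unitmxE unitfE; apply/negP => /det0P[v v0 vO]; case/negP: v0.
pose V : vfield M := \sum_i (v 0 i *: (1 : A)) *: H (f i).
have VE : comb_at p (fun i => H (f i)) (v 0) V.
  move=> h; rewrite vfield_sum Cinf_sum; apply: eq_bigr => i _.
  by rewrite vfieldZ CinfM Cinf_cst.
pose S := sharp pi (lower V).
have gES j : g (H (f j)) S p = 0 :> R.
  rewrite /S -etaE (linear_comb_at (eta_linear (H (f j))) VE).
  have := congr1 (fun u : 'rV_r => u 0 j) vO; rewrite [RHS]mxE => vj.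
  by rewrite -[RHS]vj mxE; apply: eq_bigr => i _; rewrite mxE.
have spn := ham_mx_spans rk dW.
have [c Hc] := spn S (tangent_sharp _ p).
have gSS : g S S p = 0 :> R.
  rewrite (linear_comb_at (metric_linearl g S) Hc) big1// => i _.
  by rewrite gES mulr0.
have S0 h : S h p = 0 :> R.
  by apply/eqP/negPn/negP => Sh; have := metric_pos g Sh; rewrite gSS ltxx.
have gVE j : g V (H (f j)) p = 0 :> R.
  have -> : g V (H (f j)) = lower V (H (f j)) by [].
  rewrite /hamiltonian_vf sharp_dual bivectorC.
  by rewrite -[LHS]/(- S (f j) p : R) S0 oppr0.
have gVV : g V V p = 0 :> R.
  rewrite (linear_comb_at (metric_linear g V) VE) big1// => i _.
  by rewrite gVE mulr0.
apply/eqP/rowP => i; rewrite mxE; apply: (ham_mx_free dW (c := v 0)) => h.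
rewrite -VE; apply/eqP/negPn/negP => Vh.
by have := metric_pos g Vh; rewrite gVV ltxx.
Qed.

Lemma eta_comb (a b : 'I_r -> R) X Y : comb_at p (fun i => H (f i)) a X ->
  comb_at p (fun i => H (f i)) b Y ->
  eta X Y p = ((\row_i a i) *m eta_mx *m (\row_i b i)^T) 0 0 :> R.
Proof.
move=> HX HY; rewrite (linear_comb_at (eta_linear Y) HX).
under eq_bigr => i _ do rewrite (linear_comb_at (eta_linearr _) HY) mulr_sumr.
rewrite exchange_big mxE /=; apply: eq_bigr => j _; rewrite !mxE mulr_suml.
by apply: eq_bigr => i _; rewrite !mxE; ring.
Qed.

End LeafwiseForm.

(** * Nonvanishing of the antisymmetrized form *)

Section VolumeForm.
Context {R : realType} {k q : nat} {M : manifold R (k + k + q)} (pi : bivector M).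
Local Notation A := (Cinf M).
Local Notation H := (hamiltonian_vf pi).
Hypothesis rk : constant_rank pi (k + k).
Variable g : @metric R (k + k + q) M.
Variable nu : form M q.
Hypotheses (nu0 : nowhere_vanishing nu).
Hypothesis nuT : forall (Y : 'I_q -> vfield M) i, tangent pi (Y i) -> nu Y = 0.
Let l (j : 'I_k) : 'I_(k + k + q) := lshift q (lshift k j).
Let l' (j : 'I_k) : 'I_(k + k + q) := lshift q (rshift k j).
Let eta := eta pi g.

Definition eta_nu (Y : 'I_(k + k + q) -> vfield M) : A :=
  (\prod_j eta (Y (l j)) (Y (l' j))) * nu (fun b => Y (rshift (k + k) b)).

Lemma eta_nu_linear Y i : linear (fun X => eta_nu (update Y i X) : A^o).
Proof.
have ll' a b : (l a == l' b) = false by rewrite /l /l' eq_lshift eq_lrshift.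
have l'l a b : (l' a == l b) = false by rewrite eq_sym ll'.
have nuE X j : nu (fun b => update Y (lshift q j) X (rshift (k + k) b)) =
    nu (fun b => Y (rshift (k + k) b)).
  by congr (nu _); apply/funext => b; rewrite /update eq_rlshift.
(* Each slot occurs in exactly one factor of [eta_nu]; with the other slots fixed there remains a
   linear map times a function. *)
suff [L [C [lL LE]]] : exists L : vfield M -> A^o, exists C : A,
    linear L /\ forall X, eta_nu (update Y i X) = L X * C.
  move=> a X X'; rewrite !LE lL.
  change ((a * L X + L X') * C = a * (L X * C) + L X' * C).
  by rewrite mulrDl mulrA.
case: (split_ordP i) => [j ->|b ->].
  case: (split_ordP j) => j0 ->.
  - exists (fun X => eta X (Y (l' j0))),
      ((\prod_(j | j != j0) eta (Y (l j)) (Y (l' j))) * nu (fun b => Y (rshift (k + k) b))).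
    split=> [|X]; first exact: eta_linear.
    rewrite /eta_nu nuE (bigD1 j0)//= update_eq update_neq ?l'l// -mulrA.
    congr (_ * (_ * _)); apply: eq_bigr => j1 j10.
    by rewrite !update_neq ?l'l// /l !eq_lshift.
  exists (fun X => eta (Y (l j0)) X),
    ((\prod_(j | j != j0) eta (Y (l j)) (Y (l' j))) * nu (fun b => Y (rshift (k + k) b))).
  split=> [|X]; first exact: eta_linearr.
  rewrite /eta_nu nuE (bigD1 j0)//= update_eq update_neq ?ll'// -mulrA.
  congr (_ * (_ * _)); apply: eq_bigr => j1 j10.
  by rewrite !update_neq ?ll'// /l' eq_lshift eq_rshift.
exists (fun X => nu (update (fun b => Y (rshift (k + k) b)) b X)),
  (\prod_j eta (Y (l j)) (Y (l' j))).
split=> [|X]; first exact: form_linear.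
rewrite /eta_nu mulrC; congr (nu _ * _).
  by apply/funext => b'; rewrite /update eq_rshift.
by apply: eq_bigr => j _; rewrite !update_neq// /l /l' eq_lrshift.
Qed.

(** On a symplectic basis completed by [N], each term of the sum over permutations is 0 or [nu N p],
    and the identity contributes the latter. Nothing cancels, and the value is a positive integer
    times [nu N p]. *)
Lemma volume_form_exists : exists mu : form M (k + k + q), is_volume_form mu.
Proof.
exists (antisym_form eta_nu_linear) => p.
have [f [N [[dW oN _] Np]]] := adapted_frame rk g nu0 nuT p.
have [k' [E [L [kk' dp]]]] := darboux (eta_mx_skew pi g p f) (eta_mx_unit g rk dW).
have {kk'} ek : k' = k by apply: double_inj; rewrite -!addnn.
subst k'; have LE := darboux_pairC (eta_mx_skew pi g p f) dp; have [EL EE LL] := dp.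
pose comb (B : 'M[R]_(k, k + k)) j : vfield M := \sum_i (B j i *: (1 : A)) *: H (f i).
have combE (B : 'M[R]_(k, k + k)) j : comb_at p (fun i => H (f i)) (B j) (comb B j).
  move=> h; rewrite vfield_sum Cinf_sum; apply: eq_bigr => i _.
  by rewrite vfieldZ CinfM Cinf_cst.
have eta_combE (B B' : 'M[R]_(k, k + k)) i j : eta (comb B i) (comb B' j) p =
    (B *m eta_mx pi g p f *m B'^T) i j :> R.
  rewrite (eta_comb g (combE B i) (combE B' j)).
  have rB (C : 'M[R]_(k, k + k)) a : \row_i' C a i' = row a C.
    by apply/rowP => b; rewrite !mxE.
  rewrite !rB -row_mul tr_row [LHS]mxE [RHS]mxE; apply: eq_bigr => a _.
  by rewrite [row _ _ _ _]mxE [col _ _ _ _]mxE.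
pose Y0 (x : 'I_(k + k + q)) : vfield M := match fintype.split x with
  | inl a => match fintype.split a with inl j => comb E j | inr j => comb L j end
  | inr b => N b end.
have Yl j : Y0 (l j) = comb E j.
  by rewrite /Y0 -[l j]/(unsplit (inl (lshift k j))) unsplitK
    -[lshift k j]/(unsplit (inl j)) unsplitK.
have Yl' j : Y0 (l' j) = comb L j.
  by rewrite /Y0 -[l' j]/(unsplit (inl (rshift k j))) unsplitK
    -[rshift k j]/(unsplit (inr j)) unsplitK.
have Yr b : Y0 (rshift (k + k) b) = N b.
  by rewrite /Y0 -[rshift _ b]/(unsplit (inr b)) unsplitK.
pose J x y : R := eta (Y0 x) (Y0 y) p.
pose nu' (s : 'I_q -> 'I_(k + k + q)) : R := nu (fun b => Y0 (s b)) p.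
have nuN : nu' (@rshift (k + k) q) = nu N p.
  by congr (nu _ p); apply/funext => b; rewrite Yr.
have Jl i j : J (l i) (l' j) = (i == j)%:R by rewrite /J Yl Yl' eta_combE EL mxE.
have Jskew x y : J x y = - J y x by rewrite /J /eta etaC.
have Jll i j : J (l i) (l j) = 0 by rewrite /J !Yl eta_combE EE mxE.
have Jl'l' i j : J (l' i) (l' j) = 0 by rewrite /J !Yl' eta_combE LL mxE.
have J0r b x : J x (rshift (k + k) b) = 0 by rewrite /J Yr /eta eta_orthogonal.
have nu_perm (s : 'S_q) : nu' (fun b => rshift (k + k) (s b)) =
    (-1) ^+ s * nu' (@rshift (k + k) q).
  rewrite -(Cinf_sign (M := M) _ p).
  by have /(congr1 (fun h : A => h p : R)) := form_perm nu (Y0 \o @rshift (k + k) q) s.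
exists Y0.
have -> : antisym_form eta_nu_linear Y0 p = \sum_(s : 'S_(k + k + q)) pair_term J nu' s :> R.
  rewrite -[LHS]/((antisym eta_nu Y0 : A) p) /antisym Cinf_sum; apply: eq_bigr => s _.
  by rewrite !CinfM Cinf_sign Cinf_prod.
have tE s := pair_termE Jl Jskew Jll Jl'l' J0r nu_perm s.
have t1 := pair_term1 Jl nu_perm.
(* Only positivity of the number of nonzero terms matters, and the identity ensures it. *)
have -> : \sum_(s : 'S_(k + k + q)) pair_term J nu' s =
    nu' (@rshift (k + k) q) *+ \sum_(s : 'S_(k + k + q)) (pair_term J nu' s != 0%R).
  rewrite -sumrMnr; apply: eq_bigr => s _.
  have [->|->] := tE s; first by rewrite eqxx mulr0n.
  by rewrite nuN Np mulr1n.
rewrite mulrn_eq0 negb_or nuN Np andbT (bigD1 1%g)//= t1 nuN Np.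
by rewrite add1n.
Qed.

End VolumeForm.

Lemma modular_vf_unique (R : realType) (n : nat) (M : manifold R n) (pi : bivector M)
    (mu : form M n) (X Y : vfield M) : is_volume_form mu ->
  is_modular_vf pi mu X -> is_modular_vf pi mu Y -> X = Y.
Proof.
move=> mu0 mX mY; apply: vfield_eq => f; apply: Cinf_eq => p.
have [Z Zp] := mu0 p; apply: (mulIf Zp).
have := congr1 (fun h : Cinf M => h p : R) (etrans (esym (mX f Z)) (mY f Z)).
by rewrite !CinfM.
Qed.

(** The equivalence says more than vanishing: from right to left it exhibits a volume form and a
    modular field, so that a modular class exists and the forward implication is not vacuous. *)
Theorem corollary1p1 (R : realType) (n r q : nat) (P : manifold R n)
    (pi : bivector P) :
  is_poisson pi ->
  constant_rank pi r -> (r + q = n)%N ->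
  transversally_oriented pi q ->
  riemannian_foliation pi ->
  forall c : H1 pi, is_modular_class c <-> c = 0.
Proof.
move=> poisson rk rqn [nu nu0 nuT] [g bl] c; subst n.
split=> [[mu [phi [mu0 mphi ->]]]|->].
  have [F mF] := modular_hamiltonian rk poisson bl nu0 nuT mu0.
  by apply/H1_class_eq0; exists F; exact: modular_vf_unique mphi mF.
have [mu mu0] : exists mu : form P (r + q), is_volume_form mu.
  (* The parity of [r] is read off at a point; on an empty manifold the zero form is vacuously a
     volume form. *)
  have [[p]|noP] := pselect (inhabited P); last first.
    have lin0 : forall (Y : 'I_(r + q) -> vfield P) (i : 'I_(r + q)),
        linear (fun _ : vfield P => 0 : (Cinf P)^o).
      by move=> Y i a X X'; rewrite scaler0 addr0.
    exists (@Form R (r + q) P (r + q) (fun _ => 0) lin0 (fun _ _ _ _ _ => erefl)) => p.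
    by case: noP.
  have [f [N [[dW _ _] _]]] := adapted_frame rk g nu0 nuT p.
  have [k [_ [_ [rk2 _]]]] := darboux (eta_mx_skew pi g p f) (eta_mx_unit g rk dW).
  subst r; exact: volume_form_exists rk g nu nu0 nuT.
have [F mF] := modular_hamiltonian rk poisson bl nu0 nuT mu0.
exists mu, (PoissonVf (ham_poisson poisson F)); split=> //.
by apply/esym/H1_class_eq0; exists F.
Qed.
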